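(* Assume [H1], [H2] and [H3] (stated in the context), and let $v_n$, $\mu_n$, $v^{(N)}$, $\mu^{(N)}$ be as defined in the context. Let $\tau_0>0$ and $N\in\mathbb{N}$ be fixed. Then there exist a constant $C_N$ and a polynomial $P_N(t)$ such that for every $\tau\in(0,\tau_0]$ and every smooth function $\varphi:\mathbb{T}^d\to\mathbb{R}$, the discrete Euler process $(X_p)_{p\ge0}$ with step $\tau$ and $X_0=x$ satisfies $$\forall\,p\in\mathbb{N},\qquad\big\|\mathbb{E}\,\varphi(X_p)-v^{(N)}(t_p,x)\big\|_\infty\le C_N\,\tau^N\,\|\varphi\|_{\mathcal{C}^{8N+2}},$$ where $t_p=p\tau$. Moreover, $$\forall\,p\in\mathbb{N},\qquad\Big\|\mathbb{E}\,\varphi(X_p)-\int_{\mathbb{T}^d}\varphi(y)\,\mu^{(N)}(y)\,\mathrm{d}y\Big\|_\infty\le\big(P_N(t_p)e^{-\lambda t_p}+C_N\tau^N\big)\|\varphi\|_{\mathcal{C}^{8N+2}}.$$ Here $\|\cdot\|_\infty$ is the supremum over the initial point $x\in\mathbb{T}^d$ and $\lambda$ is the constant of [H3].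
   Context: Smooth means $\mathcal{C}^\infty$. On the $d$-dimensional torus $\mathbb{T}^d$ consider the SDE $\mathrm{d}X^i(t)=f^i(X(t))\,\mathrm{d}t+\sum_{\ell=1}^m\sigma^i_\ell(X(t))\,\mathrm{d}W^\ell(t)$, $i=1,\dots,d$, where $f=(f^i)$ and $\sigma=(\sigma^i_\ell)$ are smooth on $\mathbb{T}^d$ (periodic), and $W=(W^1,\dots,W^m)$ is a standard $m$-dimensional Wiener process on a filtered probability space. Generator (summation over repeated indices): $Lv(x)=f^i(x)\partial_iv(x)+a^{ij}(x)\partial_{ij}v(x)$, with $a^{ij}(x)=\frac12\sum_{\ell=1}^m\sigma^i_\ell(x)\sigma^j_\ell(x)$. For a differential operator $B$, $B^*$ is its adjoint with respect to the $L^2(\mathbb{T}^d,\mathrm{d}x)$ product. For smooth $\varphi$, $u(t,x)$ is the unique solution of $\partial_tu=Lu$, $u(0,x)=\varphi(x)$, written $u(t)=P_t\varphi$. Norms: $\|\psi\|_\infty=\sup_{x\in\mathbb{T}^d}|\psi(x)|$, $\|\psi\|_{\mathcal{C}^k}=\sup_{|\boldsymbol{j}|\le k}\|\partial_{\boldsymbol{j}}\psi\|_\infty$ (multi-indices $\boldsymbol{j}\in\mathbb{N}^d$). Standing hypotheses: [H1] There exists $\rho\in\mathcal{C}^\infty(\mathbb{T}^d,\mathbb{R})$, $\rho\ge0$, with $L^*\rho=0$ and $\int_{\mathbb{T}^d}\rho\,\mathrm{d}x=1$. [H2] For every $g\in\mathcal{C}^\infty(\mathbb{T}^d,\mathbb{R})$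 with $\int_{\mathbb{T}^d}g\,\mathrm{d}x=0$ there exists a unique $\mu\in\mathcal{C}^\infty(\mathbb{T}^d,\mathbb{R})$ with $L^*\mu=g$ and $\int_{\mathbb{T}^d}\mu(x)\rho(x)\,\mathrm{d}x=0$. [H3] There exist a constant $\lambda>0$ and, for each $k\in\mathbb{N}$, a polynomial $p_k(t)$ such that for every $\varphi\in\mathcal{C}^\infty(\mathbb{T}^d,\mathbb{R})$ with $\int_{\mathbb{T}^d}\varphi\rho\,\mathrm{d}x=0$, $\|u(t,\cdot)\|_{\mathcal{C}^k}\le p_k(t)e^{-\lambda t}\|\varphi\|_{\mathcal{C}^k}$ for all $t\ge0$. Euler scheme with step $\tau>0$: $X_0=x\in\mathbb{T}^d$ and $X^i_{n+1}=X^i_n+\tau f^i(X_n)+\sigma^i_\ell(X_n)\big(W^\ell((n+1)\tau)-W^\ell(n\tau)\big)$, $n\ge0$ (points taken in $\mathbb{T}^d$). One step from $x$: $\tilde X^i_x(\tau)=x^i+\tau f^i(x)+\sigma^i_\ell(x)W^\ell(\tau)$. Operators $A_n$: these are the differential operators of order $2n$ with smooth coefficients giving the expansion $\mathbb{E}\,\varphi(\tilde X_x(\tau))=\sum_{n=0}^N\tau^nA_n\varphi(x)+O(\tau^{N+1})$ for all smooth $\varphi$ and all $N$. Explicitly, for $y\in\mathbb{T}^d$ let $\mathcal{L}_y=f^i(y)\partial_i+a^{ij}(y)\partial_{ij}$ (constant coefficients frozen at $y$); then $(A_n\varphi)(x)=\frac1{n!}\big((\mathcal{L}_x)^n\varphi\big)(x)$.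 So $A_0=\mathrm{Id}$, $A_1=L$. Operators $L_n$: $L_0=L$ and, recursively for $n\ge1$, $$L_n=A_{n+1}+\sum_{\ell=1}^n\frac{B_\ell}{\ell!}\sum_{n_1+\cdots+n_\ell+n_{\ell+1}=n-\ell}L_{n_1}\cdots L_{n_\ell}A_{n_{\ell+1}+1},$$ with integers $n_i\ge0$ and $B_\ell$ the Bernoulli numbers, $\frac{z}{e^z-1}=\sum_{\ell\ge0}\frac{B_\ell}{\ell!}z^\ell$ (so $B_1=-\frac12$). Functions $v_n$: given smooth $\varphi$, $v_n(t,x)$, $t\ge0$, are the smooth functions solving $\partial_tv_n-Lv_n=\sum_{\ell=1}^nL_\ell v_{n-\ell}$ with $v_0(0,\cdot)=\varphi$ and $v_n(0,\cdot)=0$ for $n\ge1$; that is, $v_0(t)=P_t\varphi$ and $v_n(t)=\int_0^tP_{t-s}\big(\sum_{\ell=1}^nL_\ell v_{n-\ell}(s)\big)\,\mathrm{d}s$ for $n\ge1$. Set $v^{(N)}(t,x)=\sum_{n=0}^N\tau^nv_n(t,x)$. Functions $\mu_n$: $\mu_0=\rho$ and, for $n\ge1$, $\mu_n\in\mathcal{C}^\infty(\mathbb{T}^d,\mathbb{R})$ is the solution of $L^*\mu_n=-\sum_{\ell=1}^n(L_\ell)^*\mu_{n-\ell}$ with $\int_{\mathbb{T}^d}\mu_n(x)\,\mathrm{d}x=0$ (existence and uniqueness of $\mu_n$ follow from [H1]–[H2] and $L_\ell 1=0$). Set $\mu^{(N)}(x)=\rho(x)+\sum_{n=1}^N\tau^n\mu_n(x)$.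 Constants and polynomials may depend on $f$, $\sigma$, $N$ and $\tau_0$, but not on $\varphi$, $p$, $\tau$ or $x$. *)

(* Defs.v *)
From HB Require Import structures.
From mathcomp Require Import all_boot all_order all_algebra.
From mathcomp Require Import all_classical all_reals all_analysis.

Set Implicit Arguments.
Unset Strict Implicit.
Unset Printing Implicit Defensive.

Import Order.TTheory GRing.Theory Num.Theory.
Import numFieldNormedType.Exports.

Local Open Scope classical_set_scope.
Local Open Scope ring_scope.

(* The torus is R^d / Z^d: a function on it is a function on R^d which is
   1-periodic in each coordinate, and points of the torus are represented by
   arbitrary lifts to R^d. *)

Section Torus.
Context {R : realType}.

Definition partial (d : nat) (i : 'I_d) (psi : 'rV[R]_d -> R) : 'rV[R]_d -> R :=
  fun x => 'D_(delta_mx 0 i) psi x.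

Definition smooth (d : nat) (psi : 'rV[R]_d -> R) : Prop :=
  forall s : seq 'I_d, let g := foldr (@partial d) psi s in
    continuous g /\ forall (i : 'I_d) x, derivable g x (delta_mx 0 i).

Definition periodic (d : nat) (psi : 'rV[R]_d -> R) : Prop :=
  forall (i : 'I_d) x, psi (x + delta_mx 0 i) = psi x.

Definition torus_smooth (d : nat) (psi : 'rV[R]_d -> R) : Prop :=
  periodic psi /\ smooth psi.

(* Iterated integral over the fundamental domain [0, 1]^d; it is the Lebesgue
   integral over the torus for the continuous integrands it is used with. *)
Fixpoint torus_int (d : nat) : ('rV[R]_d -> R) -> R :=
  match d return ('rV[R]_d -> R) -> R with
  | 0 => fun psi => psi 0
  | d'.+1 => fun psi =>
      \int[lebesgue_measure]_(t in `[0%R, 1%R])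
        torus_int (fun y : 'rV[R]_d' => psi (row_mx (t%:M : 'rV[R]_1) y))
  end.

(* Norms take values in \bar R, so that they are honest suprema. *)
Definition supnorm (d : nat) (psi : 'rV[R]_d -> R) : \bar R :=
  ereal_sup [set `|psi x|%:E | x in [set: 'rV[R]_d]].

Definition mpartial (d : nat) (j : 'I_d -> nat) (psi : 'rV[R]_d -> R) :
    'rV[R]_d -> R :=
  foldr (fun i g => iter (j i) (@partial d i) g) psi (enum 'I_d).

Definition Cnorm (d k : nat) (psi : 'rV[R]_d -> R) : \bar R :=
  ereal_sup [set supnorm (mpartial j psi) |
              j in [set j : 'I_d -> nat | (\sum_i j i <= k)%N]].

(* B^* psi: the smooth function g with <B phi, psi> = <phi, g> for all smooth
   phi. There is at most one such g, and exactly one when B is a differential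
   operator with smooth coefficients and psi is smooth. *)
Definition adjoint (d : nat) (B : ('rV[R]_d -> R) -> ('rV[R]_d -> R))
    (psi : 'rV[R]_d -> R) : 'rV[R]_d -> R :=
  xget (cst 0) [set g | torus_smooth g /\
    forall phi, torus_smooth phi ->
      torus_int (fun x => B phi x * psi x) = torus_int (fun x => phi x * g x)].

End Torus.

Section Bernoulli.
Context {R : realType}.

(* bernoulli_seq n = [:: B_0; ...; B_n] *)
Fixpoint bernoulli_seq (n : nat) : seq R :=
  if n is n'.+1 then
    let s := bernoulli_seq n' in
    rcons s (- (n.+1)%:R^-1 * \sum_(k < n) 'C(n.+1, k)%:R * s`_k)
  else [:: 1].

Definition bernoulli (n : nat) : R := (bernoulli_seq n)`_n.

Lemma size_bernoulli_seq n : size (bernoulli_seq n) = n.+1.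
Proof. by elim: n => //= n IHn; rewrite size_rcons IHn. Qed.

Lemma nth_bernoulli_seq n k : (k <= n)%N -> (bernoulli_seq n)`_k = bernoulli k.
Proof.
elim: n => [|n IHn]; first by case: k.
rewrite leq_eqVlt => /predU1P[-> //|lt_kn].
by rewrite /= nth_rcons size_bernoulli_seq lt_kn IHn.
Qed.

Lemma bernoulli_rec n :
  \sum_(k < n.+1) 'C(n.+1, k)%:R * bernoulli k = (n == 0)%N%:R.
Proof.
case: n => [|n]; first by rewrite big_ord_recr big_ord0 /= add0r bin0 mul1r.
rewrite big_ord_recr /= {2}/bernoulli /= nth_rcons size_bernoulli_seq ltnn eqxx.
rewrite binSn.
rewrite mulrA mulrN divff ?pnatr_eq0// mulN1r.
apply/eqP; rewrite subr_eq0; apply/eqP/eq_bigr => k _.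
by rewrite nth_bernoulli_seq// -ltnS.
Qed.

(* Coefficient of z^(n+1) in (e^z - 1) * \sum_k B_k / k! z^k = z. *)
Lemma bernoulli_genfun n :
  \sum_(k < n.+1) (bernoulli k / k`!%:R) / (n.+1 - k)`!%:R = (n == 0)%N%:R.
Proof.
have fact_neq0 k : k`!%:R != 0 :> R by rewrite pnatr_eq0 -lt0n fact_gt0.
apply: (mulfI (fact_neq0 n.+1)); rewrite mulr_sumr.
transitivity ((n == 0)%N%:R : R); last by case: n => [|n]; rewrite ?mulr0 ?mulr1.
rewrite -[RHS]bernoulli_rec; apply: eq_bigr => k _.
have le_kn : (k <= n.+1)%N by rewrite ltnW.
rewrite -(bin_fact le_kn) !natrM.
rewrite -[bernoulli k / _ / _]mulrA -invfM -[LHS]mulrA; congr (_ * _).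
by rewrite [LHS]mulrC divfK// mulf_neq0.
Qed.

Lemma bernoulli1 : bernoulli 1 = - 2^-1.
Proof. by rewrite /bernoulli /= big_ord_recr big_ord0 /= add0r bin0 !mulr1. Qed.

End Bernoulli.

Section Diffusion.
Context {R : realType} {d m : nat}.
Variables (f : 'rV[R]_d -> 'rV[R]_d) (sigma : 'rV[R]_d -> 'M[R]_(d, m)).

Definition diffusion (x : 'rV[R]_d) (i j : 'I_d) : R :=
  2^-1 * \sum_(l < m) sigma x i l * sigma x j l.

Definition frozen_generator (y : 'rV[R]_d) (psi : 'rV[R]_d -> R) :
    'rV[R]_d -> R := fun x =>
  \sum_(i < d) f y 0 i * partial i psi x +
  \sum_(i < d) \sum_(j < d) diffusion y i j * partial i (partial j psi) x.

Definition generator (psi : 'rV[R]_d -> R) : 'rV[R]_d -> R :=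
  fun x => frozen_generator x psi x.

Definition Aop (n : nat) (psi : 'rV[R]_d -> R) : 'rV[R]_d -> R :=
  fun x => (n`!%:R)^-1 * iter n (frozen_generator x) psi x.

Lemma Aop0 psi : Aop 0 psi = psi.
Proof. by apply/funext => x; rewrite /Aop fact0 invr1 mul1r. Qed.

Lemma Aop1 psi : Aop 1 psi = generator psi.
Proof. by apply/funext => x; rewrite /Aop factS mul1n fact0 invr1 mul1r. Qed.

(* Right-hand side of the recursion for L_n, in terms of a given sequence of
   operators; t = (n_1, ..., n_l) and q = n_{l+1}. *)
Definition Lop_step (L : nat -> ('rV[R]_d -> R) -> 'rV[R]_d -> R) (n : nat)
    (psi : 'rV[R]_d -> R) : 'rV[R]_d -> R := fun x =>
  Aop n.+1 psi x +
  \sum_(1 <= l < n.+1) bernoulli l / l`!%:R *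
    \sum_(t : l.-tuple 'I_n.+1)
      \sum_(q < n.+1 | (\sum_(k <- t) k + q == n - l)%N)
        foldr (fun (k : 'I_n.+1) g => L k g) (Aop q.+1 psi) t x.

(* The recursion computing L_n only involves L_k with k < n; r is the recursion
   depth, and is irrelevant as soon as r >= n. *)
Fixpoint Lop_depth (r n : nat) : ('rV[R]_d -> R) -> 'rV[R]_d -> R :=
  match r, n with
  | r'.+1, _.+1 => Lop_step (Lop_depth r') n
  | _, _ => generator
  end.

Definition Lop (n : nat) := Lop_depth n n.

Lemma Lop0 : Lop 0 = generator. Proof. by []. Qed.

Lemma eq_Lop_step L L' n psi : (forall k, (k < n)%N -> L k = L' k) ->
  Lop_step L n psi = Lop_step L' n psi.
Proof.
move=> eqL; apply/funext => x; congr (_ + _).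
rewrite !big_nat; apply: eq_bigr => l /andP[l_gt0 le_ln].
congr (_ * _); apply: eq_bigr => t _; apply: eq_bigr => q /eqP sum_t.
have {le_ln} lt_n : (n - l < n)%N by rewrite ltn_subrL l_gt0 (leq_trans l_gt0).
have {sum_t} lt_tn (k : 'I_n.+1) : k \in tval t -> (k < n)%N.
  move=> tk; apply: leq_ltn_trans lt_n.
  by rewrite -sum_t (big_rem k tk) /= -addnA leq_addr.
congr (_ x); elim: (tval t) lt_tn => //= k s IHs lt_sn.
rewrite eqL ?IHs ?lt_sn ?mem_head// => j sj.
by apply: lt_sn; rewrite inE sj orbT.
Qed.

Lemma LopE n psi : (0 < n)%N -> Lop n psi = Lop_step Lop n psi.
Proof.
have stable r k : (k <= r)%N -> Lop_depth r k = Lop k.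
  elim/ltn_ind: k r => -[|k] IHk [|r]//; rewrite ltnS => le_kr.
  apply/funext => g; apply: eq_Lop_step => j; rewrite ltnS => le_jk.
  by transitivity (Lop j); [|symmetry]; apply: IHk => //; exact: leq_trans le_kr.
case: n => // n _; apply: eq_Lop_step => k; rewrite ltnS; exact: stable.
Qed.

(* Smoothness on [0, +oo[ x R^d, up to the boundary t = 0. *)
Definition smooth_half (u : R -> 'rV[R]_d -> R) : Prop :=
  exists2 V : 'rV[R]_(1 + d) -> R, smooth V &
    forall t x, 0 <= t -> u t x = V (row_mx (t%:M : 'rV[R]_1) x).

(* u is the smooth solution on [0, +oo[ x T^d of
   \partial_t u - L u = g, u(0) = phi. Only the values u t with 0 <= t matter;
   the equation extends to t = 0 by continuity. *)
Definition cauchy_solution (g : R -> 'rV[R]_d -> R) (phi : 'rV[R]_d -> R)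
    (u : R -> 'rV[R]_d -> R) : Prop :=
  [/\ smooth_half u,
      forall t, 0 <= t -> periodic (u t),
      u 0 = phi &
      forall t x, 0 < t -> derive1 (u ^~ x) t - generator (u t) x = g t x].

Definition is_expansion (phi : 'rV[R]_d -> R) (v : nat -> R -> 'rV[R]_d -> R) :
    Prop :=
  forall n, cauchy_solution
    (fun t x => \sum_(1 <= l < n.+1) Lop l (v (n - l)%N t) x)
    (if n is 0 then phi else cst 0) (v n).

Definition is_measure_expansion (rho : 'rV[R]_d -> R)
    (mu : nat -> 'rV[R]_d -> R) : Prop :=
  mu 0%N = rho /\
  forall n, (0 < n)%N ->
    [/\ torus_smooth (mu n),
        forall x, adjoint generator (mu n) x =
          - \sum_(1 <= l < n.+1) adjoint (Lop l) (mu (n - l)%N) x &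
        torus_int (mu n) = 0].

Definition invariant_density (rho : 'rV[R]_d -> R) : Prop :=
  [/\ torus_smooth rho, forall x, 0 <= rho x,
      adjoint generator rho = cst 0 & torus_int rho = 1].

Definition adjoint_solvable (rho : 'rV[R]_d -> R) : Prop :=
  forall g, torus_smooth g -> torus_int g = 0 ->
    exists! mu, [/\ torus_smooth mu, adjoint generator mu = g &
                    torus_int (fun x => mu x * rho x) = 0].

Definition exponential_decay (rho : 'rV[R]_d -> R) (lambda : R) : Prop :=
  0 < lambda /\
  forall k : nat, exists p : {poly R},
    forall phi, torus_smooth phi -> torus_int (fun x => phi x * rho x) = 0 ->
    forall u, cauchy_solution (fun _ => cst 0) phi u ->
    forall t, 0 <= t ->
      (Cnorm k (u t) <= (p.[t] * expR (- lambda * t))%:E * Cnorm k phi)%E.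

(* A lift to R^d of the Euler scheme on the torus; by periodicity of f and
   sigma its class modulo Z^d only depends on the class of x. *)
Fixpoint euler {Omega : Type} (W : 'I_m -> R -> Omega -> R) (tau : R)
    (x : 'rV[R]_d) (n : nat) (w : Omega) : 'rV[R]_d :=
  if n is n'.+1 then
    let X := euler W tau x n' w in
    \row_i (X 0 i + tau * f X 0 i +
            \sum_(l < m) sigma X i l * (W l (n%:R * tau) w - W l (n'%:R * tau) w))
  else x.

Definition euler_mean {dsp : measure_display} {Omega : measurableType dsp}
    (P : probability Omega R) (W : 'I_m -> R -> Omega -> R) (tau : R)
    (phi : 'rV[R]_d -> R) (p : nat) (x : 'rV[R]_d) : R :=
  fine ('E_P[fun w => phi (euler W tau x p w)])%E.

End Diffusion.

Definition partial_sum {R : realType} {T : Type} (tau : R) (N : nat)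
    (u : nat -> T -> R) : T -> R :=
  fun x => \sum_(n < N.+1) tau ^+ n * u n x.

Section Wiener.
Context {dsp : measure_display} {Omega : measurableType dsp} {R : realType}.

(* Time is indexed by R; only 0 <= t is relevant. *)
Definition is_filtration (F : R -> set (set Omega)) : Prop :=
  (forall t, 0 <= t -> sigma_algebra setT (F t) /\ F t `<=` measurable) /\
  (forall s t, 0 <= s -> s <= t -> F s `<=` F t).

Definition is_wiener (P : probability Omega R) (F : R -> set (set Omega))
    (m : nat) (W : 'I_m -> R -> Omega -> R) : Prop :=
  [/\ forall l t (B : set R), 0 <= t -> measurable B -> F t (W l t @^-1` B),
      {ae P, forall w, forall l, W l 0 w = 0},
      {ae P, forall w, forall l, {within `[0, +oo[, continuous (W l ^~ w)}} &
      (* A = setT says that W t - W s has law N(0, (t - s) I_m); the rest is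
         its independence from F s, tested on the pi-system of boxes. *)
      forall s t (A : set Omega) (B : 'I_m -> set R),
        0 <= s -> s < t -> F s A -> (forall l, measurable (B l)) ->
        P (A `&` [set w | forall l, B l (W l t w - W l s w)]) =
        (P A * \prod_(l < m) normal_prob 0 (Num.sqrt (t - s)) (B l))%E].

End Wiener.

(* Main.v *)
(* Freezing the coefficients at X_n turns one Euler step into the frozen diffusion Y_r
   started at X_n. With g_k(r) = E (L_x^k psi)(Y_r), where x = X_n is the freezing point,
   one has g_k' = g_(k+1), so Taylor's formula gives
   E psi(X_(n+1)) = \sum_k tau^k E (A_k psi)(X_n) + O(tau^(K+1)). Instead of Ito's formula
   this only uses the moments of Wiener increments of order at most 4: they yield
   g_k(r + h) - g_k(r) - h g_(k+1)(r) = O(h^(3/2)).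
   On the other hand the recursion for L_n says that exp (\sum_n tau^(n+1) L_n) and
   \sum_n tau^n A_n agree as formal series in tau, so v^(N)(t + tau) has the same Taylor
   expansion up to order N. As v_n(t) tends to \int phi mu_n exponentially fast and all
   operators involved kill constants, the local error is O(tau^(N+1) e^(-lambda t / 2)),
   which sums to O(tau^N) uniformly in p.
   The decay of v_n is proved by induction on n with Duhamel's formula in discretised form. *)
From HB Require Import structures.
Require Import Defs.
From mathcomp Require Import all_boot all_order all_algebra.
From mathcomp Require Import all_classical all_reals all_analysis.
From mathcomp Require Import measurable_realfun ring lra zify.

Set Implicit Arguments.
Unset Strict Implicit.
Unset Printing Implicit Defensive.

Import Order.TTheory GRing.Theory Num.Theory.
Import numFieldNormedType.Exports.

Local Open Scope classical_set_scope.
Local Open Scope ring_scope.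

(** * One-dimensional Taylor estimates *)

Section RealCalculus.
Context {R : realType}.
Implicit Types (g h dg dh : R -> R).

(** Three obstacles shape the development. The v_n are known only for t >= 0 and [smooth] speaks
    only of partial derivatives, so calculus in time runs through smooth extensions to space-time,
    of which only the values at t >= 0 matter. Neither conditional expectations nor the Markov
    property appear: freezing point and evaluation point are adapted random variables, estimates are
    uniform over deterministic freezing points, and independence enters only through low moments of
    increments against adapted factors. Function-valued integrals are avoided: a quantity whose
    increments over steps h are O(h^2) is constant, which yields the conservation laws, and
    Duhamel's formula becomes a telescoping sum whose discretisation error vanishes in the limit.
    Derivative count: L_n has order 2n+2, so v_i is controlled by 4i derivatives of the data;
    expanding tau^i v_i to order N+1-i costs 2(N+1-i) more, and 4i + 2(N+1-i) <= 4N+2. The bounds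
    are proved with C^(4N+2), which C^(8N+2) dominates. The rate lambda/2 absorbs the polynomials in
    t before the local errors are summed. *)

Lemma increment_le g dg h dh (a b : R) : a <= b ->
  {within `[a, b], continuous g} -> {within `[a, b], continuous h} ->
  (forall x, x \in `]a, b[ -> is_derive x 1 g (dg x)) ->
  (forall x, x \in `]a, b[ -> is_derive x 1 h (dh x)) ->
  (forall x, x \in `]a, b[ -> dg x <= dh x) ->
  g b - g a <= h b - h a.
Proof.
rewrite le_eqVlt => /predU1P[->|ab] cg ch Dg Dh dgh; first by rewrite !subrr.
have [||c cab E] := @MVT R (h - g) (fun x => dh x - dg x) a b ab.
- by move=> x xab; apply: is_deriveB; [exact: Dh|exact: Dg].
- by move=> x; apply: cvgB; [exact: ch|exact: cg].
have : 0 <= (h - g) b - (h - g) a.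
  by rewrite E mulr_ge0// subr_ge0 ?dgh// ltW.
rewrite !fctE; lra.
Qed.

Lemma norm_increment_le g dg h dh (a b : R) : a <= b ->
  {within `[a, b], continuous g} -> {within `[a, b], continuous h} ->
  (forall x, x \in `]a, b[ -> is_derive x 1 g (dg x)) ->
  (forall x, x \in `]a, b[ -> is_derive x 1 h (dh x)) ->
  (forall x, x \in `]a, b[ -> `|dg x| <= dh x) ->
  `|g b - g a| <= h b - h a.
Proof.
move=> ab cg ch Dg Dh dgh; rewrite ler_norml; apply/andP; split; last first.
  apply: (increment_le ab cg ch Dg Dh) => x xab.
  exact: le_trans (ler_norm _) (dgh x xab).
have := @increment_le (- g) (fun x => - dg x) h dh a b ab.
rewrite lerNl opprB => /(_ _ ch _ Dh) H; have {H} : - g b - - g a <= h b - h a.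
  apply: H => x xab.
  - by apply: cvgN; exact: cg.
  - by apply: is_deriveN; exact: Dg.
  - by apply: le_trans (dgh x xab); rewrite -normrN ler_norm.
by rewrite /= opprK addrC.
Qed.

Definition taylor_mono (a : R) (j : nat) (x : R) : R := (x - a) ^+ j / j`!%:R.

Lemma is_derive_taylor_mono (a : R) j (x : R) :
  is_derive x 1 (taylor_mono a j.+1) (taylor_mono a j x).
Proof.
have -> : taylor_mono a j.+1 =
    (j.+1`!%:R^-1 : R) \*: ((id - cst a) ^+ j.+1).
  by apply/funext => y; rewrite /taylor_mono/= fctE/= [RHS]mulrC /GRing.exp/=.
apply: is_derive_eq.
rewrite /= subr0 /taylor_mono factS natrM /GRing.scale /= mulr1 !fctE.
by field; rewrite nat1r !pnatr_eq0 -lt0n fact_gt0.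
Qed.

Lemma is_derive_taylor_mono0 (a x : R) : is_derive x 1 (taylor_mono a 0) 0.
Proof.
have -> : taylor_mono a 0 = cst 1.
  by apply/funext => y; rewrite /taylor_mono fact0 expr0 divr1.
exact: is_derive_cst.
Qed.

Lemma taylor_mono_id (a : R) j : taylor_mono a j a = (j == 0)%N%:R.
Proof.
rewrite /taylor_mono subrr expr0n; case: j => [|j]; last by rewrite mul0r.
by rewrite divr1.
Qed.

Lemma continuous_taylor_mono (a : R) j : continuous (taylor_mono a j).
Proof.
move=> x; apply: differentiable_continuous; apply/derivable1_diffP.
case: j => [|j]; first exact: (@ex_derive _ _ _ _ _ _ _ (is_derive_taylor_mono0 a x)).
exact: (@ex_derive _ _ _ _ _ _ _ (is_derive_taylor_mono a j x)).
Qed.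

Definition taylor_sum (u : nat -> R -> R) (K : nat) (a x : R) : R :=
  \sum_(j < K) taylor_mono a j x * u j a.

Lemma is_derive_taylor_sum u K (a x : R) :
  is_derive x 1 (taylor_sum u K.+1 a) (taylor_sum (fun j => u j.+1) K a x).
Proof.
have -> : taylor_sum u K.+1 a =
    \sum_(j < K.+1) (cst (u j a) * (taylor_mono a j)).
  by apply/funext => y; rewrite fct_sumE; apply: eq_bigr => j _; rewrite mulrC.
pose dm (j : 'I_K.+1) := if (j : nat) is j'.+1 then taylor_mono a j' x else 0.
have -> : taylor_sum (fun j => u j.+1) K a x = \sum_(j < K.+1) u j a * dm j.
  rewrite big_ord_recl /= mulr0 add0r; apply: eq_bigr => j _.
  by rewrite mulrC.
apply: is_derive_sum => j; rewrite /dm; case: j => -[|j] /= ?.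
  have D := is_derive_taylor_mono0 a x.
  by apply: is_derive_eq; rewrite !scaler0 mulr0 addr0.
have D := is_derive_taylor_mono a j x.
by apply: is_derive_eq; rewrite scaler0 addr0.
Qed.

Lemma continuous_taylor_sum u K (a : R) : continuous (taylor_sum u K a).
Proof.
case: K => [|K] x.
  rewrite (_ : taylor_sum u 0 a = cst 0); first exact: cst_continuous.
  by apply/funext => y; rewrite /taylor_sum big_ord0.
apply: differentiable_continuous; apply/derivable1_diffP.
exact: (@ex_derive _ _ _ _ _ _ _ (is_derive_taylor_sum u K a x)).
Qed.

Lemma taylor_sum_id u K (a : R) : taylor_sum u K.+1 a a = u 0%N a.
Proof.
rewrite /taylor_sum big_ord_recl /= taylor_mono_id eqxx mul1r big1 ?addr0// => j _.
by rewrite taylor_mono_id /= mul0r.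
Qed.

(** Induction on [K]: the bound for the shifted family controls the derivative of the remainder of
    [u 0], and comparison with the increments of [M \*: taylor_mono a K.+1] integrates it.
    Derivatives are needed in the open interval only, so [a] may be the initial time. *)
Lemma taylor_bound (u : nat -> R -> R) K (a b M : R) : a <= b ->
  (forall k, (k < K)%N -> {within `[a, b], continuous (u k)}) ->
  (forall k x, (k < K)%N -> x \in `]a, b[ -> is_derive x 1 (u k) (u k.+1 x)) ->
  (forall x, x \in `[a, b] -> `|u K x| <= M) ->
  `|u 0%N b - taylor_sum u K a b| <= M * taylor_mono a K b.
Proof.
elim: K u b => [|K IH] u b ab cu Du uM.
  by rewrite /taylor_sum big_ord0 subr0 /taylor_mono fact0 divr1 mulr1 uM// in_itv/= ab lexx.
have subP x c : x \in `]a, b[ -> c \in `[a, x] -> c \in `[a, b].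
  by rewrite !in_itv/= => /andP[_ xb] /andP[-> /le_trans->]//; exact: ltW.
have subO x c : x \in `]a, b[ -> c \in `]a, x[ -> c \in `]a, b[.
  by rewrite !in_itv/= => /andP[_ xb] /andP[-> /lt_trans->].
have bnd x : x \in `]a, b[ ->
    `|u 1 x - taylor_sum (fun j => u j.+1) K a x| <= M * taylor_mono a K x.
  move=> xab; refine (IH (fun j => u j.+1) x _ _ _ _).
  - by move: xab; rewrite in_itv/= => /andP[/ltW].
  - move=> k kK; apply: (@continuous_subspaceW _ _ _ `[a, b]) => //; last exact: cu.
    by move=> c /=; exact: subP.
  - by move=> k c kK cx; apply: Du => //; exact: subO cx.
  - by move=> c cx; apply: uM; exact: subP cx.
have H := @norm_increment_le (u 0%N - taylor_sum u K.+1 a)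
  (fun x => u 1 x - taylor_sum (fun j => u j.+1) K a x)
  (M \*: taylor_mono a K.+1) (fun x => M * taylor_mono a K x) a b ab.
have {H} : `|(u 0%N b - taylor_sum u K.+1 a b) - (u 0%N a - taylor_sum u K.+1 a a)|
    <= M * taylor_mono a K.+1 b - M * taylor_mono a K.+1 a.
  apply: H.
  - move=> x; apply: cvgB; first exact: cu.
    by apply: continuous_subspaceT; exact: continuous_taylor_sum.
  - move=> x; apply: cvgZr; apply: continuous_subspaceT.
    exact: continuous_taylor_mono.
  - move=> x xab; apply: is_deriveB; first exact: Du.
    exact: is_derive_taylor_sum.
  - move=> x xab; apply: is_deriveZ; exact: is_derive_taylor_mono.
  - exact: bnd.
by rewrite taylor_sum_id taylor_mono_id /= mulr0 !subrr !subr0.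
Qed.

(** Cutting [0, T] into n+1 equal steps bounds the total increment by C T^2 / (n+1), for every n.
    This replaces a vanishing derivative in the conservation laws. *)
Lemma quadratic_increment_const (J : R -> R) (T C : R) : 0 <= T ->
  (forall t h : R, 0 <= t -> 0 <= h -> t + h <= T -> `|J (t + h) - J t| <= C * h ^+ 2) ->
  J T = J 0.
Proof.
move=> T0 HJ.
have step n : `|J T - J 0| <= C * T ^+ 2 / n.+1%:R.
  pose h := T / n.+1%:R.
  have h0 : 0 <= h by rewrite divr_ge0.
  have TE : T = n.+1%:R * h by rewrite /h mulrCA divff ?mulr1.
  have H k : (k <= n.+1)%N -> `|J (k%:R * h) - J 0| <= k%:R * (C * h ^+ 2).
    elim: k => [|k IH] kn; first by rewrite !mul0r subrr normr0.
    rewrite -[X in J X - _](_ : k%:R * h + h = _); last by rewrite -natr1 mulrDl mul1r.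
    rewrite -natr1 mulrDl mul1r.
    have -> : J (k%:R * h + h) - J 0 = (J (k%:R * h) - J 0) + (J (k%:R * h + h) - J (k%:R * h)) by ring.
    apply: le_trans (ler_normD _ _) _; apply: lerD; first exact: IH (ltnW kn).
    apply: HJ => //; first by rewrite mulr_ge0.
    by rewrite TE -[X in _ + X]mul1r -mulrDl natr1 ler_wpM2r// ler_nat.
  rewrite {1}TE; apply: le_trans (H _ (leqnn _)) _.
  rewrite le_eqVlt; apply/orP; left; apply/eqP; rewrite /h; field.
  by rewrite nat1r.
apply/eqP; rewrite -subr_eq0 -normr_le0; apply/ler_addgt0Pl => e e0; rewrite addr0.
have [n Hn] : exists n : nat, `|C * T ^+ 2| / e < n.+1%:R.
  exists (Num.bound (`|C * T ^+ 2| / e)).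
  apply: lt_le_trans (archi_boundP _) _; first by rewrite divr_ge0// ltW.
  by rewrite ler_nat.
apply: le_trans (step n) _; rewrite ler_pdivrMr//.
move: Hn; rewrite ltr_pdivrMr// => /ltW; rewrite [X in _ <= X -> _]mulrC; apply: le_trans.
exact: ler_norm.
Qed.

End RealCalculus.

(** * Smooth functions *)

Section SmoothFunctions.
Context {R : realType}.

(** Derivatives are indexed by words rather than multi-indices, so that composition is
    concatenation; symmetry is needed only to return to [Cnorm]. *)
Definition D d (s : seq 'I_d) (psi : 'rV[R]_d -> R) := foldr (@partial R d) psi s.

Arguments D : simpl never.

Lemma D_cons d (s : seq 'I_d) i psi : D (i :: s) psi = partial i (D s psi).
Proof. by []. Qed.

Lemma D_rcons d (s : seq 'I_d) i psi : D (rcons s i) psi = D s (partial i psi).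
Proof. by rewrite /D foldr_rcons. Qed.

Lemma D_cat d (s t : seq 'I_d) psi : D (s ++ t) psi = D s (D t psi).
Proof. by rewrite /D foldr_cat. Qed.

Lemma smooth_continuous d (psi : 'rV[R]_d -> R) : smooth psi -> continuous psi.
Proof. by move=> /(_ [::]) []. Qed.

Lemma smooth_derivable d (psi : 'rV[R]_d -> R) (i : 'I_d) x :
  smooth psi -> derivable psi x (delta_mx 0 i).
Proof. by move=> /(_ [::]) [_]; apply. Qed.

Lemma smooth_D d (psi : 'rV[R]_d -> R) s : smooth psi -> smooth (D s psi).
Proof. by move=> h t; have := h (t ++ s); rewrite -/(D _ _) D_cat. Qed.

Lemma smooth_partial d (psi : 'rV[R]_d -> R) i : smooth psi -> smooth (partial i psi).
Proof. exact: (smooth_D [:: i]). Qed.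

Lemma is_derive_partial d (psi : 'rV[R]_d -> R) i x : smooth psi ->
  is_derive x (delta_mx 0 i) psi (partial i psi x).
Proof. by move=> sp; apply: DeriveDef; first exact: smooth_derivable. Qed.

Lemma is_derive_partialE d (psi : 'rV[R]_d -> R) i x a :
  is_derive x (delta_mx 0 i) psi a -> partial i psi x = a.
Proof. by move=> h; exact: derive_val. Qed.

(** [smooth] quantifies over all words at once; grading it by length permits inductions that peel
    off the innermost derivative. *)
Definition Ck d n (psi : 'rV[R]_d -> R) := forall s : seq 'I_d, (size s <= n)%N ->
  continuous (D s psi) /\ forall (i : 'I_d) x, derivable (D s psi) x (delta_mx 0 i).

Lemma smoothP d (psi : 'rV[R]_d -> R) : smooth psi <-> forall n, Ck n psi.
Proof. by split => [h n s _|h s]; [exact: h | exact: (h (size s))]. Qed.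

Lemma Ck0P d (psi : 'rV[R]_d -> R) : Ck 0 psi <->
  continuous psi /\ forall (i : 'I_d) x, derivable psi x (delta_mx 0 i).
Proof.
by split => [/(_ [::] isT)//|h s]; rewrite leqn0 => /nilP ->.
Qed.

Lemma CkS d n (psi : 'rV[R]_d -> R) : Ck 0 psi ->
  (forall i, Ck n (partial i psi)) -> Ck n.+1 psi.
Proof.
move=> h0 h s; elim/last_ind: s => [_|s i _]; first exact: (h0 [::]).
by rewrite size_rcons ltnS D_rcons; exact: h.
Qed.

Lemma Ck_partial d n (psi : 'rV[R]_d -> R) i : Ck n.+1 psi -> Ck n (partial i psi).
Proof.
by move=> h s sn; have := h (rcons s i); rewrite size_rcons ltnS D_rcons; exact.
Qed.

Lemma CkW d n (psi : 'rV[R]_d -> R) : Ck n psi -> Ck 0 psi.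
Proof. by move=> h s; rewrite leqn0 => /nilP ->; exact: h. Qed.

Lemma Ck_cst d n (c : R) : Ck n (cst c : 'rV[R]_d -> R).
Proof.
have h0 e : Ck 0 (cst e : 'rV[R]_d -> R).
  move=> s; rewrite leqn0 => /nilP ->; split; first exact: cst_continuous.
  by move=> i x; exact: derivable_cst.
elim: n c => // n IH c; apply: CkS => // i.
suff -> : partial i (cst c : 'rV[R]_d -> R) = cst 0 by exact: IH.
by apply/funext => x; exact: derive_cst.
Qed.

Lemma CkD d n (psi chi : 'rV[R]_d -> R) : Ck n psi -> Ck n chi ->
  Ck n (fun x => psi x + chi x).
Proof.
have h0 (u v : 'rV[R]_d -> R) : Ck 0 u -> Ck 0 v -> Ck 0 (fun x => u x + v x).
  move=> /Ck0P[cu du] /Ck0P[cv dv]; apply/Ck0P; split.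
    by move=> x; exact: (cvgD (cu x) (cv x)).
  by move=> i x; apply: derivableD; [exact: du|exact: dv].
elim: n psi chi => [|n IH] u v hu hv; first exact: h0.
apply: CkS => [|i]; first by apply: h0; [exact: CkW hu|exact: CkW hv].
suff -> : partial i (fun x => u x + v x) = (fun x => partial i u x + partial i v x).
  by apply: IH; exact: Ck_partial.
apply/funext => x; apply: deriveD.
  by have /Ck0P[_] := CkW hu; exact.
by have /Ck0P[_] := CkW hv; exact.
Qed.

Lemma CkM d n (psi chi : 'rV[R]_d -> R) : Ck n psi -> Ck n chi ->
  Ck n (fun x => psi x * chi x).
Proof.
have h0 (u v : 'rV[R]_d -> R) : Ck 0 u -> Ck 0 v -> Ck 0 (fun x => u x * v x).
  move=> /Ck0P[cu du] /Ck0P[cv dv]; apply/Ck0P; split.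
    by move=> x; exact: (cvgM (cu x) (cv x)).
  by move=> i x; apply: derivableM; [exact: du|exact: dv].
elim: n psi chi => [|n IH] u v hu hv; first exact: h0.
apply: CkS => [|i]; first by apply: h0; [exact: CkW hu|exact: CkW hv].
have dE : partial i (fun x => u x * v x) =
    (fun x => u x * partial i v x + v x * partial i u x).
  apply/funext => x; apply: deriveM.
    by have /Ck0P[_] := CkW hu; exact.
  by have /Ck0P[_] := CkW hv; exact.
have le (w : 'rV[R]_d -> R) : Ck n.+1 w -> Ck n w.
  by move=> hw s sn; apply: hw; exact: leqW.
rewrite dE; exact: (CkD (IH _ _ (le _ hu) (Ck_partial i hv)) (IH _ _ (le _ hv) (Ck_partial i hu))).
Qed.

Lemma smooth_cst d c : smooth (cst c : 'rV[R]_d -> R).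
Proof. by apply/smoothP => n; exact: Ck_cst. Qed.

Lemma smoothD d (psi chi : 'rV[R]_d -> R) : smooth psi -> smooth chi ->
  smooth (fun x => psi x + chi x).
Proof. by move=> /smoothP hp /smoothP hc; apply/smoothP => n; exact: CkD. Qed.

Lemma smoothM d (psi chi : 'rV[R]_d -> R) : smooth psi -> smooth chi ->
  smooth (fun x => psi x * chi x).
Proof. by move=> /smoothP hp /smoothP hc; apply/smoothP => n; exact: CkM. Qed.

Lemma partialD d i (psi chi : 'rV[R]_d -> R) : smooth psi -> smooth chi ->
  partial i (fun x => psi x + chi x) = (fun x => partial i psi x + partial i chi x).
Proof. by move=> hp hc; apply/funext => x; apply: deriveD; exact: smooth_derivable. Qed.

Lemma partialM d i (psi chi : 'rV[R]_d -> R) : smooth psi -> smooth chi ->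
  partial i (fun x => psi x * chi x) =
  (fun x => psi x * partial i chi x + chi x * partial i psi x).
Proof. by move=> hp hc; apply/funext => x; apply: deriveM; exact: smooth_derivable. Qed.

Lemma partial_cst d i (c : R) : partial i (cst c : 'rV[R]_d -> R) = cst 0.
Proof. by apply/funext => x; exact: derive_cst. Qed.

#[local] Opaque smooth partial.

Lemma partialZ d i (psi : 'rV[R]_d -> R) c : smooth psi ->
  partial i (fun x => c * psi x) = (fun x => c * partial i psi x).
Proof.
move=> hp; rewrite (partialM i (smooth_cst c) hp); apply/funext => x.
by rewrite partial_cst /= mulr0 addr0.
Qed.

Lemma smoothZ d (psi : 'rV[R]_d -> R) c : smooth psi -> smooth (fun x => c * psi x).
Proof. exact: (smoothM (smooth_cst c)). Qed.

Lemma DD d s (psi chi : 'rV[R]_d -> R) : smooth psi -> smooth chi ->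
  D s (fun x => psi x + chi x) = (fun x => D s psi x + D s chi x).
Proof.
move=> hp hc; elim: s => // i s; rewrite !D_cons => ->.
by rewrite (partialD i (smooth_D s hp) (smooth_D s hc)).
Qed.

Lemma DZ d s (psi : 'rV[R]_d -> R) c : smooth psi ->
  D s (fun x => c * psi x) = (fun x => c * D s psi x).
Proof.
move=> hp; elim: s => // i s; rewrite !D_cons => ->.
by rewrite (partialZ i c (smooth_D s hp)).
Qed.

Lemma D_cst d s (c : R) : D s (cst c : 'rV[R]_d -> R) = if s is [::] then cst c else cst 0.
Proof.
by elim: s => // i s; rewrite D_cons => ->; case: s => [|j s]; rewrite partial_cst.
Qed.

Lemma is_derive_line (V : normedModType R) (psi : V -> R) (x v : V) (t a : R) :
  is_derive (x + t *: v) v psi a -> is_derive t 1 (fun s : R => psi (x + s *: v)) a.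
Proof.
move=> [dpsi <-].
have E : (fun h : R => h^-1 *: (((fun s : R => psi (x + s *: v)) \o shift t) (h *: (1 : R)) -
      psi (x + t *: v))) =
    (fun h : R => h^-1 *: ((psi \o shift (x + t *: v)) (h *: v) - psi (x + t *: v))).
  apply/funext => h; congr (_ *: (_ - _)) => /=.
  by rewrite [_ *: 1]mulr1 scalerDl addrCA.
by apply: DeriveDef; rewrite /derivable /derive E.
Qed.

Lemma is_derive_translate (V : normedModType R) (psi : V -> R) (x v w : V) (a : R) :
  is_derive (x + w) v psi a -> is_derive x v (fun y => psi (y + w)) a.
Proof.
move=> [dpsi <-].
have E : (fun h : R => h^-1 *: (((fun y => psi (y + w)) \o shift x) (h *: v) - psi (x + w)))
    = (fun h : R => h^-1 *: ((psi \o shift (x + w)) (h *: v) - psi (x + w))).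
  by apply/funext => h; congr (_ *: (_ - _)) => /=; rewrite addrA.
by apply: DeriveDef; rewrite /derivable /derive E.
Qed.

Lemma MVT_line (V : normedModType R) (psi dpsi : V -> R) (x v : V) (h : R) : 0 < h ->
  (forall y, is_derive y v psi (dpsi y)) ->
  exists2 c, 0 <= c <= h & psi (x + h *: v) - psi x = h * dpsi (x + c *: v).
Proof.
move=> h0 Dp.
have [|| c ch E] := @MVT R (fun s => psi (x + s *: v)) (fun s => dpsi (x + s *: v)) _ _ h0.
- by move=> s _; apply: is_derive_line.
- apply: continuous_subspaceT => s; apply: differentiable_continuous.
  apply/derivable1_diffP; apply: ex_derive; exact: is_derive_line (Dp _).
exists c; last by move: E; rewrite scale0r addr0 subr0 mulrC.
by move: ch; rewrite in_itv/= => /andP[/ltW -> /ltW ->].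
Qed.

(** The second difference over a square of side h is symmetric in i and j, and equals h^2 times
    either mixed derivative at a point of the square; continuity then lets h shrink. *)
Lemma schwarz d (psi : 'rV[R]_d -> R) i j : smooth psi ->
  partial i (partial j psi) = partial j (partial i psi).
Proof.
move=> sp; apply/funext => x.
pose ei : 'rV[R]_d := delta_mx 0 i; pose ej : 'rV[R]_d := delta_mx 0 j.
have si := smooth_partial i sp; have sj := smooth_partial j sp.
(* Two mean value theorems: along a for the difference psi(y + h e_b) - psi(y), then along b for the
   partial derivative in direction a. *)
have key (a b : 'I_d) (h : R) : 0 < h -> exists c1 c2,
    [/\ 0 <= c1 <= h, 0 <= c2 <= h &
    psi (x + h *: delta_mx 0 a + h *: delta_mx 0 b) - psi (x + h *: delta_mx 0 b)
    - psi (x + h *: delta_mx 0 a) + psi x = h ^+ 2 * partial b (partial a psi)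
      (x + c1 *: delta_mx 0 a + c2 *: delta_mx 0 b)].
  move=> h0.
  have D1 (y : 'rV[R]_d) : is_derive y (delta_mx 0 a) (fun y => psi (y + h *: delta_mx 0 b) - psi y)
      (partial a psi (y + h *: delta_mx 0 b) - partial a psi y).
    apply: is_deriveB; last exact: is_derive_partial.
    exact: is_derive_translate (is_derive_partial _ _ sp).
  have [c1 c1h E1] := MVT_line x h0 D1.
  have [c2 c2h E2] := MVT_line (x + c1 *: delta_mx 0 a) h0
    (fun y => is_derive_partial b y (smooth_partial a sp)).
  exists c1, c2; split => //.
  rewrite expr2 -mulrA -E2 -E1; ring.
have cont a b : forall e : R, 0 < e -> exists2 dl : R, 0 < dl &
    forall c1 c2, 0 <= c1 <= dl -> 0 <= c2 <= dl ->
     `|partial b (partial a psi) x - partial b (partial a psi) (x + c1 *: delta_mx 0 a + c2 *: delta_mx 0 b)| < e.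
  move=> e e0.
  have := @smooth_continuous d _ (smooth_partial b (smooth_partial a sp)) x.
  move=> /cvgrPdist_lt /(_ e e0) /nbhs_ballP [r /= r0 hr].
  have Mp : 0 < `|delta_mx 0 a : 'rV[R]_d| + `|delta_mx 0 b : 'rV[R]_d| + 1.
    by rewrite ltr_wpDl// addr_ge0.
  exists (r / (`|delta_mx 0 a : 'rV[R]_d| + `|delta_mx 0 b : 'rV[R]_d| + 1) / 2).
    by rewrite !divr_gt0.
  move=> c1 c2 /andP[c10 c1d] /andP[c20 c2d]; apply: hr.
  rewrite -ball_normE /ball_/= -addrA opprD addrA subrr add0r normrN.
  apply: le_lt_trans (ler_normD _ _) _; rewrite !normrZ !ger0_norm//.
  set dl := r / _ / 2 in c1d c2d.
  apply: (@le_lt_trans _ _ (dl * (`|delta_mx 0 a : 'rV[R]_d| + `|delta_mx 0 b : 'rV[R]_d| + 1))).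
    rewrite mulrDr mulrDr -[leLHS]addr0 lerD//; last first.
      by rewrite mulr1 (le_trans c10 c1d).
    by rewrite lerD// ler_wpM2r.
  rewrite /dl mulrAC divfK ?gt_eqF// ltr_pdivrMr// mulr2n mulrDr mulr1.
  by rewrite ltrDl.
apply/eqP; rewrite -subr_eq0 -normr_le0; apply/ler_addgt0Pl => e e0; rewrite addr0.
have e2 : 0 < e / 2 by rewrite divr_gt0.
have [d1 d10 h1] := cont j i _ e2; have [d2 d20 h2] := cont i j _ e2.
pose h := Num.min d1 d2; have h0 : 0 < h by rewrite lt_min d10.
have [a1 [a2 [a1h a2h Ea]]] := key j i h h0; have [b1 [b2 [b1h b2h Eb]]] := key i j h h0.
have le1 c : 0 <= c <= h -> 0 <= c <= d1.
  by case/andP=> -> /le_trans; apply; rewrite ge_min lexx.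
have le2 c : 0 <= c <= h -> 0 <= c <= d2.
  by case/andP=> -> /le_trans; apply; rewrite ge_min lexx orbT.
have := h1 _ _ (le1 _ a1h) (le1 _ a2h); have := h2 _ _ (le2 _ b1h) (le2 _ b2h).
(* Both values are the same second difference divided by h^2. *)
have -> : partial j (partial i psi) (x + b1 *: delta_mx 0 i + b2 *: delta_mx 0 j) =
   partial i (partial j psi) (x + a1 *: delta_mx 0 j + a2 *: delta_mx 0 i).
  have hn0 : h ^+ 2 != 0 by rewrite expf_neq0// gt_eqF.
  apply: (mulfI hn0); refine (etrans (esym Eb) (etrans _ Ea)).
  by rewrite (addrAC x (h *: delta_mx 0 i)); congr (_ + psi x); exact: addrAC.
set A := partial i _ x; set B := partial j _ x; set Z := partial i _ _.
move: A B Z => A B Z HB HA.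
have -> : A - B = (A - Z) - (B - Z) by ring.
apply: le_trans (ler_normB _ _) _; rewrite [leRHS]splitr; apply: lerD; exact: ltW.
Qed.

Lemma D_perm d (psi : 'rV[R]_d -> R) s t : smooth psi -> perm_eq s t -> D s psi = D t psi.
Proof.
move=> sp; elim: s t => [|i s IH] t; first by move=> /perm_size/esym/size0nil ->.
move=> pst; have it : i \in t by rewrite -(perm_mem pst) mem_head.
case/path.splitPr: it pst => t1 t2.
have pE : perm_eq (t1 ++ i :: t2) (i :: t1 ++ t2).
  by rewrite perm_sym -cat1s perm_catCA.
move=> /permPl pst; have {}pst : perm_eq s (t1 ++ t2).
  by rewrite -(perm_cons i) pst.
rewrite D_cons (IH _ pst) !D_cat D_cons.
have := smooth_D t2 sp; move: (D t2 psi) => chi schi {IH pst pE}.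
elim: t1 => // j t1; rewrite !D_cons => <-.
exact: schwarz (smooth_D t1 schi).
Qed.

End SmoothFunctions.

(** * Functions on the torus and their C^k bounds *)

#[local] Opaque smooth partial.

Section TorusFunctions.
Context {R : realType}.

(** The remainder |h|^(3/2) is the weakest one met below: it is what third absolute moments of
    Wiener increments give. Quadratic remainders reduce to it by [sqr_le_modulus]. *)
Lemma is_derive_modulus (V : normedModType R) (g : V -> R) (x v : V) (a C e0 : R) :
  0 < e0 -> (forall h : R, `|h| <= e0 ->
    `|g (x + h *: v) - g x - h * a| <= C * (`|h| * Num.sqrt `|h|)) ->
  is_derive x v g a.
Proof.
move=> e00 H.
have lim : (fun h : R => h^-1 *: ((g \o shift x) (h *: v) - g x)) @ 0^' --> a.
  apply/cvgrPdist_le => e egt0.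
  have C0 : 0 <= C.
    have := H e0; rewrite gtr0_norm// => /(_ (lexx _)); move/(le_trans (normr_ge0 _)).
    by rewrite pmulr_lge0// mulr_gt0// sqrtr_gt0.
  have Cp : 0 < C + 1 by rewrite ltr_wpDl.
  pose dl : R := Num.min e0 ((e / (C + 1)) ^+ 2).
  have dl0 : 0 < dl by rewrite lt_min e00 exprn_gt0// divr_gt0.
  near=> h.
  have hn0 : h != 0 by near: h; exact: nbhs_dnbhs_neq.
  have hdl : `|h| < dl by near: h; exact: dnbhs0_lt.
  have h1 : `|h| <= e0 by move: hdl; rewrite lt_min => /andP[/ltW].
  have hs : Num.sqrt `|h| <= e / (C + 1).
    have q0 : 0 <= e / (C + 1) by rewrite divr_ge0// ltW.
    have : `|h| <= (e / (C + 1)) ^+ 2 by move: hdl; rewrite lt_min => /andP[_ /ltW].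
    by move/ler_wsqrtr; rewrite sqrtr_sqr (ger0_norm q0).
  rewrite /= -normrN opprB /GRing.scale/= (addrC (h *: v)).
  have -> : h^-1 * (g (x + h *: v) - g x) - a = h^-1 * (g (x + h *: v) - g x - h * a).
    by rewrite [RHS]mulrBr mulKf.
  rewrite normrM normfV ler_pdivrMl ?normr_gt0//.
  apply: le_trans (H h h1) _; rewrite mulrCA ler_wpM2l//.
  apply: le_trans (_ : (C + 1) * (e / (C + 1)) <= _); last first.
    by rewrite mulrCA divff ?mulr1// gt_eqF.
  by apply: ler_pM => //; rewrite ?sqrtr_ge0// lerDl.
apply: DeriveDef; last exact/cvg_lim.
by apply/cvg_ex; exists a.
Unshelve. all: by end_near. Qed.

Lemma is_derive_scale_dir (V : normedModType R) (g : V -> R) (x v : V) (a t : R) :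
  is_derive x v g a -> is_derive x (t *: v) g (t * a).
Proof.
move=> Dg; pose l s := g (x + s *: v).
have D0 : is_derive (t * (0 : R)) 1 l a.
  by apply: is_derive_line; rewrite mulr0 scale0r addr0.
have D1 : is_derive (0 : R) 1 ( *%R t) t.
  by apply: is_derive_eq; rewrite [LHS]mulr1.
have D2 := is_derive1_comp D0 D1.
have E : (fun h : R => h^-1 *: (((l \o *%R t) \o shift 0) (h *: (1 : R)) - (l \o *%R t) 0)) =
   (fun h : R => h^-1 *: ((g \o shift x) (h *: (t *: v)) - g x)).
  apply/funext => h /=; rewrite addr0 [_ *: 1]mulr1 /l mulr0 scale0r addr0.
  by rewrite scalerA (addrC x) (mulrC t).
have [d1 d2] := D2.
rewrite mulrC; apply: DeriveDef; first by move: d1; rewrite /derivable E.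
by rewrite -d2 /derive E.
Qed.

Lemma continuous_box_bounded n (psi : 'rV[R]_n -> R) (a b : R) : continuous psi ->
  exists M : R, forall x : 'rV[R]_n, (forall i, a <= x 0 i <= b) -> `|psi x| <= M.
Proof.
move=> cp; have [ab|ba] := leP a b; last first.
  (* With b < a the box is empty, except in dimension 0, where it is the single point 0. *)
  case: n psi cp => [|n] psi cp.
    by exists `|psi 0| => x _; rewrite (_ : x = 0)//; apply/rowP => -[].
  exists 0 => x /(_ ord0) /andP[ax xb].
  by have := le_trans ax xb; rewrite leNgt ba.
pose A := [set x : 'rV[R]_n | forall i, `[a, b]%classic (x ord0 i)].
have cA : compact A.
  by apply: (@rV_compact _ _ (fun=> `[a, b]%classic)) => _; exact: segment_compact.
have A0 : A !=set0.
  by exists (const_mx a) => i /=; rewrite mxE in_itv/= lexx.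
have [|c _ hc] := @EVT_max_rV R n (fun x => `|psi x|) A A0 cA.
  apply: continuous_subspaceT => x.
  by apply: (@continuous_comp _ _ _ psi Num.norm x (cp x)); exact: norm_continuous.
exists `|psi c| => x hx; apply: hc; rewrite inE /A /= => i.
by rewrite in_itv/=; exact: hx.
Qed.

Lemma periodic_int d (psi : 'rV[R]_d -> R) i (k : int) x : Defs.periodic psi ->
  psi (x + k%:~R *: delta_mx 0 i) = psi x.
Proof.
move=> pp.
have H n y : psi (y + n%:R *: delta_mx 0 i) = psi y.
  elim: n => [|n IH]; first by rewrite scale0r addr0.
  by rewrite -natr1 scalerDl scale1r addrA pp.
case: k => n; first exact: H.
by rewrite NegzE mulrNz scaleNr -(H n.+1) subrK.
Qed.

Lemma periodic_cube d (psi : 'rV[R]_d -> R) x : Defs.periodic psi ->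
  exists2 y : 'rV[R]_d, (forall i, 0 <= y 0 i <= 1) & psi x = psi y.
Proof.
move=> pp; pose k i := - Num.floor (x 0 i).
exists (x + \sum_i (k i)%:~R *: delta_mx 0 i) => [i|].
  rewrite mxE summxE (bigD1 i)//= big1 ?addr0 => [|j ji].
    rewrite !mxE !eqxx mulr1 /k mulrNz subr_ge0 lerBlDl addrC.
    have /andP[-> /ltW] := floor_itv (x 0 i).
    by rewrite intrD addrC.
  by rewrite !mxE eqxx eq_sym (negbTE ji) mulr0.
elim/big_ind : _ (x) => [y|a b Ha Hb y|i _ y]; first by rewrite addr0.
  by rewrite addrA -Hb -Ha.
by rewrite periodic_int.
Qed.

Lemma periodic_bounded d (psi : 'rV[R]_d -> R) : Defs.periodic psi -> continuous psi ->
  exists M, forall x, `|psi x| <= M.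
Proof.
move=> pp cp; have [M HM] := continuous_box_bounded 0 1 cp; exists M => x.
by have [y y01 ->] := periodic_cube x pp; exact: HM.
Qed.

Lemma periodic_partial d (psi : 'rV[R]_d -> R) i : smooth psi -> Defs.periodic psi ->
  Defs.periodic (partial i psi).
Proof.
move=> sp pp j x.
have := is_derive_translate (is_derive_partial i (x + delta_mx 0 j) sp).
have -> : (fun y => psi (y + delta_mx 0 j)) = psi by apply/funext => y; exact: pp.
by move=> /is_derive_partialE.
Qed.

Section Closure.
Context {d : nat}.
Implicit Types psi chi : 'rV[R]_d -> R.

Lemma ts_smooth psi : torus_smooth psi -> smooth psi.
Proof. by case. Qed.

Lemma ts_periodic psi : torus_smooth psi -> Defs.periodic psi.
Proof. by case. Qed.

Lemma ts_partial psi i : torus_smooth psi -> torus_smooth (partial i psi).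
Proof. by move=> [pp sp]; split; [exact: periodic_partial|exact: smooth_partial]. Qed.

Lemma ts_D psi s : torus_smooth psi -> torus_smooth (D s psi).
Proof. move=> tp; elim: s => [|i s IH]; [exact: tp|exact: ts_partial IH]. Qed.

Lemma ts_cst c : torus_smooth (cst c : 'rV[R]_d -> R).
Proof. by split; [|exact: smooth_cst]. Qed.

Lemma tsD psi chi : torus_smooth psi -> torus_smooth chi ->
  torus_smooth (fun x => psi x + chi x).
Proof.
move=> [pp sp] [pc sc]; split; last exact: smoothD.
by move=> i x; rewrite pp pc.
Qed.

Lemma tsM psi chi : torus_smooth psi -> torus_smooth chi ->
  torus_smooth (fun x => psi x * chi x).
Proof.
move=> [pp sp] [pc sc]; split; last exact: smoothM.
by move=> i x; rewrite pp pc.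
Qed.

Lemma tsZ psi c : torus_smooth psi -> torus_smooth (fun x => c * psi x).
Proof. by move=> [pp sp]; split; [move=> i x; rewrite pp|exact: smoothZ]. Qed.

Lemma tsB psi chi : torus_smooth psi -> torus_smooth chi ->
  torus_smooth (fun x => psi x - chi x).
Proof.
move=> tp tc; have -> : (fun x => psi x - chi x) = (fun x => psi x + -1 * chi x).
  by apply/funext => x; rewrite mulN1r.
exact: (tsD tp (tsZ (-1) tc)).
Qed.

#[local] Opaque torus_smooth.

Lemma ts_sum (I : Type) (r : seq I) (P : pred I) (F : I -> 'rV[R]_d -> R) :
  (forall i, P i -> torus_smooth (F i)) ->
  torus_smooth (fun x => \sum_(i <- r | P i) F i x).
Proof.
move=> H; elim: r => [|i r IH].
  rewrite (_ : (fun x => _) = cst 0); first exact: ts_cst.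
  by apply/funext => x; rewrite big_nil.
case Pi : (P i); last first.
  rewrite (_ : (fun x => _) = (fun x => \sum_(i <- r | P i) F i x))//.
  by apply/funext => x; rewrite big_cons Pi.
rewrite (_ : (fun x => _) = (fun x => F i x + \sum_(i <- r | P i) F i x)).
  exact: (tsD (H i Pi) IH).
by apply/funext => x; rewrite big_cons Pi.
Qed.

(** Real-valued form of a C^k bound, over words instead of multi-indices; [Cnorm_le] relates it to
    [Cnorm]. *)
Definition bd (k : nat) psi (M : R) : Prop :=
  forall s x, (size s <= k)%N -> `|D s psi x| <= M.

Lemma bd_ge0 k psi M : bd k psi M -> 0 <= M.
Proof. by move=> /(_ [::] 0 isT); exact: le_trans. Qed.

Lemma bd0 k psi M x : bd k psi M -> `|psi x| <= M.
Proof. by move=> /(_ [::] x isT). Qed.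

Lemma bdW k k' psi M M' : (k' <= k)%N -> M <= M' -> bd k psi M -> bd k' psi M'.
Proof. by move=> kk MM h s x sk; apply: le_trans (h s x _) MM; exact: leq_trans sk kk. Qed.

Lemma bd_D k s psi M : bd (k + size s) psi M -> bd k (D s psi) M.
Proof. by move=> h t x tk; rewrite -D_cat; apply: h; rewrite size_cat leq_add2r. Qed.

Lemma bdD k psi chi M M' : smooth psi -> smooth chi ->
  bd k psi M -> bd k chi M' -> bd k (fun x => psi x + chi x) (M + M').
Proof.
move=> sp sc hp hc s x sk; rewrite (DD _ sp sc).
by apply: le_trans (ler_normD _ _) _; apply: lerD; [exact: hp|exact: hc].
Qed.

Lemma bdZ k psi M c : smooth psi -> bd k psi M -> bd k (fun x => c * psi x) (`|c| * M).
Proof.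
by move=> sp hp s x sk; rewrite (DZ _ _ sp) normrM ler_wpM2l//; exact: hp.
Qed.

Lemma bdB k psi chi M M' : smooth psi -> smooth chi ->
  bd k psi M -> bd k chi M' -> bd k (fun x => psi x - chi x) (M + M').
Proof.
move=> sp sc hp hc.
have := bdD sp (smoothZ (-1) sc) hp (bdZ (-1) sc hc).
rewrite normrN1 mul1r; congr (bd k _ _).
by apply/funext => x; rewrite mulN1r.
Qed.

Lemma bd_cst k c : bd k (cst c) `|c|.
Proof. by move=> s x _; rewrite D_cst; case: s => //= *; rewrite normr0. Qed.

Lemma bd_sum (I : Type) (r : seq I) (P : pred I) k (F : I -> 'rV[R]_d -> R) (M : I -> R) :
  (forall i, P i -> torus_smooth (F i)) ->
  (forall i, P i -> bd k (F i) (M i)) ->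
  bd k (fun x => \sum_(i <- r | P i) F i x) (\sum_(i <- r | P i) M i).
Proof.
move=> sF H; elim: r => [|i r IH].
  rewrite (_ : (fun x => _) = cst 0); last by apply/funext => x; rewrite big_nil.
  by rewrite big_nil; have := @bd_cst k 0; rewrite normr0.
rewrite big_cons; case Pi : (P i); last first.
  rewrite (_ : (fun x => _) = (fun x => \sum_(i <- r | P i) F i x))//.
  by apply/funext => x; rewrite big_cons Pi.
rewrite (_ : (fun x => _) = (fun x => F i x + \sum_(i <- r | P i) F i x)).
  exact: (bdD (ts_smooth (sF i Pi)) (ts_smooth (ts_sum r sF)) (H i Pi) IH).
by apply/funext => x; rewrite big_cons Pi.
Qed.

Lemma bdS k psi M : bd 0 psi M -> (forall i, bd k (partial i psi) M) -> bd k.+1 psi M.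
Proof.
move=> h0 h s x; elim/last_ind: s => [_|s i _]; first exact: h0.
by rewrite size_rcons ltnS => sk; rewrite D_rcons; exact: h.
Qed.

(** Each derivative splits a product into two products, whence the factor 2^k. *)
Lemma bdM k psi chi M M' : smooth psi -> smooth chi ->
  bd k psi M -> bd k chi M' -> bd k (fun x => psi x * chi x) (2 ^+ k * (M * M')).
Proof.
elim: k psi chi M M' => [|k IH] psi chi M M' sp sc hp hc.
  move=> s x; rewrite leqn0 => /nilP ->; rewrite expr0 mul1r normrM.
  by apply: ler_pM => //; [exact: bd0 hp|exact: bd0 hc].
have M0 := bd_ge0 hp; have M0' := bd_ge0 hc.
apply: bdS => [|i].
  move=> s x; rewrite leqn0 => /nilP ->; rewrite normrM.
  apply: (@le_trans _ _ (M * M')).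
    by apply: ler_pM => //; [exact: bd0 hp|exact: bd0 hc].
  by rewrite ler_peMl ?mulr_ge0// exprn_ege1// ler1n.
rewrite (partialM i sp sc).
have hpi : bd k (partial i psi) M by apply: (bd_D (s := [:: i])); rewrite addn1.
have hci : bd k (partial i chi) M' by apply: (bd_D (s := [:: i])); rewrite addn1.
have wp := bdW (leqnSn k) (lexx M) hp; have wc := bdW (leqnSn k) (lexx M') hc.
have -> : 2 ^+ k.+1 * (M * M') = 2 ^+ k * (M * M') + 2 ^+ k * (M' * M).
  by rewrite exprS; ring.
have spi := smooth_partial i sp; have sci := smooth_partial i sc.
exact: (bdD (smoothM sp sci) (smoothM sc spi) (IH _ _ _ _ sp sci wp hci) (IH _ _ _ _ sc spi wc hpi)).
Qed.

Lemma ts_bd k psi : torus_smooth psi -> exists M, bd k psi M.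
Proof.
elim: k psi => [|k IH] psi tp.
  have [M HM] := periodic_bounded (ts_periodic tp) (smooth_continuous (ts_smooth tp)).
  by exists M => s x; rewrite leqn0 => /nilP ->.
have [M0 H0] := periodic_bounded (ts_periodic tp) (smooth_continuous (ts_smooth tp)).
have [M HM] : {M : 'I_d -> R & forall i, bd k (partial i psi) (M i)}.
  by apply: (@choice _ _ (fun i M => bd k (partial i psi) M)) => i; apply/IH/ts_partial.
exists (`|M0| + \sum_i `|M i|); apply: bdS.
  move=> s x; rewrite leqn0 => /nilP ->; apply: le_trans (H0 x) _.
  by apply: le_trans (ler_norm _) _; rewrite lerDl sumr_ge0.
move=> i; apply: bdW (HM i) => //.
rewrite (bigD1 i)//= addrCA -[leLHS]addr0 lerD ?ler_norm//.
by rewrite addr_ge0// sumr_ge0.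
Qed.

End Closure.

(** * C^k norms and words of partial derivatives *)

Section Cnorm.
Context {d : nat}.
Implicit Types psi : 'rV[R]_d -> R.
Local Open Scope ereal_scope.

Definition multiindex_word (j : 'I_d -> nat) : seq 'I_d :=
  flatten [seq nseq (j i) i | i <- enum 'I_d].

Lemma mpartialE j psi : mpartial j psi = D (multiindex_word j) psi.
Proof.
rewrite /mpartial /multiindex_word; elim: (enum 'I_d) => //= i s ->.
rewrite D_cat; move: (D _ psi) => chi.
by elim: (j i) => //= n ->.
Qed.

Lemma size_multiindex_word j : size (multiindex_word j) = (\sum_i j i)%N.
Proof.
rewrite /multiindex_word size_flatten /shape -map_comp sumnE big_map big_enum /=.
by apply: eq_bigr => i _; rewrite size_nseq.
Qed.

Lemma perm_multiindex_word (s : seq 'I_d) :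
  perm_eq s (multiindex_word (fun i => count_mem i s)).
Proof.
apply/allP => i _ /=; rewrite /multiindex_word count_flatten -map_comp sumnE big_map big_enum /=.
rewrite (bigD1 i)//= big1 ?addn0 => [|k ki]; rewrite count_nseq /= ?eqxx ?mul1n//.
by rewrite (negbTE ki).
Qed.

(** By symmetry of derivatives a word may be sorted into the canonical word of its letter counts, so
    words and multi-indices of order at most k give the same derivatives. *)
Lemma Cnorm_le k psi (M : R) : smooth psi -> Cnorm k psi <= M%:E <-> bd k psi M.
Proof.
move=> sp; split => [H s x sk|H].
  rewrite (D_perm sp (perm_multiindex_word s)) -lee_fin; apply: le_trans H.
  apply: (@le_trans _ _ (supnorm (mpartial (fun i => count_mem i s) psi))).
    by rewrite -mpartialE; apply: ereal_sup_ubound; exists x.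
  apply: ereal_sup_ubound; exists (fun i => count_mem i s) => //=.
  by rewrite -size_multiindex_word -(perm_size (perm_multiindex_word s)).
apply: ge_ereal_sup => _ [j /= jk <-]; apply: ge_ereal_sup => _ [x _ <-].
by rewrite lee_fin mpartialE; apply: H; rewrite size_multiindex_word.
Qed.

Lemma Cnorm_bd k psi : torus_smooth psi ->
  exists2 M, bd k psi M & Cnorm k psi = M%:E.
Proof.
move=> tp; have [M0 H0] := ts_bd k tp.
have H1 : Cnorm k psi <= M0%:E by apply/(Cnorm_le _ _ (ts_smooth tp)).
have H2 : 0 <= Cnorm k psi.
  apply: (@le_trans _ _ (supnorm (mpartial (fun=> 0%N) psi))).
    apply: (@le_trans _ _ `|mpartial (fun=> 0%N) psi 0|%:E); first by rewrite lee_fin.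
    by apply: ereal_sup_ubound; exists 0%R.
  by apply: ereal_sup_ubound; exists (fun=> 0%N) => //=; rewrite big1.
have E : Cnorm k psi = (fine (Cnorm k psi))%:E.
  rewrite fineK// fin_numElt (lt_le_trans _ H2) ?ltNy0//=.
  by rewrite (le_lt_trans H1) ?ltry.
exists (fine (Cnorm k psi)) => //.
by apply/(Cnorm_le _ _ (ts_smooth tp)); rewrite -E.
Qed.

Lemma supnorm_le psi (M : R) : (forall x, (`|psi x| <= M)%R) -> supnorm psi <= M%:E.
Proof. by move=> H; apply: ge_ereal_sup => _ [x _ <-]; rewrite lee_fin. Qed.

End Cnorm.

(** * Taylor's formula in several variables *)

Section Taylor.
Context {d : nat}.
Implicit Types chi : 'rV[R]_d -> R.

Lemma line_taylor (K : nat) (chi : nat -> 'rV[R]_d -> R) (z v : 'rV[R]_d) (M : R) :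
  (forall k y, (k < K)%N -> is_derive y v (chi k) (chi k.+1 y)) ->
  (forall y, `|chi K y| <= M) ->
  `|chi 0%N (z + v) - \sum_(j < K) chi j z / j`!%:R| <= M / K`!%:R.
Proof.
move=> Dc cM.
have := @taylor_bound _ (fun k s => chi k (z + s *: v)) K 0 1 M ler01.
rewrite scale1r /taylor_sum /taylor_mono subr0 expr1n mul1r.
under eq_bigr do rewrite scale0r addr0 expr1n mul1r mulrC.
apply => [k kK|k x kK _|x _]; last exact: cM.
  apply: continuous_subspaceT => s; apply: differentiable_continuous.
  by apply/derivable1_diffP; apply: ex_derive; exact: is_derive_line (Dc _ _ kK).
by apply: is_derive_line; exact: Dc.
Qed.

(** The gradient paired with y, built from partial derivatives; that it is the derivative along y is
    proved in [is_derive_dir]. *)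
Definition dir (y : 'rV[R]_d) chi : 'rV[R]_d -> R :=
  fun z => \sum_i y 0 i * partial i chi z.

Definition norm1 (y : 'rV[R]_d) : R := \sum_i `|y 0 i|.

Lemma norm1_ge0 y : 0 <= norm1 y.
Proof. exact: sumr_ge0. Qed.

Lemma ts_dir y chi : torus_smooth chi -> torus_smooth (dir y chi).
Proof. by move=> tc; apply: ts_sum => i _; exact: (tsZ _ (ts_partial i tc)). Qed.

Lemma bd_partial k chi M i : bd k.+1 chi M -> bd k (partial i chi) M.
Proof. by move=> h; apply: (bd_D (s := [:: i])); rewrite addn1. Qed.

Lemma bd_dir k y chi M : torus_smooth chi -> bd k.+1 chi M ->
  bd k (dir y chi) (norm1 y * M).
Proof.
move=> tc hc; rewrite /norm1 mulr_suml; apply: bd_sum => i _.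
  exact: (tsZ _ (ts_partial i tc)).
exact: (bdZ _ (ts_smooth (ts_partial i tc)) (bd_partial i hc)).
Qed.

Lemma coord_taylor (K : nat) chi (z : 'rV[R]_d) i (t M : R) : smooth chi ->
  bd K chi M ->
  `|chi (z + t *: delta_mx 0 i) - \sum_(j < K) t ^+ j * D (nseq j i) chi z / j`!%:R|
    <= `|t| ^+ K * M / K`!%:R.
Proof.
move=> sc hc.
have := @line_taylor K (fun k y => t ^+ k * D (nseq k i) chi y) z (t *: delta_mx 0 i)
  (`|t| ^+ K * M).
rewrite /= expr0 mul1r; apply => [k y kK|y].
  rewrite exprSr -mulrA.
  apply: (@is_deriveZ _ _ _ (D (nseq k i) chi) (t ^+ k)).
  apply: is_derive_scale_dir; exact: (is_derive_partial _ _ (smooth_D _ sc)).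
by rewrite normrM normrX ler_wpM2l ?exprn_ge0//; apply: hc; rewrite size_nseq.
Qed.

(** Smoothness only provides derivatives along the axes, so a general displacement is made one
    coordinate at a time, by induction on the list of coordinates. *)
Lemma gradient_bound chi (z y : 'rV[R]_d) M : torus_smooth chi -> bd 2 chi M ->
  `|chi (z + y) - chi z - dir y chi z| <= M * norm1 y ^+ 2.
Proof.
move=> tc hc; have sc := ts_smooth tc; have M0 := bd_ge0 hc.
have lip i (psi := partial i chi) j (t : R) (w : 'rV[R]_d) :
    `|psi (w + t *: delta_mx 0 j) - psi w| <= `|t| * M.
  have := coord_taylor w j t (smooth_partial i sc) (bd_partial i hc).
  by rewrite big_ord_recl big_ord0 addr0 !expr0 !expr1 mul1r fact0 divr1 divr1.
suff H (s : seq 'I_d) z' :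
    `|chi (z' + \sum_(i <- s) y 0 i *: delta_mx 0 i) - chi z'
      - \sum_(i <- s) y 0 i * partial i chi z'| <= M * (\sum_(i <- s) `|y 0 i|) ^+ 2.
  have := H (index_enum _) z.
  by rewrite -row_sum_delta.
elim: s z' => [|i s IH] z'.
  by rewrite !big_nil addr0 !subrr normr0 expr0n /= mulr0.
rewrite !big_cons addrA.
set t := y 0 i; set w := z' + t *: _; set S := \sum_(_ <- _) `|_|.
have S0 : 0 <= S by apply: sumr_ge0.
have H1 := IH w; rewrite -/S in H1.
have H2 : `|chi w - chi z' - t * partial i chi z'| <= `|t| ^+ 2 * M / 2.
  have := coord_taylor z' i t sc hc; rewrite -/w !big_ord_recl big_ord0 /=.
  by rewrite addr0 !expr0 expr1 mul1r fact0 !divr1 opprD addrA.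
have H3 : `|\sum_(j <- s) y 0 j * (partial j chi w - partial j chi z')| <= S * (`|t| * M).
  apply: le_trans (ler_norm_sum _ _ _) _; rewrite /S mulr_suml.
  by apply: ler_sum => j _; rewrite normrM; apply: (ler_wpM2l (normr_ge0 _)); exact: lip.
set A := \sum_(j <- s) y 0 j * partial j chi w in H1 *.
set B := \sum_(j <- s) y 0 j * partial j chi z'.
have AB : \sum_(j <- s) y 0 j * (partial j chi w - partial j chi z') = A - B.
  by rewrite /A /B -sumrB; apply: eq_bigr => j _; rewrite mulrBr.
rewrite AB in H3.
(* Three errors: the remaining displacement seen from w, the second-order error of the first
   coordinate, and the change of the remaining partial derivatives between z' and w. *)
have -> : chi (w + \sum_(j <- s) y 0 j *: delta_mx 0 j) - chi z' - (t * partial i chi z' + B)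
  = (chi (w + \sum_(j <- s) y 0 j *: delta_mx 0 j) - chi w - A) +
    (chi w - chi z' - t * partial i chi z') + (A - B) by ring.
apply: le_trans (ler_normD _ _) _; apply: le_trans (lerD (ler_normD _ _) (lexx _)) _.
apply: le_trans (lerD (lerD H1 H2) H3) _.
rewrite -subr_ge0.
have -> : M * (`|t| + S) ^+ 2 - (M * S ^+ 2 + `|t| ^+ 2 * M / 2 + S * (`|t| * M)) =
  M * (`|t| ^+ 2 / 2 + S * `|t|) by field.
by rewrite mulr_ge0// addr_ge0// ?mulr_ge0// ?divr_ge0.
Qed.

Lemma sqr_le_modulus (h : R) : `|h| <= 1 -> `|h| ^+ 2 <= `|h| * Num.sqrt `|h|.
Proof.
move=> h1; rewrite expr2 ler_wpM2l//.
rewrite -[X in X <= _]sqr_sqrtr// expr2 ler_piMl ?sqrtr_ge0//.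
by rewrite -sqrtr1 ler_wsqrtr.
Qed.

Lemma is_derive_dir chi (z y : 'rV[R]_d) : torus_smooth chi ->
  is_derive z y chi (dir y chi z).
Proof.
move=> tc; have [M hc] := ts_bd 2 tc; have M0 := bd_ge0 hc.
apply: (@is_derive_modulus _ _ _ _ _ (M * norm1 y ^+ 2) 1) => // h h1.
have := gradient_bound z (h *: y) tc hc.
have -> : dir (h *: y) chi z = h * dir y chi z.
  by rewrite /dir mulr_sumr; apply: eq_bigr => i _; rewrite mxE mulrA.
move/le_trans; apply.
have -> : norm1 (h *: y) = `|h| * norm1 y.
  by rewrite /norm1 mulr_sumr; apply: eq_bigr => i _; rewrite mxE normrM.
rewrite exprMn mulrCA mulrC ler_wpM2l ?mulr_ge0 ?exprn_ge0 ?norm1_ge0//.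
exact: sqr_le_modulus.
Qed.

Lemma space_taylor (K : nat) chi (z y : 'rV[R]_d) (M : R) : torus_smooth chi ->
  bd K chi M ->
  `|chi (z + y) - \sum_(j < K) iter j (dir y) chi z / j`!%:R|
    <= norm1 y ^+ K * M / K`!%:R.
Proof.
move=> tc hc.
have tck k : torus_smooth (iter k (dir y) chi).
  by elim: k => [|k IH]; [exact: tc|exact: ts_dir IH].
have bck k : (k <= K)%N -> bd (K - k) (iter k (dir y) chi) (norm1 y ^+ k * M).
  elim: k => [|k IH] kK; first by rewrite subn0 expr0 mul1r.
  rewrite exprS -mulrA iterS; apply: (bd_dir _ (tck k)).
  by rewrite subnSK//; apply: IH; exact: ltnW.
apply: (line_taylor (chi := fun k => iter k (dir y) chi)) => [k x _|x].
  exact: is_derive_dir (tck k).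
exact: bd0 (bck K (leqnn K)).
Qed.

End Taylor.

End TorusFunctions.

(** * Time slices and the integral over the torus *)

#[local] Opaque smooth partial torus_smooth.

Lemma lipschitz_continuous (R : realType) (V W : normedModType R) (G : V -> W) (K : R) :
  (forall s t, `|G s - G t| <= K * `|s - t|) -> continuous G.
Proof.
move=> HG t; apply/cvgrPdist_le => e e0.
have Kp : 0 < `|K| + 1 by rewrite ltr_wpDl.
near=> s; apply: le_trans (HG _ _) _.
apply: (@le_trans _ _ ((`|K| + 1) * `|t - s|)).
  by rewrite ler_wpM2r// (le_trans (ler_norm _))// lerDl.
rewrite mulrC -ler_pdivlMr//; near: s.
by apply: cvgr_dist_le; [exact: cvg_id|rewrite divr_gt0].
Unshelve. all: by end_near. Qed.

Section Slices.
Context {R : realType} {d : nat}.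
Implicit Types V : 'rV[R]_(1 + d) -> R.

Definition glue (t : R) (x : 'rV[R]_d) : 'rV[R]_(1 + d) := row_mx (t%:M : 'rV[R]_1) x.

(** Serves twice: for time slices of space-time functions, and for the outermost variable of the
    iterated integral [torus_int]. *)
Definition slice V (t : R) : 'rV[R]_d -> R := fun x => V (glue t x).

Definition time0 : 'I_(1 + d) := lshift d ord0.

Lemma delta_time0 : delta_mx 0 time0 = glue 1 0.
Proof.
rewrite /glue delta_mx_lshift; congr row_mx.
by apply/matrixP => i j; rewrite !ord1 !mxE.
Qed.

Lemma delta_space i : delta_mx 0 (rshift 1 i) = glue 0 (delta_mx 0 i).
Proof.
rewrite /glue delta_mx_rshift; congr row_mx.
by apply/matrixP => j k; rewrite !ord1 !mxE.
Qed.

Lemma glueD t s x y : glue t x + glue s y = glue (t + s) (x + y).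
Proof. by rewrite /glue add_row_mx raddfD. Qed.

Lemma glueZ (c t : R) x : c *: glue t x = glue (c * t) (c *: x).
Proof. by rewrite /glue scale_row_mx scale_scalar_mx. Qed.

Lemma glueE_time t x : glue t x 0 time0 = t.
Proof. by rewrite /glue row_mxEl mxE. Qed.

Lemma glueE_space t x i : glue t x 0 (rshift 1 i) = x 0 i.
Proof. by rewrite /glue row_mxEr. Qed.

Lemma glue_shift (t s : R) x : glue (t + s) x = glue t x + s *: delta_mx 0 time0.
Proof. by rewrite delta_time0 glueZ glueD mulr1 scaler0 addr0. Qed.

Lemma entry_le_norm (x : 'rV[R]_d) i : `|x 0 i| <= `|x|.
Proof. by rewrite [leRHS]/Num.norm /= mx_normrE; apply/bigmax_geP; right; exists (0, i). Qed.

Lemma norm_glue0 (x : 'rV[R]_d) : `|glue 0 x| <= `|x|.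
Proof.
rewrite [leLHS]/Num.norm /= mx_normrE; apply: bigmax_le => // -[i j] _ /=.
rewrite (ord1 i); have [k|k] := split_ordP j => ->.
  by rewrite (ord1 k) glueE_time normr0.
by rewrite glueE_space entry_le_norm.
Qed.

Lemma continuous_glue_space t : continuous (glue t).
Proof.
apply: (@lipschitz_continuous _ _ _ _ 1) => x y; rewrite mul1r.
have -> : glue t x - glue t y = glue 0 (x - y); last exact: norm_glue0.
by rewrite -scaleN1r glueZ glueD mulN1r subrr scaleN1r.
Qed.

Lemma is_derive_slice_space V t i x a :
  is_derive (glue t x) (delta_mx 0 (rshift 1 i)) V a ->
  is_derive x (delta_mx 0 i) (slice V t) a.
Proof.
move=> [dV <-].
have E : (fun h : R => h^-1 *: ((slice V t \o shift x) (h *: delta_mx 0 i) - slice V t x)) =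
   (fun h : R => h^-1 *: ((V \o shift (glue t x)) (h *: delta_mx 0 (rshift 1 i)) - V (glue t x))).
  apply/funext => h /=; congr (_ *: (_ - _)).
  by rewrite /slice delta_space glueZ glueD mulr0 add0r.
by apply: DeriveDef; rewrite /derivable /derive E.
Qed.

Lemma is_derive_slice_time V t x a :
  is_derive (glue t x) (delta_mx 0 time0) V a ->
  is_derive t 1 (fun s => slice V s x) a.
Proof.
have E : glue t x = glue 0 x + t *: delta_mx 0 time0 by rewrite -glue_shift add0r.
rewrite E => /is_derive_line; congr (is_derive _ _ _ _).
by apply/funext => s; rewrite /slice -glue_shift add0r.
Qed.

Lemma Ck_slice n V t : Ck n V -> Ck n (slice V t).
Proof.
have h0 W : Ck 0 W -> Ck 0 (slice W t).
  move=> /Ck0P[cW dW]; apply/Ck0P; split.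
    move=> x; apply: (@continuous_comp _ _ _ (glue t) W x); last exact: cW.
    exact: continuous_glue_space.
  move=> i x; apply: ex_derive.
  exact: (is_derive_slice_space (derivableP (dW (rshift 1 i) (glue t x)))).
elim: n V => [|n IH] V hV; first exact: h0.
apply: CkS => [|i]; first by apply: h0; exact: CkW hV.
have -> : partial i (slice V t) = slice (partial (rshift 1 i) V) t.
  apply/funext => x; apply: is_derive_partialE; apply: is_derive_slice_space.
  by have /Ck0P[_ dV] := CkW hV; exact: derivableP.
by apply: IH; exact: Ck_partial.
Qed.

Lemma smooth_slice V t : smooth V -> smooth (slice V t).
Proof. by move=> /smoothP h; apply/smoothP => n; apply: Ck_slice; exact: h. Qed.

Lemma partial_slice V t i : smooth V ->
  partial i (slice V t) = slice (partial (rshift 1 i) V) t.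
Proof.
move=> sV; apply/funext => x; apply: is_derive_partialE; apply: is_derive_slice_space.
exact: is_derive_partial.
Qed.

Lemma is_derive_time V (t : R) x : smooth V ->
  is_derive t 1 (fun s => slice V s x) (slice (partial time0 V) t x).
Proof. by move=> sV; apply: is_derive_slice_time; exact: is_derive_partial. Qed.

Lemma continuous_time V x : smooth V -> continuous (fun s => slice V s x).
Proof.
move=> sV t; apply: differentiable_continuous; apply/derivable1_diffP.
by apply: ex_derive; exact: is_derive_time.
Qed.

Lemma ts_slice V t : torus_smooth V -> torus_smooth (slice V t).
Proof.
move=> tV; split; last exact: smooth_slice (ts_smooth tV).
move=> i x; rewrite /slice -[in RHS](ts_periodic tV (rshift 1 i)).
by rewrite delta_space glueD addr0.
Qed.

End Slices.

(** * Linearity, bounds and integration by parts on the torus *)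

Section TorusIntegral.
Context {R : realType}.

Lemma continuous_integrable01 (G : R -> R) : continuous G ->
  lebesgue_measure.-integrable `[0, 1] (EFin \o G).
Proof.
move=> cG; apply: continuous_compact_integrable; first exact: segment_compact.
exact: continuous_subspaceT.
Qed.

Lemma Rintegral01_cst (c : R) : \int[lebesgue_measure]_(t in `[0%R, 1%R]) c = c.
Proof.
by rewrite /Rintegral integral_cst//= lebesgue_measure_itv/= lte_fin ltr01 oppr0 adde0 mule1.
Qed.

(** The two properties are proved together by induction on d: integrating over one more variable
    requires the inner integral to be continuous in it, which follows from both of them in dimension
    d. *)
Definition int_good d := forall psi chi : 'rV[R]_d -> R,
  torus_smooth psi -> torus_smooth chi ->
  (forall c, torus_int (fun x => psi x + c * chi x) = torus_int psi + c * torus_int chi) /\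
  (forall M, (forall x, `|psi x| <= M) -> `|torus_int psi| <= M).

Lemma slice_time_lip d (V : 'rV[R]_(1 + d) -> R) : torus_smooth V ->
  exists K, forall s t x, `|slice V s x - slice V t x| <= K * `|s - t|.
Proof.
move=> tV; have [K hK] := ts_bd 1 tV; exists K => s t x.
have := coord_taylor (glue t x) time0 (s - t) (ts_smooth tV) hK.
rewrite big_ord_recl big_ord0 addr0 expr1 expr0 mul1r fact0 !divr1.
rewrite -glue_shift.
by rewrite subrKC mulrC.
Qed.

Lemma torus_intS d (V : 'rV[R]_(1 + d) -> R) :
  torus_int (V : 'rV[R]_d.+1 -> R) =
  \int[lebesgue_measure]_(t in `[0%R, 1%R]) torus_int (slice V t).
Proof. by []. Qed.

Lemma int_goodP d : int_good d.
Proof.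
elim: d => [|d IH] psi chi tp tc; first by split => //= M; apply.
have tps t := ts_slice t tp; have tcs t := ts_slice t tc.
have cont V : @torus_smooth R (1 + d) V -> continuous (fun t => torus_int (slice V t)).
  move=> tV; have [K hK] := slice_time_lip tV.
  have tVs t := ts_slice t tV.
  apply: (@lipschitz_continuous _ _ _ _ K) => s t.
  have [lin _] := IH _ _ (tVs s) (tVs t).
  have -> : torus_int (slice V s) - torus_int (slice V t) =
      torus_int (fun x => slice V s x + -1 * slice V t x).
    by rewrite lin mulN1r.
  have td := tsD (tVs s) (tsZ (-1) (tVs t)).
  have [_] := IH _ _ td td; apply => x.
  by rewrite mulN1r; exact: hK.
split=> [c|M HM].
  rewrite !torus_intS -RintegralZl//; last exact: continuous_integrable01 (cont _ tc).
  rewrite -RintegralD//; last 2 first.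
  - exact: continuous_integrable01 (cont _ tp).
  - by apply: continuous_integrable01 => t; apply: cvgMr; exact: cont.
  apply: eq_Rintegral => t _.
  have [lin _] := IH _ _ (tps t) (tcs t).
  by rewrite -lin.
rewrite torus_intS; have ci := continuous_integrable01 (cont _ tp).
apply: le_trans (le_normr_Rintegral _ ci) _ => //.
rewrite -[leRHS]Rintegral01_cst; apply: le_Rintegral => //.
- apply: continuous_integrable01 => t.
  exact: (cvg_norm (cont _ tp t)).
- by apply: continuous_integrable01; exact: cst_continuous.
- move=> t _; have [_] := IH _ _ (tps t) (tps t); apply => x; exact: HM.
Qed.

Section Properties.
Context {d : nat}.
Implicit Types psi chi : 'rV[R]_d -> R.

Lemma torus_int_lin psi chi c : torus_smooth psi -> torus_smooth chi ->
  torus_int (fun x => psi x + c * chi x) = torus_int psi + c * torus_int chi.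
Proof. by move=> tp tc; have [] := int_goodP tp tc. Qed.

Lemma torus_int_bound psi M : torus_smooth psi -> (forall x, `|psi x| <= M) ->
  `|torus_int psi| <= M.
Proof. by move=> tp; have [_] := int_goodP tp tp; exact. Qed.

Lemma torus_intD psi chi : torus_smooth psi -> torus_smooth chi ->
  torus_int (fun x => psi x + chi x) = torus_int psi + torus_int chi.
Proof.
move=> tp tc; rewrite -[torus_int chi]mul1r -torus_int_lin//.
by congr torus_int; apply/funext => x; rewrite mul1r.
Qed.

Lemma torus_intB psi chi : torus_smooth psi -> torus_smooth chi ->
  torus_int (fun x => psi x - chi x) = torus_int psi - torus_int chi.
Proof.
move=> tp tc; rewrite -[torus_int chi]mul1r -mulNr -torus_int_lin//.
by congr torus_int; apply/funext => x; rewrite mulN1r.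
Qed.

Lemma torus_int0 : torus_int (cst 0 : 'rV[R]_d -> R) = 0.
Proof.
apply/eqP; rewrite -normr_le0; apply: torus_int_bound; first exact: ts_cst.
by move=> x; rewrite normr0.
Qed.

Lemma torus_intZ psi c : torus_smooth psi ->
  torus_int (fun x => c * psi x) = c * torus_int psi.
Proof.
move=> tp; have := torus_int_lin c (ts_cst 0) tp; rewrite torus_int0 add0r => <-.
by congr torus_int; apply/funext => x; rewrite add0r.
Qed.

Lemma torus_int_sum (I : Type) (r : seq I) (P : pred I) (F : I -> 'rV[R]_d -> R) :
  (forall i, P i -> torus_smooth (F i)) ->
  torus_int (fun x => \sum_(i <- r | P i) F i x) = \sum_(i <- r | P i) torus_int (F i).
Proof.
move=> H; elim: r => [|i r IH].
  rewrite big_nil -[RHS]torus_int0; congr torus_int.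
  by apply/funext => x; rewrite big_nil.
rewrite big_cons -IH; case Pi : (P i).
  rewrite -(torus_intD (H i Pi) (ts_sum r H)); congr torus_int.
  by apply/funext => x; rewrite big_cons Pi.
by congr torus_int; apply/funext => x; rewrite big_cons Pi.
Qed.

Lemma torus_int_cst (c : R) : torus_int (cst c : 'rV[R]_d -> R) = c.
Proof.
elim: d => // k IH; rewrite -[RHS]Rintegral01_cst; apply: eq_Rintegral => t _.
exact: IH.
Qed.

(** Only linearity and the sup bound are available: 0 <= psi <= M means |psi - M/2| <= M/2, so the
    integral lies within M/2 of M/2. *)
Lemma torus_int_ge0 psi : torus_smooth psi -> (forall x, 0 <= psi x) -> 0 <= torus_int psi.
Proof.
move=> tp p0; have [M h] := ts_bd 0 tp; have tM := ts_cst (d := d) (M / 2).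
have : `|torus_int (fun x => psi x - cst (M / 2) x)| <= M / 2.
  apply: torus_int_bound; first exact: tsB tp tM.
  move=> x; have := bd0 x h; have := p0 x => /ger0_norm -> ?.
  have := p0 x; rewrite ler_norml /= => ?; apply/andP; split; lra.
by rewrite torus_intB// torus_int_cst ler_norml => /andP[+ _]; lra.
Qed.

Lemma torus_int_le psi chi : torus_smooth psi -> torus_smooth chi ->
  (forall x, psi x <= chi x) -> torus_int psi <= torus_int chi.
Proof.
move=> tp tc H; rewrite -subr_ge0 -torus_intB//; apply: torus_int_ge0.
  exact: tsB.
by move=> x; rewrite subr_ge0.
Qed.

End Properties.

(** The second-order Taylor remainder in the first variable is uniform in x, hence survives
    integration. *)
Lemma torus_int_time_derive d (V : 'rV[R]_(1 + d) -> R) (t : R) : torus_smooth V ->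
  is_derive t 1 (fun s => torus_int (slice V s)) (torus_int (slice (partial (time0 : 'I_(1 + d)) V) t)).
Proof.
move=> tV; have [M hM] := ts_bd 2 tV.
have tVs s := ts_slice s tV; have tVd s := ts_slice s (ts_partial time0 tV).
apply: (@is_derive_modulus _ _ _ _ _ _ (M / 2) 1) => // h h1.
rewrite [h *: 1]mulr1.
rewrite -(torus_intB (tVs _) (tVs t)) -(torus_intZ h (tVd t)).
have tB := tsB (tVs (t + h)) (tVs t); have tZ := tsZ h (tVd t).
rewrite -(torus_intB tB tZ); apply: torus_int_bound; first exact: tsB tB tZ.
move=> x; have := coord_taylor (glue t x) time0 h (ts_smooth tV) hM.
rewrite !big_ord_recl big_ord0 addr0 /= expr1 expr0 mul1r fact0 !divr1.
rewrite -glue_shift opprD addrA /slice; move/le_trans; apply.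
rewrite -mulrA mulrC ler_wpM2l ?sqr_le_modulus//.
by rewrite divr_ge0// (bd_ge0 hM).
Qed.

(** Induction on d: the first coordinate is handled by the fundamental theorem of calculus and
    periodicity, the others inside the inner integral. *)
Lemma torus_int_partial d (psi : 'rV[R]_d -> R) i : torus_smooth psi ->
  torus_int (partial i psi) = 0.
Proof.
elim: d psi i => [|d IH] psi i tp; first by case: i.
have tps t := @ts_slice R d psi t tp.
have [k|k] := @split_ordP 1 d i => ->; last first.
  rewrite torus_intS -[RHS]Rintegral01_cst; apply: eq_Rintegral => t _.
  rewrite -(partial_slice t k (@ts_smooth R (1 + d) _ tp)); exact: IH.
rewrite (ord1 k) torus_intS /Rintegral.
rewrite (continuous_FTC2 (F := fun s => torus_int (slice (psi : 'rV[R]_(1 + d) -> R) s)) ltr01).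
- have -> : slice (psi : 'rV[R]_(1 + d) -> R) 1 = slice (psi : 'rV[R]_(1 + d) -> R) 0.
    apply/funext => x; rewrite /slice.
    rewrite -[RHS](@ts_periodic R (1 + d) _ tp time0).
    by rewrite delta_time0 glueD addr0 add0r.
  by rewrite -EFinB subrr.
- apply: continuous_subspaceT => t; apply: differentiable_continuous.
  apply/derivable1_diffP; apply: ex_derive.
  exact: torus_int_time_derive (@ts_partial R (1 + d) _ time0 tp).
- have D t := @torus_int_time_derive d psi t tp.
  have C : continuous (fun s => torus_int (slice (psi : 'rV[R]_(1 + d) -> R) s)).
    by move=> t; apply: differentiable_continuous; apply/derivable1_diffP; apply: ex_derive.
  split; first by move=> t _; exact: ex_derive.
    exact/cvg_at_right_filter/C.
  exact/cvg_at_left_filter/C.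
- by move=> t _; rewrite derive1E; apply: derive_val; exact: torus_int_time_derive.
Qed.

Lemma torus_int_ibp d (psi chi : 'rV[R]_d -> R) i : torus_smooth psi -> torus_smooth chi ->
  torus_int (fun x => partial i psi x * chi x) =
  torus_int (fun x => psi x * (-1 * partial i chi x)).
Proof.
move=> tp tc; have tpi := ts_partial i tp; have tci := ts_partial i tc.
have E : torus_int (fun x => psi x * partial i chi x + chi x * partial i psi x) = 0.
  rewrite -(partialM i (ts_smooth tp) (ts_smooth tc)).
  exact: torus_int_partial (tsM tp tc).
rewrite (torus_intD (tsM tp tci) (tsM tc tpi)) in E.
have -> : (fun x => partial i psi x * chi x) = (fun x => chi x * partial i psi x).
  by apply/funext => x; rewrite mulrC.
have -> : (fun x => psi x * (-1 * partial i chi x)) = (fun x => -1 * (psi x * partial i chi x)).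
  by apply/funext => x; rewrite mulrCA.
by rewrite (torus_intZ _ (tsM tp tci)); lra.
Qed.

Lemma torus_int_mul_bound d (psi rho : 'rV[R]_d -> R) M : torus_smooth psi ->
  torus_smooth rho -> (forall x, 0 <= rho x) -> (forall x, `|psi x| <= M) ->
  `|torus_int (fun x => psi x * rho x)| <= M * torus_int rho.
Proof.
move=> tp tr r0 pM; rewrite -(torus_intZ M tr) ler_norml; apply/andP; split.
  rewrite -mulN1r -(torus_intZ _ (tsZ M tr)).
  apply: (torus_int_le (tsZ _ (tsZ M tr)) (tsM tp tr)) => x.
  have /ler_normlP[] := pM x => H _.
  by rewrite mulrA ler_wpM2r// mulN1r lerNl.
apply: (torus_int_le (tsM tp tr) (tsZ M tr)) => x.
by rewrite ler_wpM2r// (le_trans (ler_norm _)).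
Qed.

End TorusIntegral.

(** * Differential operators *)

Section DifferentialOperators.
Context {R : realType} {d : nat}.
Local Notation fn := ('rV[R]_d -> R).
Implicit Types (psi chi c : fn) (A B : fn -> fn).

(** Differential operators of order at most k with smooth periodic coefficients, generated by
    constructors, so that linearity, bounds, adjoints and commutation with time derivatives follow
    by induction. [diffop_ext] is there because an operator acts on all functions but takes its
    generated form on smooth ones only. *)
Inductive diffop : nat -> (fn -> fn) -> Prop :=
| diffop_id : diffop 0 id
| diffop_partial k i B : diffop k B -> diffop k.+1 (fun psi => partial i (B psi))
| diffop_mul k c B : torus_smooth c -> diffop k B -> diffop k (fun psi x => c x * B psi x)
| diffop_add k A B : diffop k A -> diffop k B -> diffop k (fun psi x => A psi x + B psi x)
| diffop_weak k k' B : (k <= k')%N -> diffop k B -> diffop k' B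
| diffop_ext k A B : (forall psi, torus_smooth psi -> A psi = B psi) ->
    diffop k A -> diffop k B.

Lemma diffop_ts k B psi : diffop k B -> torus_smooth psi -> torus_smooth (B psi).
Proof.
move=> dB; elim: dB psi => {k B} [psi //|k i B _ IH psi tp|k c B tc _ IH psi tp
  |k A B _ IHA _ IHB psi tp|k k' B _ _ IH psi tp|k A B e _ IH psi tp].
- exact: ts_partial (IH psi tp).
- exact: tsM tc (IH psi tp).
- exact: tsD (IHA psi tp) (IHB psi tp).
- exact: IH.
- rewrite -(e _ tp); exact: (IH _ tp).
Qed.

Lemma diffop_comp k l A B : diffop k A -> diffop l B -> diffop (k + l) (fun psi => A (B psi)).
Proof.
move=> dA dB; elim: dA => {k A} [|k i A _ IH|k c A tc _ IH|k A A' _ IHA _ IHA'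
  |k k' A kk _ IH|k A A' e _ IH].
- exact: dB.
- by rewrite addSn; exact: (diffop_partial i IH).
- exact: (diffop_mul tc IH).
- exact: (diffop_add IHA IHA').
- by apply: diffop_weak IH; rewrite leq_add2r.
- apply: diffop_ext IH => psi tp; apply: e; exact: diffop_ts dB tp.
Qed.

Lemma diffop_lin k B a psi chi : diffop k B -> torus_smooth psi -> torus_smooth chi ->
  B (fun x => psi x + a * chi x) = (fun x => B psi x + a * B chi x).
Proof.
move=> dB tp tc; have t1 := tsD tp (tsZ a tc).
elim: dB => {k B} [//|k i B dB IH|k c B _ _ IH|k A B _ IHA _ IHB|//|k A B e _ IH].
- have tBp := ts_smooth (diffop_ts dB tp); have tBc := ts_smooth (diffop_ts dB tc).
  by rewrite IH (partialD i tBp (smoothZ a tBc)) (partialZ i a tBc).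
- by apply/funext => x; rewrite IH; ring.
- by apply/funext => x; rewrite IHA IHB; ring.
- by rewrite -(e _ t1) -(e _ tp) -(e _ tc).
Qed.

Lemma diffopD k B psi chi : diffop k B -> torus_smooth psi -> torus_smooth chi ->
  B (fun x => psi x + chi x) = (fun x => B psi x + B chi x).
Proof.
move=> dB tp tc; have := diffop_lin 1 dB tp tc.
have -> : (fun x => psi x + 1 * chi x) = (fun x => psi x + chi x).
  by apply/funext => x; rewrite mul1r.
by move=> ->; apply/funext => x; rewrite mul1r.
Qed.

Lemma diffop0 k B : diffop k B -> B (cst 0) = cst 0.
Proof.
move=> dB; have t0 : torus_smooth (cst 0 : fn) := ts_cst 0.
have := diffop_lin (-1) dB t0 t0.
have -> : (fun x : 'rV[R]_d => cst 0 x + -1 * cst 0 x) = cst 0 :> fn.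
  by apply/funext => x /=; ring.
by move=> E; rewrite [LHS]E; apply/funext => x /=; ring.
Qed.

Lemma diffopZ k B a psi : diffop k B -> torus_smooth psi ->
  B (fun x => a * psi x) = (fun x => a * B psi x).
Proof.
move=> dB tp; have := diffop_lin a dB (ts_cst 0) tp; rewrite (diffop0 dB).
have -> : (fun x => cst 0 x + a * psi x) = (fun x => a * psi x).
  by apply/funext => x; rewrite add0r.
by move=> ->; apply/funext => x; rewrite add0r.
Qed.

Lemma diffop_sum_in k B (I : Type) (r : seq I) (P : pred I) (F : I -> fn) :
  diffop k B -> (forall i, P i -> torus_smooth (F i)) ->
  B (fun x => \sum_(i <- r | P i) F i x) = (fun x => \sum_(i <- r | P i) B (F i) x).
Proof.
move=> dB tF; elim: r => [|i r IH].
  have -> : (fun x => \sum_(i <- [::] | P i) F i x) = cst 0 :> fn.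
    by apply/funext => x; rewrite big_nil.
  by rewrite (diffop0 dB); apply/funext => x; rewrite big_nil.
have E (G : I -> fn) : (fun x => \sum_(j <- i :: r | P j) G j x) =
    if P i then (fun x => G i x + \sum_(j <- r | P j) G j x)
    else (fun x => \sum_(j <- r | P j) G j x).
  by apply/funext => x; rewrite big_cons; case: (P i).
rewrite (E F) (E (fun j => B (F j))); case: (boolP (P i)) => Pi //.
by rewrite (diffopD dB (tF i Pi) (ts_sum r tF)) IH.
Qed.

Lemma diffop_zero k : diffop k (fun=> cst 0).
Proof.
apply: (diffop_weak (leq0n k)).
apply: (@diffop_ext _ (fun psi x => cst 0 x * id psi x)).
  by move=> psi _; apply/funext => x; rewrite mul0r.
by apply: diffop_mul; [exact: ts_cst|exact: diffop_id].
Qed.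

Lemma diffop_sum k (I : Type) (r : seq I) (P : pred I) (F : I -> fn -> fn) :
  (forall i, P i -> diffop k (F i)) ->
  diffop k (fun psi x => \sum_(i <- r | P i) F i psi x).
Proof.
move=> H; elim: r => [|i r IH].
  apply: (@diffop_ext _ (fun=> cst 0)); last exact: diffop_zero.
  by move=> psi _; apply/funext => x; rewrite big_nil.
case: (boolP (P i)) => Pi.
  apply: (@diffop_ext _ (fun psi x => F i psi x + \sum_(j <- r | P j) F j psi x)).
    by move=> psi _; apply/funext => x; rewrite big_cons Pi.
  exact: (diffop_add (H i Pi) IH).
apply: (@diffop_ext _ (fun psi x => \sum_(j <- r | P j) F j psi x)) IH.
by move=> psi _; apply/funext => x; rewrite big_cons (negbTE Pi).
Qed.

Lemma diffop_scale k a B : diffop k B -> diffop k (fun psi x => a * B psi x).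
Proof. exact: (diffop_mul (ts_cst a)). Qed.

Lemma diffop_bd k B j : diffop k B -> exists2 C : R, 0 <= C &
  forall psi M, torus_smooth psi -> bd (j + k) psi M -> bd j (B psi) (C * M).
Proof.
move=> dB; elim: dB j => {k B} [|k i B dB IH|k c B tc dB IH|k A B dA IHA dB IHB
  |k k' B kk dB IH|k A B e dA IH] j.
- by exists 1 => // psi M _; rewrite addn0 mul1r.
- have [C C0 HC] := IH j.+1; exists C => // psi M tp hp.
  by apply: bd_partial; apply: HC => //; rewrite addSnnS.
- have [C C0 HC] := IH j; have [Mc hc] := ts_bd j tc.
  have Mc0 := bd_ge0 hc.
  exists (2 ^+ j * Mc * C) => [|psi M tp hp].
    by rewrite mulr_ge0// mulr_ge0// exprn_ge0.
  have tB := ts_smooth (diffop_ts dB tp).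
  have -> : 2 ^+ j * Mc * C * M = 2 ^+ j * (Mc * (C * M)) by ring.
  exact: (bdM (ts_smooth tc) tB hc (HC _ _ tp hp)).
- have [C C0 HC] := IHA j; have [C' C0' HC'] := IHB j.
  exists (C + C') => [|psi M tp hp]; first exact: addr_ge0.
  have tA := ts_smooth (diffop_ts dA tp); have tB := ts_smooth (diffop_ts dB tp).
  rewrite mulrDl; exact: (bdD tA tB (HC _ _ tp hp) (HC' _ _ tp hp)).
- have [C C0 HC] := IH j; exists C => // psi M tp hp; apply: HC => //.
  by apply: bdW (lexx M) hp; rewrite leq_add2l.
- have [C C0 HC] := IH j; exists C => // psi M tp hp.
  by rewrite -(e _ tp); exact: HC.
Qed.

(** Each constructor is moved to the other factor: a derivative by parts, a coefficient by absorbing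
    it into psi. *)
Lemma diffop_adjoint_ex k B psi : diffop k B -> torus_smooth psi ->
  exists g, torus_smooth g /\ forall phi, torus_smooth phi ->
    torus_int (fun x => B phi x * psi x) = torus_int (fun x => phi x * g x).
Proof.
move=> dB; elim: dB psi => {k B} [|k i B dB IH|k c B tc dB IH|k A B dA IHA dB IHB
  |k k' B kk dB IH|k A B e dA IH] psi tp.
- by exists psi.
- have [g [tg Hg]] := IH _ (tsZ (-1) (ts_partial i tp)).
  exists g; split => // phi tphi.
  by rewrite (torus_int_ibp i (diffop_ts dB tphi) tp) Hg.
- have [g [tg Hg]] := IH _ (tsM tc tp); exists g; split => // phi tphi.
  by rewrite -Hg//; congr torus_int; apply/funext => x; ring.
- have [g [tg Hg]] := IHA _ tp; have [h [th Hh]] := IHB _ tp.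
  exists (fun x => g x + h x); split => [|phi tphi]; first exact: tsD tg th.
  have -> : (fun x => (A phi x + B phi x) * psi x) =
      (fun x => A phi x * psi x + B phi x * psi x).
    by apply/funext => x; rewrite mulrDl.
  rewrite (torus_intD (tsM (diffop_ts dA tphi) tp) (tsM (diffop_ts dB tphi) tp)).
  rewrite Hg// Hh// -(torus_intD (tsM tphi tg) (tsM tphi th)).
  by congr torus_int; apply/funext => x; rewrite mulrDr.
- exact: IH.
- have [g [tg Hg]] := IH _ tp; exists g; split => // phi tphi.
  by rewrite -(e _ tphi) Hg.
Qed.

Lemma diffop_adjointP k B psi : diffop k B -> torus_smooth psi ->
  torus_smooth (adjoint B psi) /\ forall phi, torus_smooth phi ->
    torus_int (fun x => B phi x * psi x) = torus_int (fun x => phi x * adjoint B psi x).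
Proof. by move=> dB tp; exact: (xgetPex (cst 0) (diffop_adjoint_ex dB tp)). Qed.

End DifferentialOperators.

(** * The operators A_n and L_n as differential operators *)

Section Operators.
Context {R : realType} {d m : nat}.
Variables (f : 'rV[R]_d -> 'rV[R]_d) (sigma : 'rV[R]_d -> 'M[R]_(d, m)).
Hypothesis f_smooth : forall i, torus_smooth (fun x => f x 0 i).
Hypothesis sigma_smooth : forall i l, torus_smooth (fun x => sigma x i l).
Local Notation fn := ('rV[R]_d -> R).
Local Notation frozen := (frozen_generator f sigma).
Local Notation A := (Aop f sigma).
Local Notation L := (Lop f sigma).

Lemma ts_diffusion i j : torus_smooth (fun x => diffusion sigma x i j).
Proof.
apply: tsZ; apply: ts_sum => l _.
exact: tsM (sigma_smooth i l) (sigma_smooth j l).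
Qed.

Lemma frozen_diffop y : diffop 2 (frozen y).
Proof.
apply: diffop_add; apply: diffop_sum => i _.
  apply: (diffop_weak (k := 1)) => //; apply: diffop_scale.
  exact: diffop_partial (diffop_id).
apply: diffop_sum => j _; apply: diffop_scale.
exact: diffop_partial (diffop_partial j diffop_id).
Qed.

Lemma iter_frozen_diffop y n : diffop (2 * n) (iter n (frozen y)).
Proof.
elim: n => [|n IH]; first exact: diffop_id.
by rewrite mulnS; exact: (diffop_comp (frozen_diffop y) IH).
Qed.

(** With x fixed the coefficients are constants, so those of the innermost factor pass through the
    outer ones; evaluating at x then turns them into multiplication by functions. [G] collects the
    derivatives already applied to psi. *)
Lemma unfreeze_diffop n l (G : fn -> fn) : diffop l G ->
  diffop (2 * n + l) (fun psi x => iter n (frozen x) (G psi) x).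
Proof.
elim: n l G => [|n IH] l G dG; first exact: dG.
pose G1 i psi := partial i (G psi); pose G2 i j psi := partial i (partial j (G psi)).
have dG1 i : diffop l.+1 (G1 i) := diffop_partial i dG.
have dG2 i j : diffop l.+2 (G2 i j) := diffop_partial i (diffop_partial j dG).
apply: (@diffop_ext _ _ _ (fun psi x =>
    \sum_i f x 0 i * iter n (frozen x) (G1 i psi) x +
    \sum_i \sum_j diffusion sigma x i j * iter n (frozen x) (G2 i j psi) x)).
  move=> psi tp; apply/funext => x; rewrite iterSr.
  have dF := iter_frozen_diffop x n.
  have t1 i := diffop_ts (dG1 i) tp; have t2 i j := diffop_ts (dG2 i j) tp.
  rewrite /frozen_generator.
  have ts1 := ts_sum (index_enum 'I_d) (P := xpredT) (fun i _ => tsZ (f x 0 i) (t1 i)).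
  have ts2 i := ts_sum (index_enum 'I_d) (P := xpredT)
    (fun j _ => tsZ (diffusion sigma x i j) (t2 i j)).
  have ts3 := ts_sum (index_enum 'I_d) (P := xpredT) (fun i _ => ts2 i).
  rewrite (diffopD dF ts1 ts3).
  rewrite (diffop_sum_in _ dF (fun i _ => tsZ (f x 0 i) (t1 i))).
  rewrite (diffop_sum_in _ dF (fun i _ => ts2 i)).
  congr (_ + _); apply: eq_bigr => i _.
    by rewrite (diffopZ _ dF (t1 i)).
  rewrite (diffop_sum_in _ dF (fun j _ => tsZ (diffusion sigma x i j) (t2 i j))).
  by apply: eq_bigr => j _; rewrite (diffopZ _ dF (t2 i j)).
apply: diffop_add; apply: diffop_sum => i _.
  apply: (diffop_mul (f_smooth i)); apply: diffop_weak (IH _ _ (dG1 i)).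
  by rewrite mulnS addnS -addSn leq_add2r add2n ltnS leqnSn.
apply: diffop_sum => j _; apply: (diffop_mul (ts_diffusion i j)).
apply: diffop_weak (IH _ _ (dG2 i j)).
by rewrite mulnS -addSnnS -addSnnS leq_add2r add2n.
Qed.

Lemma Aop_diffop n : diffop (2 * n) (A n).
Proof.
have := unfreeze_diffop n diffop_id; rewrite addn0 => dA.
exact: (diffop_scale _ dA).
Qed.

Lemma frozen_cst y c : frozen y (cst c) = cst 0.
Proof.
apply/funext => x; rewrite /frozen_generator !big1 ?addr0// => i _.
  by rewrite big1// => j _; rewrite !partial_cst mulr0.
by rewrite partial_cst mulr0.
Qed.

Lemma Aop_cst n c : A n.+1 (cst c) = cst 0.
Proof.
apply/funext => x; rewrite /Aop iterSr frozen_cst.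
by rewrite (diffop0 (iter_frozen_diffop x n)) mulr0.
Qed.

Lemma generator_diffop : diffop 2 (generator f sigma).
Proof.
apply: (@diffop_ext _ _ _ (A 1)); last exact: (Aop_diffop 1).
by move=> psi _; rewrite Aop1.
Qed.

Lemma LopE' n psi : L n psi = Lop_step f sigma L n psi.
Proof.
case: n => [|n]; last exact: LopE.
by apply/funext => x; rewrite /Lop_step big_nil addr0 Lop0 Aop1.
Qed.

Lemma foldr_diffop k K (Ls : nat -> fn -> fn) (B : fn -> fn) (t : seq 'I_K) :
  (forall i : 'I_K, i \in t -> diffop (2 * i).+2 (Ls i)) -> diffop k B ->
  diffop (2 * (\sum_(i <- t) i + size t) + k)%N
    (fun psi => foldr (fun (i : 'I_K) g => Ls i g) (B psi) t).
Proof.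
move=> dL dB; elim: t dL => [|i t IH] dL.
  by rewrite big_nil muln0 add0n.
rewrite big_cons /=.
have -> : (2 * (i + \sum_(j <- t) j + (size t).+1) + k
    = (2 * i).+2 + (2 * (\sum_(j <- t) j + size t) + k))%N by lia.
apply: diffop_comp; first by apply: dL; rewrite mem_head.
by apply: IH => j jt; apply: dL; rewrite inE jt orbT.
Qed.

(** In the recursion L_(n_1) ... L_(n_l) A_(q+1), with n_1 + ... + n_l + q = n - l, has order 2(n -
    l) + 2l + 2 = 2n + 2, whatever the indices. *)
Lemma Lop_diffop n : diffop (2 * n).+2 (L n).
Proof.
elim/ltn_ind: n => n IH.
apply: (@diffop_ext _ _ _ (Lop_step f sigma L n)).
  by move=> psi _; rewrite LopE'.
rewrite /Lop_step; apply: diffop_add.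
  by apply: diffop_weak (Aop_diffop n.+1); rewrite mulnS.
under [X in diffop _ X]eq_fun => psi do under eq_fun => x do rewrite big_nat.
apply: diffop_sum => l /andP[l0 ln]; apply: diffop_scale.
apply: diffop_sum => t _; apply: diffop_sum => q /eqP tq.
apply: diffop_weak (foldr_diffop _ (Aop_diffop q.+1)).
  by rewrite size_tuple; lia.
move=> i it; apply: IH; have : (i <= \sum_(k <- t) k)%N.
  by rewrite (big_rem i it) /= leq_addr.
by move: tq; set S := (\sum_(k <- t) k)%N; move: (nat_of_ord i) S (nat_of_ord q) => i' S q'; lia.
Qed.

(** Every term of the recursion applies some A_(q+1) first, and this kills constants. *)
Lemma Lop_cst n c : L n (cst c) = cst 0.
Proof.
rewrite LopE' /Lop_step; apply/funext => x.
rewrite Aop_cst add0r big_nat big1// => l _.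
rewrite big1 ?mulr0// => t _; rewrite big1// => q _.
rewrite Aop_cst; suff -> : foldr (fun (k : 'I_n.+1) g => L k g) (cst 0) t = cst 0 by [].
by elim: (tval t) => //= k s ->; exact: diffop0 (Lop_diffop k).
Qed.

End Operators.

(** * The formal identity exp (\sum_n tau^(n+1) L_n) = \sum_n tau^n A_n *)

Section FormalSeries.
Context {R : realType} {d : nat}.
Local Notation fn := ('rV[R]_d -> R).
Implicit Types (T : nat -> fn -> fn) (u w : nat -> fn) (psi : fn).

(* Coefficient of tau^n in (\sum_k tau^(k+1) T_k) (\sum_k tau^k u_k). *)
Definition conv T u : nat -> fn := fun n x => \sum_(k < n) T k (u (n - k.+1)%N) x.

Lemma convE T u n x : conv T u n x = \sum_(k < n) T k (u (n - k.+1)%N) x.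
Proof. by []. Qed.

Definition linear_ops T := forall k, exists l, diffop l (T k).

Definition ts_seq u := forall n, torus_smooth (u n).

Lemma ts_conv T u : linear_ops T -> ts_seq u -> ts_seq (conv T u).
Proof.
move=> lT tu n; apply: ts_sum => k _; have [l dl] := lT k.
exact: (diffop_ts dl (tu _)).
Qed.

Lemma ts_iter_conv T u j : linear_ops T -> ts_seq u -> ts_seq (iter j (conv T) u).
Proof. by move=> lT tu; elim: j => [|j IH]; [exact: tu|exact: ts_conv lT IH]. Qed.

Lemma conv_local T u w n : (forall k, (k < n)%N -> u k = w k) -> conv T u n = conv T w n.
Proof.
move=> uw; apply/funext => x; apply: eq_bigr => k _; rewrite uw//.
by rewrite ltn_subrL /= (leq_ltn_trans _ (ltn_ord k)).
Qed.

Lemma iter_conv_local T u w j n : (forall k, (k <= n)%N -> u k = w k) ->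
  iter j (conv T) u n = iter j (conv T) w n.
Proof.
elim: j n => [|j IH] n uw; first exact: uw.
apply: conv_local => k kn; apply: IH => i ik; apply: uw.
exact: leq_trans ik (ltnW kn).
Qed.

(** Each factor raises the degree in tau by at least one, so powers beyond n do not reach tau^n and
    the exponential series are finite sums in each degree. *)
Lemma iter_conv_small T u j n : linear_ops T -> (n < j)%N -> iter j (conv T) u n = cst 0.
Proof.
move=> lT; elim: j n => // j IH n nj; apply/funext => x.
rewrite iterS convE big1// => k _; have [l dl] := lT k.
by rewrite IH ?(diffop0 dl)//; have := ltn_ord k; lia.
Qed.

Lemma conv_sum T (I : Type) (r : seq I) (c : I -> R) (F : I -> nat -> fn) n :
  linear_ops T -> (forall i, ts_seq (F i)) ->
  conv T (fun n x => \sum_(i <- r) c i * F i n x) n =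
  fun x => \sum_(i <- r) c i * conv T (F i) n x.
Proof.
move=> lT tF; apply/funext => x; rewrite /conv.
under [RHS]eq_bigr do rewrite mulr_sumr.
rewrite exchange_big; apply: eq_bigr => k _; have [l dl] := lT k.
rewrite (diffop_sum_in r (P := xpredT) dl (fun i _ => tsZ (c i) (tF i _))).
by apply: eq_bigr => i _; rewrite (diffopZ _ dl (tF i _)).
Qed.

Lemma iter_conv_sum T (I : Type) (r : seq I) (c : I -> R) (F : I -> nat -> fn) j n :
  linear_ops T -> (forall i, ts_seq (F i)) ->
  iter j (conv T) (fun n x => \sum_(i <- r) c i * F i n x) n =
  fun x => \sum_(i <- r) c i * iter j (conv T) (F i) n x.
Proof.
move=> lT tF; elim: j n => // j IH n.
rewrite iterS (conv_local T (w := fun n x => \sum_(i <- r) c i * iter j (conv T) (F i) n x)).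
  exact: (conv_sum _ _ _ lT (fun i => ts_iter_conv j lT (tF i))).
by move=> k _; exact: IH.
Qed.

(** The formal series psi tau^i. *)
Definition delta (i : nat) psi : nat -> fn := fun n => if n == i then psi else cst 0.

Lemma ts_delta i psi : torus_smooth psi -> ts_seq (delta i psi).
Proof. by move=> tp n; rewrite /delta; case: eqP => _; [exact: tp|exact: ts_cst]. Qed.

Lemma conv_delta T i psi n : linear_ops T ->
  conv T (delta i psi) n = if (i < n)%N then T (n - i.+1)%N psi else cst 0.
Proof.
move=> lT; apply/funext => x; rewrite /conv /delta.
have H (k : 'I_n) : (n - k.+1 == i)%N = false -> T k (cst 0) x = 0.
  by have [l dl] := lT k; rewrite (diffop0 dl).
have [ni|ni] := ltnP i n; last first.
  rewrite big1// => k _; have e : (n - k.+1 == i)%N = false by have := ltn_ord k; lia.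
  by rewrite e H.
have kn : (n - i.+1 < n)%N by lia.
rewrite (bigD1 (Ordinal kn))//= big1 ?addr0 => [|k /eqP/val_eqP/= ki].
  by have -> : (n - (n - i.+1).+1 == i)%N by lia.
have e : (n - k.+1 == i)%N = false by have := ltn_ord k; lia.
by rewrite e H.
Qed.

Lemma iter_conv_shift T i psi j n : linear_ops T ->
  iter j (conv T) (delta i psi) (n + i)%N = iter j (conv T) (delta 0 psi) n /\
  forall k, (k < i)%N -> iter j (conv T) (delta i psi) k = cst 0.
Proof.
move=> lT; elim: j n => [|j IH] n /=.
  by rewrite /delta -[X in (_ == X)]add0n eqn_add2r; split=> // k ki; rewrite ltn_eqF.
have small k : (k < i)%N -> iter j (conv T) (delta i psi) k = cst 0 by have [_] := IH 0%N; exact.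
split => [|k ki]; apply/funext => x; rewrite !convE.
  have H k : (k < n + i)%N -> (n <= k)%N ->
      T k (iter j (conv T) (delta i psi) (n + i - k.+1)%N) x = 0.
    move=> kni nk; have [l dl] := lT k.
    by rewrite small ?(diffop0 dl)//; lia.
  rewrite -(big_mkord xpredT (fun k => T k (iter j (conv T) (delta i psi) (n + i - k.+1)%N) x)).
  rewrite (big_cat_nat (n := n)) ?leq_addr//= [X in _ + X]big_nat_cond [X in _ + X]big1 ?addr0.
    rewrite big_mkord; apply: eq_bigr => k _.
    have -> : (n + i - k.+1 = (n - k.+1) + i)%N by have := ltn_ord k; lia.
    by have [-> _] := IH (n - k.+1)%N.
  by move=> k /andP[/andP[nk kni] _]; exact: H.
rewrite big1// => h _; have [l dl] := lT h.
by rewrite small ?(diffop0 dl)//; have := ltn_ord h; lia.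
Qed.

(** Unrolls the l-th power into the sum over tuples that occurs in [Lop_step]. The bounds [K] and
    [K'] are left free to match the index types there; larger indices exceed the degree. *)
Lemma iter_conv_tuples T l w n x K K' : linear_ops T -> ts_seq w ->
  (n <= K)%N -> (n < K')%N ->
  iter l (conv T) w n x = \sum_(t : l.-tuple 'I_K) \sum_(q < K' | (\sum_(k <- t) k + q + l == n)%N)
    foldr (fun (k : 'I_K) g => T k g) (w q) t x.
Proof.
move=> lT tw; elim: l n x => [|l IH] n x nK nK'.
  rewrite (big_pred1 [tuple]) /= => [|t]; last by apply/esym/eqP; exact: tuple0.
  rewrite (big_pred1 (Ordinal nK')) //= => q.
  by rewrite big_nil add0n addn0.
rewrite iterS convE.
transitivity (\sum_(k < K | (k < n)%N) T k (iter l (conv T) w (n - k.+1)%N) x).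
  by rewrite (big_ord_widen_cond K xpredT (fun k => T k (iter l (conv T) w (n - k.+1)%N) x) nK).
pose G (t : l.-tuple 'I_K) (q : 'I_K') := foldr (fun (k : 'I_K) g => T k g) (w q) t.
have tG t q : torus_smooth (G t q).
  rewrite /G; elim: (tval t) => [|k s IHs]; first exact: tw.
  by have [e de] := lT k; exact: diffop_ts de IHs.
transitivity (\sum_(k < K) \sum_(t : l.-tuple 'I_K)
   \sum_(q < K' | (k + \sum_(i <- t) i + q + l.+1 == n)%N) T k (G t q) x).
  rewrite big_mkcond /=; apply: eq_bigr => k _; have [e de] := lT k.
  case: ltnP => kn; last first.
    rewrite big1// => t _; rewrite big_pred0// => q; apply/eqP.
    by move: (\sum_(i <- t) i)%N (nat_of_ord q) => S q'; lia.
  have -> : iter l (conv T) w (n - k.+1)%N = fun x => \sum_(t : l.-tuple 'I_K)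
      \sum_(q < K' | (\sum_(i <- t) i + q + l == n - k.+1)%N) G t q x.
    by apply/funext => y; apply: IH; lia.
  rewrite (diffop_sum_in _ de (fun t _ => ts_sum _ (fun q _ => tG t q))).
  apply: eq_bigr => t _; rewrite (diffop_sum_in _ de (fun q _ => tG t q)).
  apply: eq_bigl => q.
  by move: (\sum_(i <- t) i)%N (nat_of_ord q) (nat_of_ord k) kn => S q' k' kn; lia.
rewrite pair_big /=.
rewrite (reindex (fun p : 'I_K * l.-tuple 'I_K => cons_tuple p.1 p.2)) /=.
  apply: eq_bigr => -[k t] _ /=; apply: eq_bigl => q.
  by rewrite big_cons.
exists (fun t : l.+1.-tuple 'I_K => (thead t, behead_tuple t)) => [[k t] _|t _] /=.
  by congr (_, _); apply: val_inj.
by rewrite [RHS]tuple_eta; apply: val_inj.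
Qed.

Lemma sum_triangle (F : nat -> nat -> R) K :
  (forall l j, (K < l + j)%N -> F l j = 0) ->
  \sum_(l < K.+1) \sum_(j < K.+1) F l j = \sum_(n < K.+1) \sum_(l < n.+1) F l (n - l)%N.
Proof.
move=> F0.
transitivity (\sum_(l < K.+1) \sum_(n < K.+1 | (l <= n)%N) F l (n - l)%N).
  apply: eq_bigr => l _; have lK := ltn_ord l.
  rewrite -(big_mkord xpredT (F l)) (big_cat_nat (n := (K.+1 - l)%N)) ?leq_subr//=.
  rewrite [X in _ + X]big_nat_cond [X in _ + X]big1 ?addr0; last first.
    by move=> j /andP[/andP[h _] _]; apply: F0; lia.
  rewrite -(big_mkord (fun n => (l <= n)%N) (fun n => F l (n - l)%N)).
  rewrite [RHS](big_cat_nat (n := l))//=; last exact: ltnW.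
  rewrite [X in _ = X + _]big_nat_cond [X in _ = X + _]big1 ?add0r; last first.
    by move=> j /andP[/andP[_ h] h']; lia.
  rewrite [RHS]big_nat_cond -[X in index_iota X K.+1]add0n big_addn.
  rewrite [LHS]big_nat_cond; apply: eq_big => [j|j _]; rewrite ?addnK//; lia.
rewrite (exchange_big_dep xpredT)//=; apply: eq_bigr => n _.
rewrite (big_ord_widen_cond K.+1 xpredT (fun l => F l (n - l)%N))//.
Qed.

End FormalSeries.

(** * Inverting the Bernoulli recursion *)

Section Exponential.
Context {R : realType} {d m : nat}.
Variables (f : 'rV[R]_d -> 'rV[R]_d) (sigma : 'rV[R]_d -> 'M[R]_(d, m)).
Hypothesis f_smooth : forall i, torus_smooth (fun x => f x 0 i).
Hypothesis sigma_smooth : forall i l, torus_smooth (fun x => sigma x i l).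
Local Notation fn := ('rV[R]_d -> R).
Local Notation A := (Aop f sigma).
Local Notation L := (Lop f sigma).
Implicit Types (psi : fn) (u : nat -> fn).

Lemma linear_Lop : linear_ops L.
Proof. by move=> k; exists (2 * k).+2%N; exact: Lop_diffop. Qed.

Lemma linear_AopS : linear_ops (fun k => A k.+1).
Proof. by move=> k; exists (2 * k.+1)%N; exact: Aop_diffop. Qed.

Local Notation a psi := (conv (fun k => A k.+1) (delta 0 psi)).
Local Notation beta l := (bernoulli l / l`!%:R : R).

Lemma aE psi n : a psi n.+1 = A n.+1 psi.
Proof. by rewrite (conv_delta _ _ _ linear_AopS) subSS subn0. Qed.

Lemma a0 psi : a psi 0 = cst 0.
Proof. by rewrite (conv_delta _ _ _ linear_AopS). Qed.

Lemma iter0 (T : Type) (g : T -> T) x : iter 0 g x = x.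
Proof. by []. Qed.

Lemma beta0 : beta 0 = 1.
Proof. by rewrite /bernoulli /= fact0 divr1. Qed.

(* z = b(z) (A - 1) with b(z) = z / (e^z - 1) *)
Lemma Lop_recursion psi K n : torus_smooth psi -> (n <= K)%N ->
  conv L (delta 0 psi) n = fun x => \sum_(l < K.+1) beta l * iter l (conv L) (a psi) n x.
Proof.
move=> tp nK; have ta := ts_conv linear_AopS (ts_delta 0 tp).
apply/funext => x.
have -> : \sum_(l < K.+1) beta l * iter l (conv L) (a psi) n x =
    \sum_(0 <= l < n.+1) beta l * iter l (conv L) (a psi) n x.
  rewrite -(big_mkord xpredT (fun l => beta l * iter l (conv L) (a psi) n x)).
  rewrite (big_cat_nat (n := n.+1))//= [X in _ + X]big_nat_cond [X in _ + X]big1 ?addr0//.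
  move=> l /andP[/andP[nl _] _].
  by rewrite (iter_conv_small _ linear_Lop nl) mulr0.
case: n nK => [|n] nK.
  rewrite big_nat1 /= a0 mulr0 convE big_ord0//.
rewrite (conv_delta _ _ _ linear_Lop) subSS subn0 LopE' /Lop_step.
have term l : iter l (conv L) (a psi) n.+1 x =
    if (l <= n)%N then \sum_(t : l.-tuple 'I_n.+1)
      \sum_(q < n.+1 | (\sum_(k <- t) k + q == n - l)%N)
        foldr (fun (k : 'I_n.+1) g => L k g) (A q.+1 psi) t x else 0.
  rewrite (iter_conv_tuples l x linear_Lop ta (leqnn n.+1) (ltnSn n.+1)).
  have fold0 (t : l.-tuple 'I_n.+1) :
      foldr (fun (k : 'I_n.+1) g => L k g) (a psi 0) t = cst 0.
    rewrite a0; elim: (tval t) => //= k t' ->.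
    exact: diffop0 (Lop_diffop f_smooth sigma_smooth k).
  (* The series A - 1 has no constant term, so q = 0 drops out; the shift by one produces the
     A_(q+1) of the definition. *)
  have skip0 (t : l.-tuple 'I_n.+1) :
      \sum_(q < n.+2 | (\sum_(k <- t) k + q + l == n.+1)%N)
        foldr (fun (k : 'I_n.+1) g => L k g) (a psi q) t x =
      \sum_(q < n.+1 | (\sum_(k <- t) k + q + l == n)%N)
        foldr (fun (k : 'I_n.+1) g => L k g) (A q.+1 psi) t x.
    rewrite big_mkcond big_ord_recl /= fold0 if_same add0r [RHS]big_mkcond /=.
    apply: eq_bigr => q _; rewrite aE /bump /=.
    by rewrite add1n addnS addSn eqSS.
  rewrite (eq_bigr _ (fun t _ => skip0 t)); case: leqP => ln.
    apply: eq_bigr => t _; apply: eq_bigl => q.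
    by move: (\sum_(k <- t) k)%N (nat_of_ord q) => S q'; lia.
  rewrite big1// => t _; apply: big_pred0 => q.
  by move: (\sum_(k <- t) k)%N (nat_of_ord q) => S q'; lia.
rewrite [RHS]big_nat_recl// beta0 mul1r iter0 aE /=; congr (_ + _).
under [RHS]eq_bigr do rewrite -iterS.
rewrite [RHS]big_nat_recr// term ltnn mulr0 /= addr0.
rewrite big_add1 /= !big_nat; apply: eq_bigr => l /andP[_ ln].
by rewrite -[conv L _](iterS l (conv L)) term ln.
Qed.

(** Inserting z = b(z) (A - 1) into e^z - 1, with z = \sum_n tau^(n+1) L_n, makes \sum_l (B_l / l!)
    / (k + 1 - l)! the coefficient of z^k (A - 1). By [bernoulli_genfun] it is 1 for k = 0 and 0
    otherwise, so e^z - 1 = A - 1. *)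
Lemma Aop_exp_delta psi n K : torus_smooth psi -> (n <= K)%N ->
  A n psi = fun x => \sum_(j < K.+1) j`!%:R^-1 * iter j (conv L) (delta 0 psi) n x.
Proof.
move=> tp nK; have ta := ts_conv linear_AopS (ts_delta 0 tp).
have tD := ts_delta 0 tp.
case: n nK => [|n] nK.
  rewrite Aop0; apply/funext => x; rewrite big_ord_recl /= fact0 invr1 mul1r.
  rewrite big1 ?addr0// => j _.
  by rewrite convE big_ord0 mulr0.
have bern : A n.+1 psi = fun x => \sum_(j < K.+1) j.+1`!%:R^-1 *
    iter j (conv L) (conv L (delta 0 psi)) n.+1 x.
  apply/funext => x.
  pose F l j := beta l / j.+1`!%:R * iter (j + l) (conv L) (a psi) n.+1 x.
  transitivity (\sum_(l < K.+1) \sum_(j < K.+1) F l j); last first.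
    rewrite exchange_big; apply: eq_bigr => j _.
    rewrite (iter_conv_local L (w := fun n x =>
      \sum_(l < K.+1) beta l * iter l (conv L) (a psi) n x)); last first.
      by move=> k kn; apply: Lop_recursion => //; exact: leq_trans kn nK.
    rewrite (iter_conv_sum _ _ _ _ linear_Lop); last first.
      by move=> l; exact: ts_iter_conv _ linear_Lop ta.
    rewrite mulr_sumr; apply: eq_bigr => l _.
    by rewrite /F iterD; ring.
  rewrite sum_triangle => [|l j h]; last first.
    rewrite /F (iter_conv_small _ linear_Lop) ?mulr0//.
    by rewrite addnC; exact: leq_ltn_trans nK h.
  rewrite big_ord_recl /= big_ord_recl big_ord0 addr0.
  rewrite /F beta0 subn0 factS fact0 mul1n divr1 mul1r /= aE.
  rewrite big1 ?addr0// => k _; change (bump 0 k) with k.+1.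
  transitivity ((k.+1 == 0)%N%:R * iter k.+1 (conv L) (a psi) n.+1 x : R); last first.
    by rewrite mul0r.
  rewrite -(bernoulli_genfun (R := R) k.+1) mulr_suml; apply: eq_bigr => l _.
  have lk : (l <= k.+1)%N by rewrite -ltnS.
  by rewrite /F subnK// (subSn lk).
apply/funext => x; rewrite bern big_ord_recr /= [RHS]big_ord_recl /=.
rewrite -iterSr (iter_conv_small _ linear_Lop) ?ltnS// mulr0 addr0.
rewrite /delta /= mulr0 add0r; apply: eq_bigr => j _.
by rewrite -iterSr /bump /= add1n.
Qed.

(** The identity on a single function extends to a series u = \sum_i u_i tau^i, since multiplication
    by tau^i commutes with all the operators; terms beyond degree n are irrelevant. *)
Lemma Aop_exp u n : ts_seq u ->
  (fun x => \sum_(k < n.+1) A k (u (n - k)%N) x) =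
  fun x => \sum_(j < n.+1) j`!%:R^-1 * iter j (conv L) u n x.
Proof.
move=> tu.
pose w : nat -> fn := fun k x => \sum_(i < n.+1) 1 * delta i (u i) k x.
have uw k : (k <= n)%N -> u k = w k.
  move=> kn; apply/funext => x; rewrite /w (bigD1 (Ordinal (kn : (k < n.+1)%N)))//=.
  rewrite /delta eqxx mul1r big1 ?addr0// => i /eqP/val_eqP/= ik.
  by rewrite eq_sym (negbTE ik) mulr0.
have E j : iter j (conv L) u n = fun x => \sum_(i < n.+1)
    iter j (conv L) (delta 0 (u i)) (n - i)%N x.
  rewrite (iter_conv_local _ _ uw).
  rewrite (iter_conv_sum _ _ _ _ linear_Lop); last by move=> i; exact: ts_delta.
  apply/funext => x; apply: eq_bigr => i _; rewrite mul1r.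
  have iN : (i <= n)%N by rewrite -ltnS.
  have [H _] := iter_conv_shift i (u i) j (n - i) linear_Lop.
  by rewrite -H subnK.
apply/funext => x.
under [RHS]eq_bigr do rewrite E mulr_sumr.
rewrite exchange_big /= (reindex_inj rev_ord_inj) /=; apply: eq_bigr => i _.
have iN : (i <= n)%N by rewrite -ltnS.
rewrite subSS subKn//.
by rewrite (Aop_exp_delta (tu i) (leq_subr i n)).
Qed.

(** L_k raises the degree by k+1 and costs 2(k+1) derivatives: two per degree. As j factors raise
    the degree by at least j, only the u_i with i + j <= n occur. *)
Lemma iter_conv_bd j n k : exists2 C : R, 0 <= C & forall u M, ts_seq u ->
  (forall i, (i + j <= n)%N -> bd (k + 2 * (n - i)) (u i) M) ->
  bd k (iter j (conv L) u n) (C * M).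
Proof.
elim: j n k => [|j IH] n k.
  exists 1 => // u M _ hu; rewrite mul1r.
  by have := hu n; rewrite addn0 leqnn subnn muln0 addn0; apply.
pose stmt (i : 'I_n) (C : R) := 0 <= C /\ forall u M, ts_seq u ->
  (forall i, (i + j.+1 <= n)%N -> bd (k + 2 * (n - i)) (u i) M) ->
  bd k (L i (iter j (conv L) u (n - i.+1)%N)) (C * M).
have [C HC] : {C : 'I_n -> R & forall i, stmt i (C i)}.
  apply: (@choice _ _ stmt) => i; have iN := ltn_ord i.
  have [C1 C10 H1] := diffop_bd k (Lop_diffop f_smooth sigma_smooth i).
  have [C2 C20 H2] := IH (n - i.+1)%N (k + (2 * i).+2)%N.
  exists (C1 * C2); split => [|u M tu hu]; first exact: mulr_ge0.
  rewrite -mulrA; apply: H1; first exact: ts_iter_conv _ linear_Lop tu _.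
  apply: H2 => // h hn; apply: bdW (lexx M) (hu h _); first by lia.
  by lia.
exists (\sum_i C i) => [|u M tu hu]; first by apply: sumr_ge0 => i _; have [] := HC i.
rewrite mulr_suml iterS; apply: bd_sum => i _.
  exact: diffop_ts (Lop_diffop f_smooth sigma_smooth i) (ts_iter_conv _ linear_Lop tu _).
by have [_] := HC i; apply.
Qed.

(** At least one factor L_k is applied, and it kills constants; this lets v_n be replaced by its
    distance to its limit. *)
Lemma iter_conv_cst u (c : nat -> R) j n : ts_seq u ->
  iter j.+1 (conv L) u n = iter j.+1 (conv L) (fun i x => u i x - c i) n.
Proof.
move=> tu; rewrite !iterSr; apply: iter_conv_local => k _.
apply/funext => x; apply: eq_bigr => i _.
have dL := Lop_diffop f_smooth sigma_smooth i.
have := diffop_lin (-1) dL (tu (k - i.+1)%N) (ts_cst (c (k - i.+1)%N)).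
rewrite (Lop_cst f_smooth sigma_smooth) => E.
have -> : (fun x => u (k - i.+1)%N x - c (k - i.+1)%N) =
    (fun x => u (k - i.+1)%N x + -1 * cst (c (k - i.+1)%N) x).
  by apply/funext => y; rewrite mulN1r.
by rewrite E mulr0 addr0.
Qed.

End Exponential.

(** * Time-dependent functions *)

Section RealLemmas.
Context {R : realType}.

(** Extensions to negative times are arbitrary, so identities valid for t >= 0 reach the time
    derivative at t = 0 only from the right. *)
Lemma derive_right_zero (k : R -> R) (t a : R) :
  is_derive t 1 k a -> (forall s, t <= s -> k s = 0) -> a = 0.
Proof.
move=> [dk <-] k0.
rewrite /derive cvg_at_rightE//; apply/cvg_lim => //.
apply: cvg_near_cst; near=> h.
rewrite /= k0 ?k0 ?subrr ?scaler0// lerDr [_ *: _]mulr1.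
by near: h; exact: nbhs_right_ge.
Unshelve. all: by end_near. Qed.

Lemma continuous_right_zero (k : R -> R) (t : R) : continuous k ->
  (forall s, t < s -> k s = 0) -> k t = 0.
Proof.
move=> ck k0; have H : k s @[s --> t^'+] --> k t by apply: cvg_at_right_filter; exact: ck.
have C : k s @[s --> t^'+] --> (0 : R).
  by apply: cvg_near_cst; near=> s; apply: k0.
exact: cvg_unique H C.
Unshelve. all: by end_near. Qed.

End RealLemmas.

Section TimeDependent.
Context {R : realType} {d : nat}.
Local Notation fn := ('rV[R]_d -> R).
Local Notation fnt := ('rV[R]_(1 + d) -> R).
Implicit Types (u g : R -> fn) (V : fnt) (c : fn).

Lemma Ck_translate n e (psi : 'rV[R]_e -> R) (w : 'rV[R]_e) :
  Ck n psi -> Ck n (fun x => psi (x + w)).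
Proof.
have h0 (chi : 'rV[R]_e -> R) : Ck 0 chi -> Ck 0 (fun x => chi (x + w)).
  move=> /Ck0P[cW dW]; apply/Ck0P; split.
    pose tr (y : 'rV[R]_e) := y + w.
    have ct : continuous tr by apply: (@lipschitz_continuous _ _ _ _ 1) => y z;
      rewrite mul1r /tr opprD addrACA subrr addr0.
    move=> x; apply: (@continuous_comp _ _ _ tr chi x); [exact: ct|exact: cW].
  move=> i x; apply: ex_derive.
  exact: is_derive_translate (derivableP (dW i (x + w))).
elim: n psi => [|n IH] psi hV; first exact: h0.
apply: CkS => [|i]; first by apply: h0; exact: CkW hV.
have -> : partial i (fun x => psi (x + w)) = (fun x => partial i psi (x + w)).
  apply/funext => x; apply: is_derive_partialE; apply: is_derive_translate.
  by have /Ck0P[_ dV] := CkW hV; exact: (derivableP (dV i (x + w))).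
by apply: IH; exact: Ck_partial.
Qed.

Lemma smooth_translate e (psi : 'rV[R]_e -> R) (w : 'rV[R]_e) : smooth psi -> smooth (fun x => psi (x + w)).
Proof. by move=> /smoothP h; apply/smoothP => n; apply: Ck_translate; exact: h. Qed.

Lemma partial_translate e (psi : 'rV[R]_e -> R) (w : 'rV[R]_e) i : smooth psi ->
  partial i (fun x => psi (x + w)) = (fun x => partial i psi (x + w)).
Proof.
move=> sp; apply/funext => x; apply: is_derive_partialE; apply: is_derive_translate.
exact: is_derive_partial.
Qed.

Definition cylinder c : fnt := fun z => c (rsubmx z).

Lemma slice_cylinder c t : slice (cylinder c) t = c.
Proof. by apply/funext => x; rewrite /slice /cylinder /glue row_mxKr. Qed.

Lemma continuous_rsubmx : continuous (@rsubmx R 1 1 d).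
Proof.
apply: (@lipschitz_continuous _ _ _ _ 1) => x y; rewrite mul1r.
have -> : rsubmx x - rsubmx y = rsubmx (x - y) by apply/rowP => i; rewrite !mxE.
rewrite [leLHS]/Num.norm /= mx_normrE; apply: bigmax_le => // -[i j] _ /=.
rewrite (ord1 i) mxE [leRHS]/Num.norm /= mx_normrE.
by apply/bigmax_geP; right; exists (0, rshift 1 j).
Qed.

Lemma is_derive_cylinder_space c z i a : is_derive (rsubmx z) (delta_mx 0 i) c a ->
  is_derive z (delta_mx 0 (rshift 1 i)) (cylinder c) a.
Proof.
move=> [dc <-].
have E : (fun h : R => h^-1 *: ((cylinder c \o shift z) (h *: delta_mx 0 (rshift 1 i)) - cylinder c z)) =
   (fun h : R => h^-1 *: ((c \o shift (rsubmx z)) (h *: delta_mx 0 i) - c (rsubmx z))).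
  apply/funext => h /=; congr (_ *: (_ - _)); rewrite /cylinder; congr c.
  by rewrite delta_mx_rshift scale_row_mx linearD /= row_mxKr.
by apply: DeriveDef; rewrite /derivable /derive E.
Qed.

Lemma is_derive_cylinder_time c z : is_derive z (delta_mx 0 (time0 : 'I_(1 + d))) (cylinder c) 0.
Proof.
have E : (fun h : R => h^-1 *: ((cylinder c \o shift z) (h *: delta_mx 0 (time0 : 'I_(1 + d))) - cylinder c z)) =
   (fun h : R => 0).
  apply/funext => h /=; rewrite /cylinder (_ : rsubmx (_ + _) = rsubmx z) ?subrr ?scaler0//.
  by rewrite delta_time0 glueZ linearD /= /glue row_mxKr scaler0 add0r.
apply: DeriveDef; rewrite /derivable /derive E; first exact: is_cvg_cst.
exact: lim_cst.
Qed.

Lemma Ck_cylinder n c : Ck n c -> Ck n (cylinder c).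
Proof.
have split_delta (i : 'I_(1 + d)) (b : fn) z : (forall j, derivable b (rsubmx z) (delta_mx 0 j)) ->
    is_derive z (delta_mx 0 i) (cylinder b)
      (match fintype.split i with inl _ => 0 | inr j => partial j b (rsubmx z) end).
  move=> db; case: splitP => [j|j] ij.
    have -> : i = time0 by apply: val_inj; rewrite /= ij (ord1 j).
    exact: is_derive_cylinder_time.
  have -> : i = rshift 1 j by exact: val_inj.
  by apply: is_derive_cylinder_space; exact: derivableP (db j).
have h0 (b : fn) : Ck 0 b -> Ck 0 (cylinder b).
  move=> /Ck0P[cb db]; apply/Ck0P; split.
    move=> z; apply: (@continuous_comp _ _ _ _ b z); last exact: cb.
    exact: continuous_rsubmx.
  move=> i z; apply: ex_derive; apply: split_delta; exact: (db^~ _).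
elim: n c => [|n IH] c hc; first exact: h0.
apply: CkS => [|i]; first by apply: h0; exact: CkW hc.
have /Ck0P[_ dc] := CkW hc.
have -> : partial i (cylinder c) =
    match fintype.split i with inl _ => cst 0 | inr j => cylinder (partial j c) end.
  apply/funext => z; rewrite (is_derive_partialE (split_delta i c z (dc^~ _))).
  by case: fintype.split.
by case: fintype.split => j; [exact: Ck_cst|apply: IH; exact: Ck_partial].
Qed.

Lemma smooth_cylinder c : smooth c -> smooth (cylinder c).
Proof. by move=> /smoothP h; apply/smoothP => n; apply: Ck_cylinder; exact: h. Qed.

Lemma partial_cylinder_time c : partial time0 (cylinder c) = cst 0.
Proof. by apply/funext => z; apply: is_derive_partialE; exact: is_derive_cylinder_time. Qed.

Definition evo u := smooth_half u /\ forall t, 0 <= t -> Defs.periodic (u t).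

Definition represents V u := smooth V /\ forall t, 0 <= t -> u t = slice V t.

(** A relation rather than an operator: values at negative times are unconstrained, and u and g are
    tied for t >= 0 by a common extension, including at t = 0. *)
Definition time_derivative u g := [/\ evo u, evo g &
  exists V, represents V u /\ represents (partial time0 V) g].

Lemma evo_rep u : evo u -> exists V, represents V u.
Proof.
move=> [[V sV uV] _]; exists V; split => // t t0; apply/funext => x.
by rewrite uV.
Qed.

Lemma rep_evo V u : represents V u -> (forall t, 0 <= t -> Defs.periodic (u t)) -> evo u.
Proof. by move=> [sV uV] pu; split => //; exists V => // t x t0; rewrite uV. Qed.

Lemma evo_ts u t : evo u -> 0 <= t -> torus_smooth (u t).
Proof.
move=> eu t0; have [V [sV uV]] := evo_rep eu.
by split; [exact: eu.2|rewrite uV//; exact: smooth_slice].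
Qed.

Lemma evo_time_derivative u : evo u -> exists g, time_derivative u g.
Proof.
move=> eu; have [V [sV uV]] := evo_rep eu.
exists (slice (partial time0 V)).
have sdV := smooth_partial time0 sV.
split => //; last by exists V.
apply: (@rep_evo (partial time0 V)) => // t t0 i x; apply/eqP; rewrite -subr_eq0; apply/eqP.
apply: (@derive_right_zero _ (fun s => slice V s (x + delta_mx 0 i) - slice V s x) t).
  by apply: is_deriveB; exact: is_derive_time.
move=> s ts; have s0 := le_trans t0 ts.
by rewrite -!uV// eu.2// subrr.
Qed.

(** Induction on the generation of B: space derivatives commute with the time derivative by symmetry
    of second derivatives, and coefficients extend to functions independent of time. *)
Lemma time_derivative_diffop k B u g : diffop k B -> time_derivative u g ->
  time_derivative (fun t => B (u t)) (fun t => B (g t)).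
Proof.
move=> dB [eu eg [V [rV rdV]]].
suff [W [rW rdW]] : exists W, represents W (fun t => B (u t)) /\
    represents (partial time0 W) (fun t => B (g t)).
  split; last by exists W.
    by apply: rep_evo rW _ => t t0; apply: ts_periodic; apply: diffop_ts dB (evo_ts eu t0).
  by apply: rep_evo rdW _ => t t0; apply: ts_periodic; apply: diffop_ts dB (evo_ts eg t0).
elim: dB => {k B} [|k i B _ [W [[sW uW] [sdW gW]]]|k c B tc _ [W [[sW uW] [sdW gW]]]
  |k A B _ [W [[sW uW] [sdW gW]]] _ [W' [[sW' uW'] [sdW' gW']]]
  |//|k A B e _ [W [[sW uW] [sdW gW]]]].
- by exists V.
- exists (partial (rshift 1 i) W); rewrite (schwarz _ _ sW).
  split; split; [exact: smooth_partial| |exact: smooth_partial|].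
    exact: (fun t t0 => etrans (congr1 (partial i) (uW t t0)) (partial_slice t i sW)).
  exact: (fun t t0 => etrans (congr1 (partial i) (gW t t0)) (partial_slice t i sdW)).
- exists (fun z => cylinder c z * W z).
  have sl := smooth_cylinder (ts_smooth tc).
  have -> : partial time0 (fun z => cylinder c z * W z) = (fun z => cylinder c z * partial time0 W z).
    rewrite (partialM _ sl sW) partial_cylinder_time; apply/funext => z /=.
    by rewrite mulr0 addr0.
  split; split; [exact: smoothM| |exact: smoothM|]; move=> t t0; apply/funext => x.
    by rewrite uW// -[in LHS](slice_cylinder c t).
  by rewrite gW// -[in LHS](slice_cylinder c t).
- exists (fun z => W z + W' z); rewrite (partialD _ sW sW').
  split; split; [exact: smoothD| |exact: smoothD|]; move=> t t0; apply/funext => x.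
    by rewrite uW// uW'.
  by rewrite gW// gW'.
- exists W; split; split => // t t0.
    by rewrite -uW// -e//; exact: evo_ts.
  by rewrite -gW// -e//; exact: evo_ts.
Qed.

Lemma evo_diffop k B u : diffop k B -> evo u -> evo (fun t => B (u t)).
Proof.
move=> dB eu; have [g ug] := evo_time_derivative eu.
by have [] := time_derivative_diffop dB ug.
Qed.

Lemma time_derivative_lin u g u' g' a : time_derivative u g -> time_derivative u' g' ->
  time_derivative (fun t x => u t x + a * u' t x) (fun t x => g t x + a * g' t x).
Proof.
move=> [eu eg [V [[sV uV] [sdV gV]]]] [eu' eg' [W [[sW uW] [sdW gW]]]].
have per w w' : evo w -> evo w' -> forall t, 0 <= t ->
    Defs.periodic (fun x => w t x + a * w' t x).
  by move=> [_ pw] [_ pw'] t t0 i x; rewrite pw// pw'.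
have sZ := smoothZ a sW.
have r1 : represents (fun z => V z + a * W z) (fun t x => u t x + a * u' t x).
  by split => [|t t0]; [exact: (smoothD sV sZ)|by rewrite uV// uW].
have r2 : represents (partial time0 (fun z => V z + a * W z)) (fun t x => g t x + a * g' t x).
  rewrite (partialD _ sV sZ) (partialZ _ _ sW); split => [|t t0].
    exact: (smoothD sdV (smoothZ a sdW)).
  by rewrite gV// gW.
split; [exact: rep_evo r1 (per _ _ eu eu')|exact: rep_evo r2 (per _ _ eg eg')|].
by exists (fun z => V z + a * W z).
Qed.

Lemma time_derivative_cst c : torus_smooth c -> time_derivative (fun=> c) (fun=> cst 0).
Proof.
move=> tc; have r : represents (cylinder c) (fun=> c).
  by split => [|t _]; [exact: smooth_cylinder (ts_smooth tc)|rewrite slice_cylinder].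
have r0 : represents (partial time0 (cylinder c)) (fun=> cst 0 : fn).
  by rewrite partial_cylinder_time; split => //; exact: smooth_cst.
split; last by exists (cylinder c).
  by apply: rep_evo r _ => t _; exact: ts_periodic.
by apply: rep_evo r0 _.
Qed.

Lemma time_derivative_shift u g s : 0 <= s -> time_derivative u g ->
  time_derivative (fun t => u (s + t)) (fun t => g (s + t)).
Proof.
move=> s0 [eu eg [V [[sV uV] [sdV gV]]]].
have H w W : evo w -> represents W w ->
    evo (fun t => w (s + t)) /\ represents (fun z => W (z + glue s 0)) (fun t => w (s + t)).
  move=> ew [sW wW].
  have r : represents (fun z => W (z + glue s 0)) (fun t => w (s + t)).
    split => [|t t0]; first exact: smooth_translate.
    rewrite wW ?addr_ge0//; apply/funext => x.
    by rewrite /slice glueD addr0 addrC.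
  split; last exact: r.
  by apply: rep_evo r _ => t t0; apply: ew.2; exact: addr_ge0.
have [e1 r1] := H _ _ eu (conj sV uV); have [e2 r2] := H _ _ eg (conj sdV gV).
split; [exact: e1|exact: e2|exists (fun z => V (z + glue s 0))].
by rewrite (partial_translate _ _ sV); exact: (conj r1 r2).
Qed.

Lemma evoD u u' : evo u -> evo u' -> evo (fun t x => u t x + u' t x).
Proof.
move=> eu eu'; have [g ug] := evo_time_derivative eu; have [g' ug'] := evo_time_derivative eu'.
have [+ _ _] := time_derivative_lin 1 ug ug'.
by congr evo; apply/funext => t; apply/funext => x; rewrite mul1r.
Qed.

Lemma evo_sum (I : Type) (r : seq I) (P : pred I) (F : I -> R -> fn) :
  (forall i, P i -> evo (F i)) -> evo (fun t x => \sum_(i <- r | P i) F i t x).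
Proof.
move=> eF; elim: r => [|i r IH].
  have [+ _ _] := time_derivative_cst (ts_cst (d := d) (0 : R)).
  by congr evo; apply/funext => t; apply/funext => x; rewrite big_nil.
have E : (fun t x => \sum_(j <- i :: r | P j) F j t x) =
    if P i then (fun t x => F i t x + \sum_(j <- r | P j) F j t x)
    else (fun t x => \sum_(j <- r | P j) F j t x).
  by case: (boolP (P i)) => Pi; apply/funext => t; apply/funext => x;
    rewrite big_cons ?Pi ?(negbTE Pi).
by rewrite E; case: (boolP (P i)) => // Pi; apply: evoD => //; exact: eF.
Qed.

Lemma evo_bounded u k (T : R) : evo u ->
  exists M, forall t, 0 <= t -> t <= T -> bd k (u t) M.
Proof.
have H0 w : evo w -> exists M, forall t, 0 <= t -> t <= T -> bd 0 (w t) M.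
  move=> ew; have [V [sV wV]] := evo_rep ew.
  (* One box contains both the times in [0, T] and the fundamental cube [0, 1]^d. *)
  have [M HM] := continuous_box_bounded 0 (Num.max T 1) (smooth_continuous sV).
  exists M => t t0 tT s x; rewrite leqn0 => /nilP ->.
  have [y y01 E] := periodic_cube x (ew.2 t t0).
  rewrite [D _ _ _]E wV//; apply: HM => i.
  have [j|j] := split_ordP i => ->.
    by rewrite (ord1 j) glueE_time t0 le_max tT.
  by have /andP[y0 y1] := y01 j; rewrite glueE_space y0 le_max y1 orbT.
elim: k u => [|k IH] u eu; first exact: H0.
have [M0 {}H0] := H0 u eu.
have ei i : evo (fun t => partial i (u t)) := evo_diffop (diffop_partial i diffop_id) eu.
have [M HM] : {M : 'I_d -> R & forall i t, 0 <= t -> t <= T -> bd k (partial i (u t)) (M i)}.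
  by apply: (@choice _ _ (fun i M => forall t, 0 <= t -> t <= T -> bd k (partial i (u t)) M)) => i;
    exact: IH (ei i).
exists (`|M0| + \sum_i `|M i|) => t t0 tT; apply: bdS.
  apply: bdW (H0 t t0 tT) => //; apply: le_trans (ler_norm _) _.
  by rewrite lerDl sumr_ge0.
move=> i; apply: bdW (HM i t t0 tT) => //.
rewrite (bigD1 i)//= addrCA -[leLHS]addr0 lerD ?ler_norm//.
by rewrite addr_ge0// sumr_ge0.
Qed.

Lemma time_taylor (K : nat) (u : nat -> R -> fn) (t h M : R) x : 0 <= t -> 0 <= h ->
  (forall k, (k < K)%N -> time_derivative (u k) (u k.+1)) -> evo (u K) ->
  (forall s, t <= s -> s <= t + h -> `|u K s x| <= M) ->
  `|u 0%N (t + h) x - \sum_(j < K) h ^+ j / j`!%:R * u j t x| <= M * (h ^+ K / K`!%:R).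
Proof.
move=> t0 h0 Du eK uM.
(* The extensions for different k are chosen independently and may disagree at negative times; on
   [t, t + h] they all coincide with the u k. *)
have [W HW] : {W : nat -> fnt & forall k, (k <= K)%N -> represents (W k) (u k) /\
    forall s, (k < K)%N -> 0 <= s -> u k.+1 s = slice (partial time0 (W k)) s}.
  apply: (@choice _ _ (fun k W => (k <= K)%N -> represents W (u k) /\
    forall s, (k < K)%N -> 0 <= s -> u k.+1 s = slice (partial time0 W) s)) => k.
  have [kK|Kk] := ltnP k K.
    have [_ _ [V [rV [_ gV]]]] := Du k kK; exists V => _; split => // s _ s0.
    exact: gV.
  have [-> |kK] := eqVneq k K; last first.
    by exists (cst 0) => kK'; move: kK; rewrite eqn_leq kK' Kk.
  by have [V rV] := evo_rep eK; exists V => _; split => // s; rewrite ltnn.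
have th : t <= t + h by rewrite lerDl.
have := @taylor_bound _ (fun k s => slice (W k) s x) K t (t + h) M th.
rewrite /taylor_sum /taylor_mono addrAC subrr add0r.
have WE k s : (k <= K)%N -> 0 <= s -> slice (W k) s x = u k s x.
  by move=> kK s0; have [[_ ->]] := HW k kK.
rewrite WE ?addr_ge0//.
have -> : \sum_(j < K) h ^+ j / j`!%:R * slice (W j) t x =
    \sum_(j < K) h ^+ j / j`!%:R * u j t x.
  by apply: eq_bigr => j _; rewrite WE// ltnW.
apply => [k kK|k s kK|s].
- apply: continuous_subspaceT; apply: continuous_time.
  by have [[]] := HW k (ltnW kK).
- rewrite in_itv/= => /andP[ts _]; have [[sW _] dW] := HW k (ltnW kK).
  have s0 : 0 <= s := le_trans t0 (ltW ts).
  rewrite WE// dW//; exact: is_derive_time.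
- rewrite in_itv/= => /andP[ts sth]; rewrite WE ?(le_trans t0)//; exact: uM.
Qed.

(** The Taylor bound of order two is applied to each space derivative, [D s] being itself a
    differential operator. *)
Lemma time_second_order k u g g' (t h M : R) : 0 <= t -> 0 <= h ->
  time_derivative u g -> time_derivative g g' ->
  (forall s, t <= s -> s <= t + h -> bd k (g' s) M) ->
  bd k (fun x => u (t + h) x - (u t x + h * g t x)) (M * h ^+ 2).
Proof.
move=> t0 h0 ug gg' hM s x sk.
have M0 : 0 <= M by apply: (@bd_ge0 _ _ k (g' t)); apply: hM; rewrite ?lerDl.
have th : 0 <= t + h by rewrite addr_ge0.
have [eu eg _] := ug; have [_ eg' _] := gg'.
have dDs : diffop (size s) (@D R d s).
  elim: (s) => [|i s' IH] /=; first exact: diffop_id.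
  exact: diffop_partial IH.
pose w j := if j is j'.+1 then if j' is 0 then (fun r => D s (g r)) else (fun r => D s (g' r))
  else (fun r => D s (u r)).
have := @time_taylor 2 w t h M x t0 h0.
have -> : D s (fun x => u (t + h) x - (u t x + h * g t x)) =
    (fun x => D s (u (t + h)) x - (D s (u t) x + h * D s (g t) x)).
  have tu := ts_smooth (evo_ts eu t0); have tg := ts_smooth (evo_ts eg t0).
  have tuh := ts_smooth (evo_ts eu th).
  have E (a b : fn) : (fun x => a x - b x) = (fun x => a x + -1 * b x).
    by apply/funext => y; rewrite mulN1r.
  have sZ := smoothZ h tg; have sD := smoothD tu sZ.
  by rewrite (E (u (t + h))) (DD _ tuh (smoothZ (-1) sD)) (DZ _ _ sD) (DD _ tu sZ) (DZ _ _ tg) -E.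
move=> H; apply: le_trans (_ : M * (h ^+ 2 / 2) <= _); last first.
  by rewrite ler_wpM2l// ler_pdivrMr// ler_peMr ?exprn_ge0// ler1n.
move: H; rewrite !big_ord_recl big_ord0 /= addr0 expr0 fact0 divr1 mul1r expr1.
rewrite (_ : (bump 0 0)`!%:R = 1)// divr1; apply.
- move=> [|[|//]] _; first exact: time_derivative_diffop dDs ug.
  exact: time_derivative_diffop dDs gg'.
- exact: evo_diffop dDs eg'.
- by move=> r tr rth; exact: hM.
Qed.

End TimeDependent.

(** * Exponential decay of the expansion *)

Section NonnegPolynomials.
Context {R : realType}.
Implicit Types p q : {poly R}.

(** Nonnegative coefficients make a polynomial nonnegative and nondecreasing on t >= 0, stably under
    sums and products, so values at earlier times can be replaced by the value at t. *)
Definition nneg_poly p := forall i, 0 <= p`_i.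

Lemma nneg_polyC (c : R) : 0 <= c -> nneg_poly c%:P.
Proof. by move=> c0 i; rewrite coefC; case: eqP. Qed.

Lemma nneg_polyX : nneg_poly 'X.
Proof. by move=> i; rewrite coefX; case: eqP. Qed.

Lemma nneg_polyD p q : nneg_poly p -> nneg_poly q -> nneg_poly (p + q).
Proof. by move=> hp hq i; rewrite coefD addr_ge0. Qed.

Lemma nneg_polyM p q : nneg_poly p -> nneg_poly q -> nneg_poly (p * q).
Proof. by move=> hp hq i; rewrite coefM sumr_ge0// => j _; rewrite mulr_ge0. Qed.

Lemma nneg_poly_sum n (F : 'I_n -> {poly R}) : (forall i, nneg_poly (F i)) ->
  nneg_poly (\sum_i F i).
Proof. by move=> hF i; rewrite coef_sum sumr_ge0// => j _; exact: hF. Qed.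

Lemma nneg_poly_ge0 p (t : R) : nneg_poly p -> 0 <= t -> 0 <= p.[t].
Proof.
by move=> hp t0; rewrite horner_coef sumr_ge0// => i _; rewrite mulr_ge0// exprn_ge0.
Qed.

Lemma nneg_poly_le p (s t : R) : nneg_poly p -> 0 <= s -> s <= t -> p.[s] <= p.[t].
Proof.
move=> hp s0 st; rewrite !horner_coef ler_sum// => i _.
by rewrite ler_wpM2l// lerXn2r// nnegrE// (le_trans s0).
Qed.

Lemma nneg_poly_majorant p : exists2 q, nneg_poly q & forall t : R, 0 <= t -> p.[t] <= q.[t].
Proof.
exists (\poly_(i < size p) `|p`_i|) => [i|t t0].
  by rewrite coef_poly; case: ifP.
rewrite horner_poly horner_coef ler_sum// => i _.
by rewrite ler_wpM2r ?exprn_ge0// ler_norm.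
Qed.

End NonnegPolynomials.

Section Semigroup.
Context {R : realType} {d m : nat}.
Variables (f : 'rV[R]_d -> 'rV[R]_d) (sigma : 'rV[R]_d -> 'M[R]_(d, m)).
Hypothesis f_smooth : forall i, torus_smooth (fun x => f x 0 i).
Hypothesis sigma_smooth : forall i l, torus_smooth (fun x => sigma x i l).
Local Notation fn := ('rV[R]_d -> R).
Local Notation L := (generator f sigma).
Implicit Types (u : R -> fn) (phi psi : fn).

Let dL : diffop 2 L := generator_diffop f_smooth sigma_smooth.

Lemma derive1_rep V u t x : represents V u -> 0 < t ->
  derive1 (u ^~ x) t = slice (partial time0 V) t x.
Proof.
move=> [sV uV] t0; rewrite derive1E.
have D := is_derive_time t x sV.
rewrite -(derive_val (is_derive := D)).
apply: near_eq_derive; near=> s; rewrite uV//.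
by apply: ltW; near: s; exact: lt_nbhsr.
Unshelve. all: by end_near. Qed.

Lemma cauchy_time_derivative F phi u : evo F -> cauchy_solution f sigma F phi u ->
  time_derivative u (fun t x => L (u t) x + F t x) /\ u 0 = phi.
Proof.
move=> eF [hu pu u0 Eu]; split; last exact: u0.
have eu : evo u by split.
have eg : evo (fun t x => L (u t) x + F t x) := evoD (evo_diffop dL eu) eF.
have [V rV] := evo_rep eu; have [W [sW gW]] := evo_rep eg.
have sdV := smooth_partial time0 rV.1.
split; [exact: eu|exact: eg|exists V; split; first exact: rV].
split; first exact: sdV.
have pos t x : 0 < t -> slice W t x = slice (partial time0 V) t x.
  move=> t0; rewrite -gW ?ltW// -(derive1_rep x rV t0).
  by rewrite -(Eu t x t0); ring.
(* The equation is given for positive times only; continuity from the right carries it to t = 0. *)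
move=> t t0; rewrite (gW t t0); apply/funext => x; apply/eqP; rewrite -subr_eq0; apply/eqP.
apply: (@continuous_right_zero _ (fun s => slice W s x - slice (partial time0 V) s x) t).
  move=> s; apply: cvgB; first exact: continuous_time sW s.
  exact: continuous_time sdV s.
by move=> s ts; rewrite pos ?subrr// (le_lt_trans t0).
Qed.

Definition evolves u := time_derivative u (fun t => L (u t)).

Lemma cauchy_evolves phi u : cauchy_solution f sigma (fun=> cst 0) phi u ->
  evolves u /\ u 0 = phi.
Proof.
move=> cu; have [_ e0 _] := time_derivative_cst (ts_cst (d := d) (0 : R)).
have [tu ->] := cauchy_time_derivative e0 cu; split; last by [].
move: tu; rewrite /evolves; congr time_derivative.
by apply/funext => t; apply/funext => x; rewrite addr0.
Qed.

Lemma evolves_cauchy u : evolves u -> cauchy_solution f sigma (fun=> cst 0) (u 0) u.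
Proof.
move=> [eu _ [V [rV [_ gV]]]].
split=> [| |//|t x t0]; [exact: eu.1|exact: eu.2|].
by rewrite (derive1_rep x rV t0) -gV ?ltW// subrr.
Qed.

Lemma evolves_lin u u' a : evolves u -> evolves u' -> evolves (fun t x => u t x + a * u' t x).
Proof.
move=> eu eu'; have [evu _ _] := eu; have [evu' _ _] := eu'.
have [e1 e2 [V [rV [sdV gV]]]] := time_derivative_lin a eu eu'.
have E t : 0 <= t -> L (fun x => u t x + a * u' t x) = fun x => L (u t) x + a * L (u' t) x.
  by move=> t0; exact: diffop_lin dL (evo_ts evu t0) (evo_ts evu' t0).
split; first exact: e1.
  exact: evo_diffop dL e1.
exists V; split; first exact: rV.
by split; [exact: sdV|move=> t t0; rewrite E// gV].
Qed.

Lemma evolves_shift u s : 0 <= s -> evolves u -> evolves (fun t => u (s + t)).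
Proof. by move=> s0 eu; exact: (time_derivative_shift s0 eu). Qed.

Lemma evolves_cst c : evolves (fun=> cst c).
Proof.
have := time_derivative_cst (ts_cst (d := d) c).
rewrite /evolves; congr time_derivative; apply/funext => t.
by rewrite -Lop0 (Lop_cst f_smooth sigma_smooth).
Qed.

Variables (rho : fn) (lambda : R).
Hypothesis H1 : invariant_density f sigma rho.
Hypothesis H3 : exponential_decay f sigma rho lambda.

Local Notation mean psi := (torus_int (fun x => psi x * rho x)).

Let ts_rho : torus_smooth rho. Proof. by have [] := H1. Qed.

Let rho_ge0 x : 0 <= rho x. Proof. by have [_ +] := H1; exact. Qed.

Let int_rho : torus_int rho = 1. Proof. by have [] := H1. Qed.

Lemma lambda_gt0 : 0 < lambda. Proof. by have [] := H3. Qed.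

Lemma mean_lin psi phi a : torus_smooth psi -> torus_smooth phi ->
  mean (fun x => psi x + a * phi x) = mean psi + a * mean phi.
Proof.
move=> tp tc; rewrite -(torus_int_lin a (tsM tp ts_rho) (tsM tc ts_rho)).
by congr torus_int; apply/funext => x; ring.
Qed.

Lemma mean_cst c : mean (cst c) = c.
Proof. by rewrite (torus_intZ c ts_rho) int_rho mulr1. Qed.

Lemma mean_bound psi M : torus_smooth psi -> (forall x, `|psi x| <= M) -> `|mean psi| <= M.
Proof.
move=> tp hM; have := torus_int_mul_bound tp ts_rho rho_ge0 hM.
by rewrite int_rho mulr1.
Qed.

Lemma mean_generator psi : torus_smooth psi -> mean (L psi) = 0.
Proof.
move=> tp; have [_ ->//] := diffop_adjointP dL ts_rho.
have [_ _ -> _] := H1; rewrite -[RHS](torus_int0 (d := d)); congr torus_int.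
by apply/funext => x; rewrite mulr0.
Qed.

Lemma decay k : exists2 p : {poly R}, nneg_poly p & forall u M t, evolves u ->
  mean (u 0) = 0 -> 0 <= t -> bd k (u 0) M -> bd k (u t) (p.[t] * expR (- lambda * t) * M).
Proof.
have [_ /(_ k) [p hp]] := H3; have [q nq pq] := nneg_poly_majorant p.
exists q => // u M t eu m0 t0 hM.
have [evu _ _] := eu; have tu0 := evo_ts evu (lexx 0); have tut := evo_ts evu t0.
have M0 := bd_ge0 hM; have q0 := nneg_poly_ge0 nq t0.
have H := hp (u 0) tu0 m0 u (evolves_cauchy eu) t t0.
apply/(Cnorm_le _ _ (ts_smooth tut)); apply: (le_trans H).
have [M' hM' CE] := Cnorm_bd k tu0.
rewrite CE -EFinM lee_fin.
have M'M : M' <= M by rewrite -lee_fin -CE; apply/(Cnorm_le _ _ (ts_smooth tu0)).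
have M'0 := bd_ge0 hM'.
apply: (@le_trans _ _ (q.[t] * expR (- lambda * t) * M')).
  by rewrite ler_wpM2r// ler_wpM2r ?expR_ge0//; exact: pq.
by rewrite ler_wpM2l// mulr_ge0// expR_ge0.
Qed.

(** Uniqueness comes from the decay hypothesis: the difference has zero data, hence zero mean, and
    the bound multiplies the zero norm of the data. *)
Lemma evolves_unique u u' : evolves u -> evolves u' -> u 0 = u' 0 ->
  forall t, 0 <= t -> u t = u' t.
Proof.
move=> eu eu' e0 t t0; have ed := evolves_lin (-1) eu eu'.
have z0 : (fun x => u 0 x + -1 * u' 0 x) = cst 0.
  by apply/funext => x; rewrite e0 mulN1r subrr.
have [p np hp] := decay 0.
have bz : bd 0 (fun x => u 0 x + -1 * u' 0 x) 0.
  by rewrite z0; have := @bd_cst R d 0 0; rewrite normr0.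
have mz : mean (fun x => u 0 x + -1 * u' 0 x) = 0.
  rewrite -[RHS](mean_cst 0); congr torus_int; apply/funext => x.
  by rewrite e0 mulN1r subrr.
apply/funext => x; have := bd0 x (hp _ 0 t ed mz t0 bz).
by rewrite mulr0 normr_le0 mulN1r subr_eq0 => /eqP.
Qed.

(** The increment over h is h times the mean of L u, which vanishes by invariance of rho, up to
    O(h^2). *)
Lemma mean_evolves u t : evolves u -> 0 <= t -> mean (u t) = mean (u 0).
Proof.
move=> eu t0; have [evu evLu _] := eu.
have [g' Lg'] := evo_time_derivative evLu.
have [_ eg' _] := Lg'; have [M hM] := evo_bounded 0 t eg'.
apply: (@quadratic_increment_const _ (fun s => mean (u s)) t M t0) => s h s0 h0 sht.
have sh0 : 0 <= s + h by rewrite addr_ge0.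
have := @time_second_order _ _ 0 u (fun t => L (u t)) g' s h M s0 h0 eu Lg'.
move=> /(_ (fun r sr rsh => hM r (le_trans s0 sr) (le_trans rsh sht))) B.
have tus := evo_ts evu s0; have tush := evo_ts evu sh0; have tL := diffop_ts dL tus.
have -> : mean (u (s + h)) - mean (u s) =
    mean (fun x => u (s + h) x + -1 * (u s x + h * L (u s) x)).
  rewrite (mean_lin _ tush (tsD tus (tsZ h tL))) (mean_lin _ tus tL).
  by rewrite mean_generator// mulr0 addr0 mulN1r.
apply: (mean_bound (tsD tush (tsZ (-1) (tsD tus (tsZ h tL))))) => x.
by have := bd0 x B; rewrite mulN1r.
Qed.

(* v psi 0 solves the homogeneous problem, so P below is the transition semigroup. *)
Variable v : fn -> nat -> R -> fn.
Hypothesis Hv : forall phi, torus_smooth phi -> is_expansion f sigma phi (v phi).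

Local Notation P t psi := (v psi 0 t).

Lemma semigroup_evolves psi : torus_smooth psi -> evolves (v psi 0) /\ P 0 psi = psi.
Proof.
move=> tp; apply: cauchy_evolves; have := Hv tp 0%N.
by congr cauchy_solution; apply/funext => t; apply/funext => x; rewrite big_geq.
Qed.

Lemma ts_semigroup psi t : torus_smooth psi -> 0 <= t -> torus_smooth (P t psi).
Proof. by move=> tp t0; have [[ev _ _] _] := semigroup_evolves tp; exact: evo_ts. Qed.

Lemma semigroup_unique u t : evolves u -> 0 <= t -> u t = P t (u 0).
Proof.
move=> eu t0; have [evu _ _] := eu.
have [ep p0] := semigroup_evolves (evo_ts evu (lexx 0)).
exact: evolves_unique eu ep (esym p0) t t0.
Qed.

Lemma semigroup_add psi s t : torus_smooth psi -> 0 <= s -> 0 <= t ->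
  P (s + t) psi = P t (P s psi).
Proof.
move=> tp s0 t0; have [ep _] := semigroup_evolves tp.
by have := semigroup_unique (evolves_shift s0 ep) t0; rewrite addr0.
Qed.

Lemma semigroup_lin psi phi a t : torus_smooth psi -> torus_smooth phi -> 0 <= t ->
  P t (fun x => psi x + a * phi x) = fun x => P t psi x + a * P t phi x.
Proof.
move=> tp tc t0; have [ep p0] := semigroup_evolves tp; have [ec c0] := semigroup_evolves tc.
have := semigroup_unique (evolves_lin a ep ec) t0.
by rewrite p0 c0.
Qed.

Lemma semigroup_sum n (F : 'I_n -> fn) t : (forall i, torus_smooth (F i)) -> 0 <= t ->
  P t (fun x => \sum_i F i x) = fun x => \sum_i P t (F i) x.
Proof.
move=> tF t0; elim: n F tF => [|n IH] F tF.
  have -> : (fun x => \sum_(i < 0) F i x) = (fun x => cst 0 x + -1 * cst 0 x) :> fn.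
    by apply/funext => x; rewrite big_ord0 mulr0 addr0.
  rewrite (semigroup_lin _ (ts_cst 0) (ts_cst 0) t0).
  by apply/funext => x; rewrite big_ord0 mulN1r subrr.
have -> : (fun x => \sum_(i < n.+1) F i x) =
    (fun x => F ord0 x + 1 * \sum_(i < n) F (lift ord0 i) x).
  by apply/funext => x; rewrite big_ord_recl mul1r.
rewrite (semigroup_lin _ (tF _) (ts_sum _ (fun i _ => tF (lift ord0 i))) t0).
rewrite (IH _ (fun i => tF (lift ord0 i))).
by apply/funext => x; rewrite big_ord_recl mul1r.
Qed.

Lemma mean_semigroup psi t : torus_smooth psi -> 0 <= t -> mean (P t psi) = mean psi.
Proof. by move=> tp t0; have [ep p0] := semigroup_evolves tp; rewrite mean_evolves// p0. Qed.

Lemma semigroup_decay k : exists2 p : {poly R}, nneg_poly p & forall psi M t,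
  torus_smooth psi -> 0 <= t -> bd k psi M ->
  bd k (fun x => P t psi x - mean psi) (p.[t] * expR (- lambda * t) * M).
Proof.
(* The factor 2 pays for subtracting the mean, itself bounded by the norm of psi. *)
have [p np hp] := decay k; exists (2%:P * p).
  by apply: nneg_polyM => //; exact: nneg_polyC.
move=> psi M t tp t0 hM; have [ep p0] := semigroup_evolves tp.
have ed := evolves_lin (-1) ep (evolves_cst (mean psi)).
have tc := ts_cst (d := d) (mean psi).
have m0 : mean (fun x => P 0 psi x + -1 * cst (mean psi) x) = 0.
  by rewrite p0 (mean_lin _ tp tc) mean_cst mulN1r subrr.
have h2 : bd k (fun x => P 0 psi x + -1 * cst (mean psi) x) (M + M).
  rewrite p0.
  have -> : (fun x => psi x + -1 * cst (mean psi) x) = (fun x => psi x - cst (mean psi) x).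
    by apply/funext => x; rewrite mulN1r.
  apply: (bdB (ts_smooth tp) (ts_smooth tc) hM).
  apply: bdW (leqnn k) _ (bd_cst (mean psi)).
  by apply: mean_bound => // x; exact: bd0 hM.
have := hp _ _ t ed m0 t0 h2.
have -> : (fun x => P t psi x + -1 * cst (mean psi) x) = (fun x => P t psi x - mean psi).
  by apply/funext => x; rewrite mulN1r.
by rewrite hornerM hornerC; congr bd; ring.
Qed.

Lemma semigroup_bounded k : exists2 p : {poly R}, nneg_poly p & forall psi M t,
  torus_smooth psi -> 0 <= t -> bd k psi M -> bd k (P t psi) (p.[t] * M).
Proof.
have [p np hp] := semigroup_decay k; exists (p + 1).
  by apply: nneg_polyD => //; exact: nneg_polyC.
move=> psi M t tp t0 hM; have h := hp psi M t tp t0 hM.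
have tP := ts_semigroup tp t0; have tc := ts_cst (d := d) (mean psi).
have -> : P t psi = (fun x => (P t psi x - mean psi) + cst (mean psi) x).
  by apply/funext => x; rewrite subrK.
have hc : bd k (cst (mean psi) : fn) M.
  apply: bdW (leqnn k) _ (bd_cst (mean psi)).
  by apply: mean_bound => // x; exact: bd0 hM.
apply: bdW (leqnn k) _ (bdD (ts_smooth (tsB tP tc)) (ts_smooth tc) h hc).
have M0 := bd_ge0 hM; have p0 := nneg_poly_ge0 np t0.
rewrite hornerD hornerC mulrDl mul1r lerD2r ler_wpM2r//.
by rewrite ler_piMr// expR_le1 mulNr oppr_le0 mulr_ge0// ltW// lambda_gt0.
Qed.

(** The second time derivative is L(L u), of order 4; for h <= 1 the polynomial growth is frozen at
    time 1. *)
Lemma semigroup_small_time k : exists2 C : R, 0 <= C & forall psi M h,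
  torus_smooth psi -> 0 <= h -> h <= 1 -> bd (k + 4) psi M ->
  bd k (fun x => P h psi x - (psi x + h * L psi x)) (C * M * h ^+ 2).
Proof.
have [p np hp] := semigroup_bounded (k + 4)%N.
have [C C0 HC] := diffop_bd k (diffop_comp dL dL).
have p1 := nneg_poly_ge0 np (ler01 : 0 <= 1 :> R).
exists (C * p.[1]) => [|psi M h tp h0 h1 hM]; first exact: mulr_ge0.
have [ep p0] := semigroup_evolves tp.
have eL := time_derivative_diffop dL ep.
have := @time_second_order _ _ k _ _ _ 0 h (C * p.[1] * M) (lexx 0) h0 ep eL.
rewrite add0r p0; apply => s s0 sh.
rewrite -mulrA; apply: HC; first exact: ts_semigroup tp s0.
apply: bdW (leqnn _) _ (hp psi M s tp s0 hM).
have M0 := bd_ge0 hM.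
by rewrite ler_wpM2r// nneg_poly_le// (le_trans sh).
Qed.

Lemma bd_limit k psi A : (forall e, 0 < e -> bd k psi (A + e)) -> bd k psi A.
Proof. by move=> H s x sk; apply/ler_addgt0Pr => e e0; exact: H. Qed.

(** * Duhamel's formula in discretised form *)

Section Duhamel.
Variables (w F : R -> fn).
Hypotheses (evF : evo F) (Dw : time_derivative w (fun t x => L (w t) x + F t x)).
Hypothesis w0 : w 0 = cst 0.

Let evw : evo w. Proof. by have [] := Dw. Qed.

(** What the source adds during the j-th time step, roughly h F(j h); transporting these
    contributions by the semigroup and summing them telescopes to w. *)
Definition duhamel_step h j : fn := fun x => w (j.+1%:R * h) x + -1 * P h (w (j%:R * h)) x.

Lemma ts_duhamel_step h j : 0 <= h -> torus_smooth (duhamel_step h j).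
Proof.
move=> h0; have tw i : torus_smooth (w (i%:R * h)).
  by apply: evo_ts evw _; exact: mulr_ge0.
exact: tsD (tw _) (tsZ _ (ts_semigroup (tw _) h0)).
Qed.

Lemma duhamel_sum h n : 0 <= h ->
  w (n%:R * h) = fun x => \sum_(j < n) P ((n - j.+1)%:R * h) (duhamel_step h j) x.
Proof.
move=> h0; have tr j := ts_duhamel_step j h0; elim: n => [|n IH].
  by rewrite mul0r w0; apply/funext => x; rewrite big_ord0.
have tP j : torus_smooth (P ((n - j.+1)%:R * h) (duhamel_step h j)).
  by apply: (ts_semigroup (tr j)); exact: mulr_ge0.
have E : P h (w (n%:R * h)) = fun x => \sum_(j < n) P ((n.+1 - j.+1)%:R * h) (duhamel_step h j) x.
  rewrite IH (semigroup_sum (fun j => tP j) h0).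
  apply/funext => x; apply: eq_bigr => j _.
  rewrite -(semigroup_add (tr j) _ h0); last exact: mulr_ge0.
  by rewrite subSS -[(n - j)%N](subnSK (ltn_ord j)) -natr1 mulrDl mul1r.
have [_ P0] := semigroup_evolves (tr n).
apply/funext => x; rewrite big_ord_recr /= subnn mul0r P0 -[X in X + _](congr1 (fun g => g x) E).
by rewrite /duhamel_step mulN1r addrC subrK.
Qed.

Lemma duhamel_mean h n : 0 <= h ->
  mean (w (n%:R * h)) = \sum_(j < n) mean (duhamel_step h j).
Proof.
move=> h0; have tr j := ts_duhamel_step j h0.
have tP j : torus_smooth (P ((n - j.+1)%:R * h) (duhamel_step h j)).
  by apply: (ts_semigroup (tr j)); exact: mulr_ge0.
rewrite (duhamel_sum n h0).
transitivity (torus_int (fun x =>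
    \sum_(j < n) P ((n - j.+1)%:R * h) (duhamel_step h j) x * rho x)).
  by congr torus_int; apply/funext => x; rewrite mulr_suml.
rewrite (torus_int_sum _ (fun (j : 'I_n) _ => tsM (tP j) ts_rho)).
by apply: eq_bigr => j _; apply: (mean_semigroup (tr j)); exact: mulr_ge0.
Qed.

(** The terms in L w cancel between w and the semigroup, leaving h F(j h) and a quadratic error. [C]
    depends on w, F and t, which is harmless: its contribution vanishes as h tends to 0. *)
Lemma duhamel_step_bd k t : 0 <= t -> exists2 C, 0 <= C & forall h j B,
  0 <= h -> h <= 1 -> j.+1%:R * h <= t -> bd k (F (j%:R * h)) B ->
  bd k (duhamel_step h j) (h * B + C * h ^+ 2).
Proof.
move=> t0; have [_ evg _] := Dw; have [g' gg'] := evo_time_derivative evg.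
have [_ eg' _] := gg'; have [C1 hC1] := evo_bounded k t eg'.
have [Mw hMw] := evo_bounded (k + 4) t evw.
have [C2 C20 hC2] := semigroup_small_time k.
have C10 : 0 <= C1 := bd_ge0 (hC1 0 (lexx 0) t0).
have Mw0 : 0 <= Mw := bd_ge0 (hMw 0 (lexx 0) t0).
exists (C1 + C2 * Mw) => [|h j B h0 h1 jt hB]; first by rewrite addr_ge0// mulr_ge0.
have s0 : 0 <= j%:R * h by exact: mulr_ge0.
have jE : j.+1%:R * h = j%:R * h + h by rewrite -natr1 mulrDl mul1r.
have st : j%:R * h <= t by apply: le_trans jt; rewrite jE lerDl.
have tw := evo_ts evw s0; have tF := evo_ts evF s0; have tL := diffop_ts dL tw.
have tw1 : torus_smooth (w (j.+1%:R * h)) by apply: evo_ts evw _; exact: mulr_ge0.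
have tP := ts_semigroup tw h0.
have b1 := @time_second_order _ _ k w _ g' _ h C1 s0 h0 Dw gg'
  (fun r sr rsh => hC1 r (le_trans s0 sr) (le_trans rsh (eq_ind _ (fun z => z <= t) jt _ jE))).
have b2 := hC2 _ Mw h tw h0 h1 (hMw _ s0 st).
rewrite -jE in b1.
have tG := tsD tL tF.
have t1 := tsB tw1 (tsD tw (tsZ h tG)).
have t2 := tsB tP (tsD tw (tsZ h tL)).
have -> : duhamel_step h j = fun x =>
    (w (j.+1%:R * h) x - (w (j%:R * h) x + h * (L (w (j%:R * h)) x + F (j%:R * h) x)) -
     (P h (w (j%:R * h)) x - (w (j%:R * h) x + h * L (w (j%:R * h)) x))) +
    h * F (j%:R * h) x.
  by apply/funext => x; rewrite /duhamel_step; ring.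
have b3 := bdB (ts_smooth t1) (ts_smooth t2) b1 b2.
have b4 := bdZ h (ts_smooth tF) hB.
apply: bdW (leqnn k) _ (bdD (ts_smooth (tsB t1 t2)) (ts_smooth (tsZ h tF)) b3 b4).
by rewrite ger0_norm// le_eqVlt; apply/orP; left; apply/eqP; ring.
Qed.

End Duhamel.

(** Discrete form of the bound of \int_0^t p(t-s) e^(-lambda (t-s)) q(s) e^(-lambda s) ds by t p(t)
    q(t) e^(-lambda t). The discrete times add up to t - h rather than t, and with h <= 1 this costs
    the factor [expR lambda]. *)
Lemma duhamel_decay k : exists2 p : {poly R}, nneg_poly p & forall w F (q : {poly R}) M,
  nneg_poly q -> evo F -> time_derivative w (fun t x => L (w t) x + F t x) ->
  w 0 = cst 0 -> 0 <= M ->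
  (forall s, 0 <= s -> bd k (F s) (q.[s] * expR (- lambda * s) * M)) ->
  forall t, 0 <= t ->
    bd k (fun x => w t x - mean (w t)) ((p * q).[t] * expR (- lambda * t) * M).
Proof.
have [p np hp] := semigroup_decay k.
exists ((expR lambda)%:P * 'X * p).
  apply: nneg_polyM => //; apply: nneg_polyM; last exact: nneg_polyX.
  by apply: nneg_polyC; exact: expR_ge0.
move=> w F q M nq eF Dw w0 M0 hF t t0; apply: bd_limit => e e0.
have [C C0 hC] := duhamel_step_bd eF Dw k t0.
have pt := nneg_poly_ge0 np t0; have qt := nneg_poly_ge0 nq t0.
pose B := p.[t] * C * t ^+ 2.
have B0 : 0 <= B by rewrite mulr_ge0 ?exprn_ge0// mulr_ge0.
(* Large enough for h <= 1 and for the total quadratic error B / n to be at most e. *)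
pose n := (Num.bound (t + B / e)).+1.
have nlt : t + B / e <= n%:R.
  apply: ltW; apply: lt_le_trans (archi_boundP _) _; last by rewrite ler_nat.
  by rewrite addr_ge0// divr_ge0// ltW.
have n0 : 0 < n%:R :> R by rewrite ltr0n.
pose h := t / n%:R.
have h0 : 0 <= h by rewrite divr_ge0.
have h1 : h <= 1.
  rewrite ler_pdivrMr// mul1r (le_trans _ nlt)// lerDl divr_ge0// ltW//.
have nh : n%:R * h = t by rewrite /h mulrCA divff ?mulr1// gt_eqF.
have tr j := ts_duhamel_step Dw j h0.
have E1 : (fun x => w t x - mean (w t)) = fun x => \sum_(j < n)
    (P ((n - j.+1)%:R * h) (duhamel_step w h j) x - mean (duhamel_step w h j)).
  apply/funext => x; rewrite sumrB -(duhamel_mean Dw w0 n h0) nh; congr (_ - _).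
  by rewrite -{1}nh (duhamel_sum Dw w0 n h0).
rewrite E1.
pose b (j : 'I_n) : R := h * (p.[t] * q.[t] * expR lambda * expR (- lambda * t) * M) +
  p.[t] * C * h ^+ 2.
apply: (@bdW _ _ k k _ (\sum_j b j)) => //; last first.
  apply: bd_sum => j _.
    apply: (tsB (ts_semigroup (tr j) _) (ts_cst _)); exact: mulr_ge0.
  have jn := ltn_ord j.
  have s0 : 0 <= j%:R * h by exact: mulr_ge0.
  have r0 : 0 <= (n - j.+1)%:R * h by exact: mulr_ge0.
  have rt : (n - j.+1)%:R * h <= t.
    by rewrite -nh ler_wpM2r// ler_nat leq_subr.
  have st1 : j.+1%:R * h <= t by rewrite -nh ler_wpM2r// ler_nat.
  have st : j%:R * h <= t.
    by apply: le_trans st1; rewrite ler_wpM2r// ler_nat.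
  have qs0 := nneg_poly_ge0 nq s0; have pr0 := nneg_poly_ge0 np r0.
  have := hp _ _ _ (tr j) r0 (hC h j _ h0 h1 st1 (hF _ s0)).
  apply: bdW => //.
  have pr : p.[(n - j.+1)%:R * h] <= p.[t] := nneg_poly_le np r0 rt.
  have qs : q.[j%:R * h] <= q.[t] := nneg_poly_le nq s0 st.
  have er1 : expR (- lambda * ((n - j.+1)%:R * h)) <= 1.
    by rewrite expR_le1 mulNr oppr_le0 mulr_ge0// ltW// lambda_gt0.
  have ee : expR (- lambda * ((n - j.+1)%:R * h)) * expR (- lambda * (j%:R * h)) <=
      expR lambda * expR (- lambda * t).
    rewrite -!expRD ler_expR -nh natrB//.
    have l0 := lambda_gt0; rewrite -natr1.
    have -> : - lambda * ((n%:R - (j%:R + 1)) * h) + - lambda * (j%:R * h) =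
      lambda * h + - lambda * (n%:R * h) by ring.
    by rewrite lerD2r ler_piMr// ltW.
  rewrite /b mulrDr; apply: lerD.
    have -> : p.[(n - j.+1)%:R * h] * expR (- lambda * ((n - j.+1)%:R * h)) *
        (h * (q.[j%:R * h] * expR (- lambda * (j%:R * h)) * M)) =
      h * (p.[(n - j.+1)%:R * h] * q.[j%:R * h] *
        (expR (- lambda * ((n - j.+1)%:R * h)) * expR (- lambda * (j%:R * h))) * M) by ring.
    have -> : p.[t] * q.[t] * expR lambda * expR (- lambda * t) * M =
      p.[t] * q.[t] * (expR lambda * expR (- lambda * t)) * M by ring.
    rewrite ler_wpM2l// ler_wpM2r//; apply: ler_pM => //; rewrite ?mulr_ge0 ?expR_ge0//.
    exact: ler_pM.
  rewrite mulrA ler_wpM2r ?exprn_ge0// ler_wpM2r//.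
  by rewrite -[leRHS]mulr1; apply: ler_pM => //; exact: expR_ge0.
rewrite sumr_const card_ord -[X in X <= _]mulr_natl mulrDr mulrA nh.
rewrite hornerM hornerM hornerM hornerC hornerX.
apply: lerD; first by rewrite le_eqVlt; apply/orP; left; apply/eqP; ring.
have -> : n%:R * (p.[t] * C * h ^+ 2) = B / n%:R.
  by rewrite /B /h; field; rewrite gt_eqF.
rewrite ler_pdivrMr// mulrC -ler_pdivrMr//; apply: le_trans nlt.
by rewrite lerDr.
Qed.

Local Notation Lc := (conv (Lop f sigma)).

Definition source phi n t : fn := fun x => \sum_(1 <= l < n.+1) Lop f sigma l (v phi (n - l)%N t) x.

Lemma expansion_source phi n : torus_smooth phi -> evo (source phi n) /\
  time_derivative (v phi n) (fun t x => L (v phi n t) x + source phi n t x) /\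
  v phi n 0 = if n is 0 then phi else cst 0.
Proof.
move=> tphi; elim/ltn_ind: n => n IH.
have eF : evo (source phi n).
  rewrite /source; under eq_fun => t do under eq_fun => x do rewrite big_nat.
  apply: evo_sum => l /andP[l0 ln].
  apply: (evo_diffop (Lop_diffop f_smooth sigma_smooth l)).
  have nl : (n - l < n)%N by lia.
  by have [_ [[]]] := IH _ nl.
split; first exact: eF.
exact: cauchy_time_derivative eF (Hv tphi n).
Qed.

Lemma expansion_evo phi n : torus_smooth phi -> evo (v phi n).
Proof. by move=> tphi; have [_ [[]]] := expansion_source n tphi. Qed.

Lemma ts_expansion phi n t : torus_smooth phi -> 0 <= t -> torus_smooth (v phi n t).
Proof. by move=> tphi t0; apply: (evo_ts _ t0); exact: expansion_evo. Qed.

(** As formal series the equations read tau d/dt v = (\sum_k tau^(k+1) L_k) v, so generator and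
    source together form the coefficient of degree n+1. *)
Lemma source_conv phi n t x :
  L (v phi n t) x + source phi n t x = Lc (fun k => v phi k t) n.+1 x.
Proof.
rewrite convE big_ord_recl subSS subn0; congr (_ + _).
by rewrite /source big_add1 /= big_mkord; apply: eq_bigr => l _; rewrite subSS.
Qed.

Lemma expansion_time_derivative phi n : torus_smooth phi ->
  time_derivative (v phi n) (fun t => Lc (fun k => v phi k t) n.+1).
Proof.
move=> tphi; have [_ [+ _]] := expansion_source n tphi; congr time_derivative.
by apply/funext => t; apply/funext => x; rewrite source_conv.
Qed.

(** Each time derivative adds one factor of the formal operator and raises the degree by one, which
    is what turns the time Taylor series of the v_n into the exponential series. *)
Lemma iter_conv_time_derivative phi j n : torus_smooth phi ->
  time_derivative (fun t => iter j Lc (fun k => v phi k t) n)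
    (fun t => iter j.+1 Lc (fun k => v phi k t) n.+1).
Proof.
move=> tphi; elim: j n => [|j IH] n; first exact: expansion_time_derivative.
have lin_td (r : seq 'I_n) (u g : 'I_n -> R -> fn) :
    (forall i, time_derivative (u i) (g i)) ->
    time_derivative (fun t x => \sum_(i <- r) u i t x) (fun t x => \sum_(i <- r) g i t x).
  move=> H; elim: r => [|i r IHr].
    have := time_derivative_cst (ts_cst (d := d) (0 : R)).
    by congr time_derivative; apply/funext => t; apply/funext => x; rewrite big_nil.
  have := time_derivative_lin 1 (H i) IHr.
  by congr time_derivative; apply/funext => t; apply/funext => x; rewrite big_cons mul1r.
have := lin_td (index_enum _) _ _ (fun i : 'I_n =>
  time_derivative_diffop (Lop_diffop f_smooth sigma_smooth i) (IH (n - i.+1)%N)).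
congr time_derivative; apply/funext => t; apply/funext => x.
rewrite -[RHS]/(Lc (iter j.+1 Lc (fun k => v phi k t)) n.+1 x) convE big_ord_recr /= subnn.
(* The new top term of the sum carries coefficient 0 of a series with at least one factor, which
   vanishes. *)
have -> : Lc (iter j Lc (fun k => v phi k t)) 0 = cst 0.
  by apply/funext => y; rewrite convE big_ord0.
rewrite (diffop0 (Lop_diffop f_smooth sigma_smooth n)) addr0.
apply: eq_bigr => i _.
by rewrite subSS -[(n - i)%N](subnSK (ltn_ord i)).
Qed.

(** * Duality between the v_n and the mu_n *)

Variable mu : nat -> fn.
Hypothesis Hmu : is_measure_expansion f sigma rho mu.

Lemma ts_mu n : torus_smooth (mu n).
Proof.
have [mu0 mun] := Hmu; case: n => [|n]; first by rewrite mu0.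
by have [] := mun n.+1 isT.
Qed.

(** The equations defining the mu_n brought to one side; for n = 0 this is the invariance of rho. *)
Lemma adjoint_mu n x :
  \sum_(l < n.+1) adjoint (Lop f sigma (n - l)) (mu l) x = 0.
Proof.
have [mu0 mun] := Hmu; case: n => [|n].
  rewrite big_ord_recl big_ord0 addr0 subnn mu0 Lop0.
  by have [_ _ -> _] := H1.
rewrite big_ord_recr /= subnn Lop0; have [_ -> _] := mun n.+1 isT.
apply/eqP; rewrite subr_eq0; apply/eqP.
rewrite big_add1 /= big_mkord (reindex_inj rev_ord_inj) /=.
apply: eq_bigr => l _.
have ln : (l < n.+1)%N := ltn_ord l.
by have -> : (n.+1 - (n.+1 - l.+1) = l.+1)%N by lia.
Qed.

(* The linear functional phi |-> \int phi mu_n is recovered from the conserved quantity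
   \sum_l \int v_(n - l)(t) mu_l, since v_k(t) becomes constant as t grows. *)
Definition conserved phi n t : R :=
  \sum_(l < n.+1) torus_int (fun x => v phi (n - l)%N t x * mu l x).

(** Passing every L_k to the adjoint and grouping by the index of u, the factor against each u_i is
    one of the vanishing sums of [adjoint_mu]. *)
Lemma int_conv_mu (u : nat -> fn) n : ts_seq u ->
  \sum_(l < n.+1) torus_int (fun x => Lc u (n - l).+1 x * mu l x) = 0.
Proof.
move=> tu; pose F (l k : nat) : R := if (l + k <= n)%N then
  torus_int (fun x => Lop f sigma k (u (n - l - k)%N) x * mu l x) else 0.
have tL k i : torus_smooth (Lop f sigma k (u i)).
  exact: diffop_ts (Lop_diffop f_smooth sigma_smooth k) (tu i).
have tA k l : torus_smooth (adjoint (Lop f sigma k) (mu l)).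
  by have [] := diffop_adjointP (Lop_diffop f_smooth sigma_smooth k) (ts_mu l).
transitivity (\sum_(l < n.+1) \sum_(k < n.+1) F l k).
  apply: eq_bigr => l _; have ln : (l <= n)%N by rewrite -ltnS.
  transitivity (torus_int (fun x => \sum_(k < (n - l).+1)
      Lop f sigma k (u (n - l - k)%N) x * mu l x)).
    congr torus_int; apply/funext => x; rewrite convE mulr_suml.
    by apply: eq_bigr => k _; rewrite subSS.
  rewrite (torus_int_sum _ (fun (k : 'I_(n - l).+1) _ => tsM (tL k _) (ts_mu l))).
  have sub : ((n - l).+1 <= n.+1)%N by rewrite ltnS leq_subr.
  rewrite (big_ord_widen_cond n.+1 xpredT (fun k =>
    torus_int (fun x => Lop f sigma k (u (n - l - k)%N) x * mu l x)) sub) big_mkcond /=.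
  by apply: eq_bigr => k _; rewrite /F ltnS leq_subRL.
rewrite sum_triangle => [|l k h]; last by rewrite /F leqNgt h.
rewrite big1// => j _; have jn : (j <= n)%N by rewrite -ltnS.
transitivity (\sum_(l < j.+1) torus_int (fun x => u (n - j)%N x *
    adjoint (Lop f sigma (j - l)) (mu l) x)).
  apply: eq_bigr => l _; have lj : (l <= j)%N by rewrite -ltnS.
  rewrite /F subnKC// jn -subnDA subnKC//.
  have [_ H] := diffop_adjointP (Lop_diffop f_smooth sigma_smooth (j - l)) (ts_mu l).
  exact: H.
rewrite -(torus_int_sum _ (fun (l : 'I_j.+1) _ => tsM (tu _) (tA (j - l)%N l))).
rewrite -[RHS](torus_int0 (d := d)); congr torus_int; apply/funext => x.
by rewrite -mulr_sumr adjoint_mu mulr0.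
Qed.

(** At t = 0 only v_0 = phi against mu_n survives, and the first-order increment vanishes by
    [int_conv_mu]. *)
Lemma conserved_const phi n t : torus_smooth phi -> 0 <= t ->
  conserved phi n t = torus_int (fun x => phi x * mu n x).
Proof.
move=> tphi t0.
have -> : torus_int (fun x => phi x * mu n x) = conserved phi n 0.
  rewrite /conserved big_ord_recr /= subnn.
  have [_ [_ ->]] := expansion_source 0 tphi; rewrite big1 ?add0r// => l _.
  have [_ [_ ->]] := expansion_source (n - l) tphi.
  have -> : (n - l = (n - l.+1).+1)%N by rewrite subnSK.
  by rewrite -[RHS](torus_int0 (d := d)); congr torus_int; apply/funext => x; rewrite mul0r.
pose G i s := Lc (fun k => v phi k s) i.+1.
have Dv i := expansion_time_derivative i tphi.
pose stmt (l : 'I_n.+1) (C : R) := forall s h : R, 0 <= s -> 0 <= h -> s + h <= t ->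
  `|torus_int (fun x => (v phi (n - l) (s + h) x +
      -1 * (v phi (n - l) s x + h * G (n - l)%N s x)) * mu l x)| <= C * h ^+ 2.
have [C HC] : {C : 'I_n.+1 -> R & forall l, stmt l (C l)}.
  apply: (@choice _ _ stmt) => l.
  have [ev eG _] := Dv (n - l)%N; have [g' Gg'] := evo_time_derivative eG.
  have [_ eg' _] := Gg'; have [M hM] := evo_bounded 0 t eg'.
  have [Mm hMm] := ts_bd 0 (ts_mu l).
  exists (M * Mm) => s h s0 h0 sht.
  have sh0 : 0 <= s + h by rewrite addr_ge0.
  have B := @time_second_order _ _ 0 _ _ g' s h M s0 h0 (Dv (n - l)%N) Gg'
     (fun r sr rsh => hM r (le_trans s0 sr) (le_trans rsh sht)).
  have tD := tsD (evo_ts ev s0) (tsZ h (evo_ts eG s0)).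
  have tdiff := tsD (evo_ts ev sh0) (tsZ (-1) tD).
  apply: (torus_int_bound (tsM tdiff (ts_mu l))) => x; rewrite normrM mulrAC.
  apply: ler_pM => //; last exact: bd0 x hMm.
  by have := bd0 x B; rewrite mulN1r.
apply: (@quadratic_increment_const _ (conserved phi n) t (\sum_l C l) t0) => s h s0 h0 sht.
have sh0 : 0 <= s + h by rewrite addr_ge0.
have tv i r : 0 <= r -> torus_smooth (v phi i r) by move=> r0; exact: ts_expansion.
have tG i : torus_smooth (G i s) by have [_ eG _] := Dv i; exact: evo_ts eG s0.
have -> : conserved phi n (s + h) - conserved phi n s =
   \sum_(l < n.+1) torus_int (fun x => (v phi (n - l) (s + h) x + -1 * (v phi (n - l) s x + h * G (n - l)%N s x)) * mu l x).
  transitivity (conserved phi n (s + h) - conserved phi n s - h *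
      \sum_(l < n.+1) torus_int (fun x => G (n - l)%N s x * mu l x)).
    by rewrite (int_conv_mu n (fun i => ts_expansion i tphi s0)) mulr0 subr0.
  rewrite mulr_sumr /conserved -!sumrB; apply: eq_bigr => l _.
  have t1 := tsM (tv (n - l)%N _ sh0) (ts_mu l); have t2 := tsM (tv (n - l)%N _ s0) (ts_mu l).
  have t3 := tsM (tG (n - l)%N) (ts_mu l).
  rewrite -(torus_intZ h t3) -(torus_intB t1 t2) -(torus_intB (tsB t1 t2) (tsZ h t3)).
  by congr torus_int; apply/funext => x; ring.
apply: le_trans (ler_norm_sum _ _ _) _; rewrite mulr_suml; apply: ler_sum => l _.
exact: HC.
Qed.

(** Induction on n. Duhamel's formula yields the decay of v_(n+1) to its mean against rho, and the
    conserved quantity the decay of that mean to its limit. Derivatives: L_(l+1) v_(n-l) needs 2l +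
    4 + 4(n - l) <= 4(n + 1) of them. *)
Lemma expansion_decay n k : exists2 q : {poly R}, nneg_poly q & forall phi M t,
  torus_smooth phi -> bd (k + 4 * n) phi M -> 0 <= t ->
  bd k (fun x => v phi n t x - torus_int (fun y => phi y * mu n y))
    (q.[t] * expR (- lambda * t) * M).
Proof.
have [mu0 mun] := Hmu.
elim/ltn_ind: n k => -[|n] IH k.
  have [p np hp] := semigroup_decay k; exists p => // phi M t tphi.
  by rewrite muln0 addn0 mu0 => hM t0; exact: hp.
pose c phi i := torus_int (fun y => phi y * mu i y).
(* L_l kills constants, so v may be replaced by its distance to its limit. *)
pose stmt_source (l : 'I_n.+1) (q : {poly R}) := nneg_poly q /\
  forall phi M t, torus_smooth phi -> bd (k + 4 * n.+1) phi M -> 0 <= t ->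
    bd k (Lop f sigma l.+1 (v phi (n - l) t)) (q.[t] * expR (- lambda * t) * M).
have [qs Hqs] : {q : 'I_n.+1 -> {poly R} & forall l, stmt_source l (q l)}.
  apply: (@choice _ _ stmt_source) => l.
  have dl := Lop_diffop f_smooth sigma_smooth l.+1.
  have [C C0 hC] := diffop_bd k dl.
  have nl : (n - l < n.+1)%N by rewrite ltnS leq_subr.
  have [q nq hq] := IH _ nl (k + (2 * l.+1).+2)%N.
  exists (C%:P * q); split => [|phi M t tphi hM t0].
    by apply: nneg_polyM => //; exact: nneg_polyC.
  have tv := ts_expansion (n - l) tphi t0.
  have -> : Lop f sigma l.+1 (v phi (n - l) t) =
      Lop f sigma l.+1 (fun x => v phi (n - l) t x - c phi (n - l)%N).
    have := diffop_lin (-1) dl tv (ts_cst (c phi (n - l)%N)).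
    rewrite (Lop_cst f_smooth sigma_smooth).
    have -> : (fun x => v phi (n - l) t x + -1 * cst (c phi (n - l)%N) x) =
      (fun x => v phi (n - l) t x - c phi (n - l)%N).
      by apply/funext => x; rewrite mulN1r.
    by move=> ->; apply/funext => x; rewrite mulr0 addr0.
  rewrite hornerM hornerC -!mulrA; apply: hC; first exact: (tsB tv (ts_cst _)).
  rewrite mulrA; apply: hq => //.
  by apply: bdW (lexx M) hM; have := ltn_ord l; lia.
pose q := \sum_l qs l.
have nq : nneg_poly q by apply: nneg_poly_sum => l; have [] := Hqs l.
have hF phi M t : torus_smooth phi -> bd (k + 4 * n.+1) phi M -> 0 <= t ->
    bd k (source phi n.+1 t) (q.[t] * expR (- lambda * t) * M).
  move=> tphi hM t0; rewrite /source.
  have -> : (fun x => \sum_(1 <= l < n.+2) Lop f sigma l (v phi (n.+1 - l) t) x) =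
    (fun x => \sum_(l < n.+1) Lop f sigma l.+1 (v phi (n - l) t) x).
    apply/funext => x; rewrite big_add1 /= big_mkord.
    by apply: eq_bigr => l _; rewrite subSS.
  rewrite /q horner_sum !mulr_suml; apply: bd_sum => l _.
    exact: diffop_ts (Lop_diffop f_smooth sigma_smooth l.+1) (ts_expansion _ tphi t0).
  by have [_] := Hqs l; apply.
have [p np hp] := duhamel_decay k.
pose stmt_mean (l : 'I_n.+1) (q : {poly R}) := nneg_poly q /\
  forall phi M t, torus_smooth phi -> bd (k + 4 * n.+1) phi M -> 0 <= t ->
    `|torus_int (fun x => v phi (n - l) t x * mu l.+1 x)| <= q.[t] * expR (- lambda * t) * M.
have [rs Hrs] : {r : 'I_n.+1 -> {poly R} & forall l, stmt_mean l (r l)}.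
  apply: (@choice _ _ stmt_mean) => l.
  have [Mm hMm] := ts_bd 0 (ts_mu l.+1); have Mm0 := bd_ge0 hMm.
  have nl : (n - l < n.+1)%N by rewrite ltnS leq_subr.
  have [r nr hr] := IH _ nl 0%N.
  exists (Mm%:P * r); split => [|phi M t tphi hM t0].
    by apply: nneg_polyM => //; exact: nneg_polyC.
  have tv := ts_expansion (n - l) tphi t0; have tm := ts_mu l.+1.
  have tc := ts_cst (d := d) (c phi (n - l)%N).
  (* mu_(l+1) has zero integral, so the limit of v_(n-l) may be subtracted at no cost. *)
  have -> : torus_int (fun x => v phi (n - l) t x * mu l.+1 x) =
      torus_int (fun x => (v phi (n - l) t x - c phi (n - l)%N) * mu l.+1 x).
    transitivity (torus_int (fun x => v phi (n - l) t x * mu l.+1 x) -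
        torus_int (fun x => c phi (n - l)%N * mu l.+1 x)).
      by rewrite (torus_intZ _ tm); have [_ _ ->] := mun l.+1 isT; rewrite mulr0 subr0.
    rewrite -(torus_intB (tsM tv tm) (tsZ _ tm)).
    by congr torus_int; apply/funext => x; rewrite mulrBl.
  apply: (torus_int_bound (tsM (tsB tv tc) tm)) => x.
  have hb : bd (0 + 4 * (n - l)) phi M by apply: bdW (lexx M) hM; lia.
  rewrite normrM hornerM hornerC.
  rewrite [leRHS](_ : _ = r.[t] * expR (- lambda * t) * M * Mm); last by ring.
  by apply: ler_pM => //; [exact: bd0 x (hr phi M t tphi hb t0)|exact: bd0 x hMm].
pose r := \sum_l rs l.
have nr : nneg_poly r by apply: nneg_poly_sum => l; have [] := Hrs l.
exists (p * q + r) => [|phi M t tphi hM t0].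
  by apply: nneg_polyD => //; exact: nneg_polyM.
have [eF [Dv v0]] := expansion_source n.+1 tphi.
have b1 := hp _ _ q M nq eF Dv v0 (bd_ge0 hM) (fun s s0 => hF phi M s tphi hM s0) t t0.
have tv := ts_expansion n.+1 tphi t0.
have -> : (fun x => v phi n.+1 t x - c phi n.+1) =
    (fun x => (v phi n.+1 t x - mean (v phi n.+1 t)) + cst (mean (v phi n.+1 t) - c phi n.+1) x).
  by apply/funext => x; rewrite addrA subrK.
have b2 : `|mean (v phi n.+1 t) - c phi n.+1| <= r.[t] * expR (- lambda * t) * M.
  (* In the conserved quantity the term with mu_0 = rho is the mean; all others involve earlier v_i
     against mu_(l+1) and decay. *)
  rewrite /c -(conserved_const n.+1 tphi t0) /conserved big_ord_recl subn0 mu0 opprD addrA.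
  rewrite subrr add0r normrN; apply: le_trans (ler_norm_sum _ _ _) _.
  rewrite /r horner_sum !mulr_suml; apply: ler_sum => l _.
  by have [_ H] := Hrs l; exact: (H phi M t tphi hM t0).
have b3 := @bd_cst R d k (mean (v phi n.+1 t) - c phi n.+1).
have tc1 := ts_cst (d := d) (mean (v phi n.+1 t)).
have tc2 := ts_cst (d := d) (mean (v phi n.+1 t) - c phi n.+1).
rewrite hornerD mulrDl mulrDl.
exact: (bdD (ts_smooth (tsB tv tc1)) (ts_smooth tc2) b1 (bdW (leqnn k) b2 b3)).
Qed.

End Semigroup.

(** * Gaussian moments *)

Section GaussianMoments.
Context {R : realType}.
Variable s : R.
Hypothesis s0 : 0 < s.
Local Notation mu := lebesgue_measure.
Local Notation p := (normal_pdf 0 s).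
Local Open Scope ereal_scope.

Lemma gauss_pdfE x : (p x = normal_peak s * expR (- (x ^+ 2 / (s ^+ 2 *+ 2))))%R.
Proof. by rewrite normal_pdfE ?gt_eqF// /normal_fun subr0 mulNr. Qed.

Lemma gauss_pdf_sym x : (p (- x) = p x)%R.
Proof. by rewrite !gauss_pdfE sqrrN. Qed.

Lemma is_derive_gauss_pdf (x : R) : is_derive x 1%R p (- (x / s ^+ 2) * p x)%R.
Proof.
pose e (y : R) : R := (- (s ^+ 2 *+ 2)^-1 * (y ^+ 2))%R.
have E : p = (normal_peak s \*: (expR \o e))%R.
  apply/funext => y; rewrite gauss_pdfE /= /e.
  by congr (_ * expR _)%R; rewrite mulNr mulrC.
have ex : expR (e x) = (p x / normal_peak s)%R.
  rewrite E /= /GRing.scale /= mulrC mulKf//.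
  by rewrite gt_eqF// normal_peak_gt0// gt_eqF.
have D1 : is_derive x 1%R e (- (x / s ^+ 2))%R.
  have -> : e = ((- (s ^+ 2 *+ 2)^-1)%R \*: (fun x : R => x ^+ 2)%R) by [].
  apply: is_derive_eq; rewrite /GRing.scale /= !mulr1.
  by field; rewrite gt_eqF.
have D2 : is_derive (e x) 1%R expR (expR (e x)).
  exact: is_derive_expR.
rewrite [X in is_derive _ _ X _]E.
apply: is_derive_eq (is_deriveZ (normal_peak s) (is_derive1_comp D2 D1)) _.
rewrite ex /GRing.scale /=; field.
by rewrite !gt_eqF// normal_peak_gt0// gt_eqF.
Qed.

Lemma pow_le_expR k (x : R) : (0 <= x -> x ^+ k <= k`!%:R * expR x)%R.
Proof.
move=> x0; case: k => [|k].
  rewrite expr0 fact0 mul1r; apply: le_trans (expR_ge1Dx x).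
  by rewrite lerDl.
have := expR_ge1Dxn k x0; rewrite -ler_pdivrMl ?ltr0n ?fact_gt0// mulrC.
by apply: le_trans; rewrite lerDr.
Qed.

(** From x^k <= k! e^x and, completing the square, 2x - x^2 / (2 s^2) <= 2 s^2; what remains is a
    multiple of e^(-x), whose integral is explicit. *)
Definition gauss_cst k : R := (k`!%:R * normal_peak s * expR (2 * s ^+ 2))%R.

Lemma gauss_cst_ge0 k : (0 <= gauss_cst k)%R.
Proof. by rewrite /gauss_cst !mulr_ge0// ?expR_ge0// normal_peak_ge0. Qed.

Lemma gauss_pow_bound k x : (0 <= x -> x ^+ k * p x <= gauss_cst k * expR (- x))%R.
Proof.
move=> x0; rewrite gauss_pdfE.
apply: (@le_trans _ _ (k`!%:R * expR x * (normal_peak s * expR (- (x ^+ 2 / (s ^+ 2 *+ 2)))))%R).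
  by rewrite ler_wpM2r ?pow_le_expR// mulr_ge0 ?expR_ge0// normal_peak_ge0.
rewrite /gauss_cst.
have -> : (k`!%:R * expR x * (normal_peak s * expR (- (x ^+ 2 / (s ^+ 2 *+ 2)))) =
  k`!%:R * normal_peak s * expR (x - x ^+ 2 / (s ^+ 2 *+ 2)))%R.
  by rewrite expRD; ring.
rewrite -mulrA -[leRHS]mulrA -[leRHS]mulrA -expRD.
rewrite !ler_wpM2l ?normal_peak_ge0// ler_expR -subr_ge0.
have -> : (2 * s ^+ 2 - x - (x - x ^+ 2 / (s ^+ 2 *+ 2)) = (x - 2 * s ^+ 2) ^+ 2 / (s ^+ 2 *+ 2))%R.
  by field; rewrite gt_eqF.
by rewrite divr_ge0 ?sqr_ge0// mulrn_wge0// sqr_ge0.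
Qed.

Lemma gauss_pow_cvg0 k : (x ^+ k * p x)%R @[x --> +oo%R] --> (0%R : R).
Proof.
apply: (@squeeze_cvgr _ _ _ _ (fun=> 0%R) (fun x => gauss_cst k * expR (- x))%R).
- near=> x; have x0 : (0 <= x)%R by near: x; exact: nbhs_pinfty_ge.
  by rewrite gauss_pow_bound// mulr_ge0 ?exprn_ge0// normal_pdf_ge0.
- exact: cvg_cst.
- rewrite -[X in _ --> X](mulr0 (gauss_cst k)); apply: cvgMr; exact: cvgr_expR.
Unshelve. all: by end_near. Qed.

Definition half_moment k : \bar R := \int[mu]_(x in `[0%R, +oo[) (x ^+ k * p x)%:E.

Lemma continuous_gauss_pow k : continuous (fun x : R => x ^+ k * p x)%R.
Proof.
move=> x; apply: cvgM; first exact: exprn_continuous.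
by apply: continuous_normal_pdf; rewrite gt_eqF.
Qed.

Lemma measurable_gauss_pow k (D : set R) : measurable D ->
  measurable_fun D (fun x : R => (x ^+ k * p x)%:E).
Proof.
move=> mD; apply/measurable_EFinP; apply: measurable_funTS.
by apply: continuous_measurable_fun; exact: continuous_gauss_pow.
Qed.

Lemma gauss_pow_ge0 k x : (0 <= x -> 0 <= x ^+ k * p x)%R.
Proof. by move=> x0; rewrite mulr_ge0 ?exprn_ge0// normal_pdf_ge0. Qed.

Lemma is_derive_expRN (K x : R) :
  is_derive x 1%R (fun y : R => K * expR (- y))%R (- K * expR (- x))%R.
Proof.
have D2 : is_derive (- x)%R 1%R expR (expR (- x))%R by exact: is_derive_expR.
have D1 : is_derive x 1%R (fun y : R => - y)%R (-1)%R by exact: is_deriveNid.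
apply: is_derive_eq (is_deriveZ K (is_derive1_comp D2 D1)) _.
rewrite /GRing.scale /=; ring.
Qed.

Lemma is_derive_continuous (F G : R -> R) :
  (forall x : R, is_derive x 1%R F (G x)) -> continuous F.
Proof.
move=> DF x; apply: differentiable_continuous; apply/derivable1_diffP.
by have [] := DF x.
Qed.

Lemma integral_expRN (K : R) : (0 <= K)%R ->
  \int[mu]_(x in `[0%R, +oo[) (K * expR (- x))%:E = K%:E.
Proof.
move=> K0; pose F (x : R) : R := (- K * expR (- x))%R.
have DF (x : R) : is_derive x 1%R F (K * expR (- x))%R.
  by have := is_derive_expRN (- K)%R x; rewrite opprK.
have cF : continuous F.
  exact: is_derive_continuous DF.
rewrite (@ge0_continuous_FTC2y _ (fun x => K * expR (- x))%R F 0%R 0%R).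
- by rewrite /F oppr0 expR0 mulr1 -EFinB opprK add0r.
- by move=> x _; rewrite mulr_ge0// expR_ge0.
- by apply: continuous_subspaceT; exact: is_derive_continuous (is_derive_expRN K).
- rewrite -[X in _ --> X](mulr0 (- K)%R); apply: cvgMr; exact: cvgr_expR.
- by move=> x _; exact: ex_derive.
- exact/cvg_at_right_filter/cF.
- by move=> x _; rewrite derive1E; have [_ ->] := DF x.
Qed.

Lemma half_moment_fin k : half_moment k \is a fin_num.
Proof.
rewrite ge0_fin_numE; last first.
  by apply: integral_ge0 => x /=; rewrite in_itv/= andbT => x0; rewrite lee_fin gauss_pow_ge0.
apply: (@le_lt_trans _ _ (gauss_cst k)%:E); last by rewrite ltry.
rewrite -(integral_expRN (gauss_cst_ge0 k)); apply: ge0_le_integral => //=.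
- by move=> x /=; rewrite in_itv/= andbT => x0; rewrite lee_fin gauss_pow_ge0.
- exact: measurable_gauss_pow.
- apply/measurable_EFinP; apply: measurable_funTS; apply: continuous_measurable_fun.
  exact: is_derive_continuous (is_derive_expRN _).
- by move=> x /=; rewrite in_itv/= andbT => x0; rewrite lee_fin gauss_pow_bound.
Qed.

(* Integration by parts: (x^(k+2) - (k+1) s^2 x^k) p is the derivative of - s^2 x^(k+1) p.
   Adding K e^(-x) makes it nonnegative. *)
Lemma half_momentS k : half_moment k.+2 = (k.+1%:R * s ^+ 2)%:E * half_moment k.
Proof.
pose K : R := (k.+1%:R * s ^+ 2 * gauss_cst k)%R.
have K0 : (0 <= K)%R by exact: mulr_ge0 (mulr_ge0 (ler0n _ _) (sqr_ge0 _)) (gauss_cst_ge0 k).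
pose f (x : R) : R := (x ^+ k.+2 * p x - k.+1%:R * s ^+ 2 * (x ^+ k * p x) + K * expR (- x))%R.
pose F (x : R) : R := (- s ^+ 2 * (x ^+ k.+1 * p x) - K * expR (- x))%R.
have cexp : continuous (fun x : R => K * expR (- x))%R.
  exact: is_derive_continuous (is_derive_expRN K).
have cf : continuous f.
  move=> x; apply: cvgD; last exact: cexp.
  apply: cvgB; first exact: continuous_gauss_pow.
  by apply: cvgMr; exact: continuous_gauss_pow.
have DF (x : R) : is_derive x 1%R F (f x).
  have D3 := is_derive_expRN K x.
  have Dp := is_derive_gauss_pdf x.
  have D4 : is_derive (x : R) 1%R (fun y : R => y ^+ k.+1)%R (k.+1%:R * x ^+ k)%R.
    split; first exact: exprn_derivable.
    by rewrite exp_derive /GRing.scale /= mulr1.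
  have := is_deriveB (is_deriveZ (- s ^+ 2)%R (is_deriveM D4 Dp)) D3.
  move=> H; apply: is_derive_eq H _; rewrite /f /GRing.scale /= !exprS; field.
  by rewrite gt_eqF.
have cF : continuous F.
  exact: is_derive_continuous DF.
have f0 (x : R) : (0 <= x -> 0 <= f x)%R.
  move=> x0; rewrite /f -addrA; apply: addr_ge0; first exact: gauss_pow_ge0.
  rewrite addrC subr_ge0 /K -[leRHS]mulrA; apply: ler_wpM2l (gauss_pow_bound k x0).
  exact: mulr_ge0 (ler0n _ _) (sqr_ge0 _).
have If : \int[mu]_(x in `[0%R, +oo[) (f x)%:E = K%:E.
  rewrite (@ge0_continuous_FTC2y _ f F 0%R 0%R) //.
  - by rewrite /F expr0n /= mul0r mulr0 oppr0 expR0 mulr1 sub0r -EFinB opprK add0r.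
  - exact: continuous_subspaceT.
  - have -> : (0 = - s ^+ 2 * 0 - K * 0 :> R)%R by rewrite !mulr0 subr0.
    apply: cvgB; apply: cvgMr; [exact: gauss_pow_cvg0|exact: cvgr_expR].
  - exact/cvg_at_right_filter/cF.
  - by move=> x _; rewrite derive1E; have [_ ->] := DF x.
have mE : measurable_fun (`[0%R, +oo[ : set R) (fun x : R => (K * expR (- x))%:E).
  by apply/measurable_EFinP; apply: measurable_funTS; apply: continuous_measurable_fun; exact: cexp.
have mf : measurable_fun (`[0%R, +oo[ : set R) (fun x : R => (f x)%:E).
  by apply/measurable_EFinP; apply: measurable_funTS; apply: continuous_measurable_fun; exact: cf.
have L : \int[mu]_(x in `[0%R, +oo[) ((x ^+ k.+2 * p x)%:E + (K * expR (- x))%:E) =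
    \int[mu]_(x in `[0%R, +oo[) ((f x)%:E + (k.+1%:R * s ^+ 2)%:E * (x ^+ k * p x)%:E).
  apply: eq_integral => x _; rewrite -EFinM -!EFinD; congr EFin; rewrite /f; ring.
have c0 : (0 <= k.+1%:R * s ^+ 2)%R by exact: mulr_ge0 (ler0n _ _) (sqr_ge0 _).
move: L; rewrite !ge0_integralD//; first last.
- by move=> x /=; rewrite lee_fin mulr_ge0// expR_ge0.
- exact: measurable_gauss_pow.
- by move=> x /=; rewrite in_itv/= andbT => x0; rewrite lee_fin gauss_pow_ge0.
- by apply: emeasurable_funM => //; exact: measurable_gauss_pow.
- move=> x /=; rewrite in_itv/= andbT => x0.
  by rewrite -EFinM lee_fin; exact: mulr_ge0 c0 (gauss_pow_ge0 k x0).
- by move=> x /=; rewrite in_itv/= andbT => x0; rewrite lee_fin f0.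
rewrite If (integral_expRN K0) ge0_integralZl//; last 2 first.
- exact: measurable_gauss_pow.
- by move=> x /=; rewrite in_itv/= andbT => x0; rewrite lee_fin gauss_pow_ge0.
rewrite -/(half_moment k) -/(half_moment k.+2).
have := half_moment_fin k; have := half_moment_fin k.+2.
case: (half_moment k) => // a; case: (half_moment k.+2) => // b _ _.
by rewrite -EFinM -!EFinD => -[?]; congr EFin; lra.
Qed.

Lemma half_moment0 : half_moment 0 = (2^-1)%:E.
Proof.
have := integral_normal_pdf 0 s.
have -> : \int[mu]_x (p x)%:E = \int[mu]_x (x ^+ 0 * p x)%:E.
  by apply: eq_integral => x _; rewrite expr0 mul1r.
rewrite ge0_symfun_integralT//; last 3 first.
- by move=> x; rewrite expr0 mul1r normal_pdf_ge0.
- exact: continuous_gauss_pow.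
- by move=> x; rewrite /= !expr0 gauss_pdf_sym.
rewrite -set_itvcy -/(half_moment 0).
have := half_moment_fin 0; case: (half_moment 0) => // a _.
by rewrite -EFinM => -[?]; congr EFin; lra.
Qed.

Local Notation gamma := (normal_prob 0 s).

(** The Radon-Nikodym derivative of the normal law agrees almost everywhere with its density, having
    the same integral over every measurable set. *)
Lemma ge0_integral_normal_prob (g : R -> \bar R) :
  measurable_fun [set: R] g -> (forall x, 0 <= g x) ->
  \int[gamma]_x g x = \int[mu]_x (g x * (p x)%:E).
Proof.
move=> mg g0.
have dom : gamma `<< mu := normal_prob_dominates 0 s.
rewrite -(Radon_Nikodym_SigmaFinite.change_of_variables dom)//.
have fi := Radon_Nikodym_SigmaFinite.f_integrable dom.
have mp : measurable_fun [set: R] (fun x : R => (p x)%:E).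
  by apply/measurable_EFinP; exact: measurable_normal_pdf.
apply: ae_eq_integral => //.
- by apply: emeasurable_funM => //; exact: measurable_int fi.
- exact: emeasurable_funM.
apply: ae_eqe_mul2l; apply: integral_ae_eq => // E _ mE.
by rewrite -Radon_Nikodym_SigmaFinite.f_integral.
Qed.

Lemma even_pow_moment k : ~~ odd k ->
  \int[gamma]_x (`|x| ^+ k)%:E = 2%:E * half_moment k.
Proof.
move=> ek; rewrite ge0_integral_normal_prob.
- rewrite /half_moment set_itvcy -ge0_symfun_integralT.
  + apply: eq_integral => x _; rewrite -EFinM; congr (_ * _)%:E.
    by rewrite -normrX ger0_norm// exprn_even_ge0.
  + by move=> x; rewrite mulr_ge0 ?normal_pdf_ge0// exprn_even_ge0.
  + exact: continuous_gauss_pow.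
  + by move=> x; rewrite /= gauss_pdf_sym exprNn -signr_odd (negbTE ek) expr0 mul1r.
- by apply/measurable_EFinP; apply: measurable_funX; exact: normr_measurable.
- by move=> x; rewrite lee_fin exprn_ge0.
Qed.

Lemma normal_moment2 : \int[gamma]_x (x ^+ 2)%:E = (s ^+ 2)%:E.
Proof.
under eq_integral => x _ do rewrite -real_normK ?num_real//.
rewrite even_pow_moment// half_momentS half_moment0 -!EFinM; congr EFin; by field.
Qed.

Lemma normal_moment4 : \int[gamma]_x (x ^+ 4)%:E = (3 * s ^+ 4)%:E.
Proof.
under eq_integral => x _.
  rewrite -[(x ^+ 4)%R]/(x ^+ (2 * 2))%R exprM -(real_normK (num_real x)) -exprM.
  over.
rewrite (even_pow_moment (k := 4))// (half_momentS 2) (half_momentS 0) half_moment0 -!EFinM.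
congr EFin; by field.
Qed.

Lemma normal_pos_moment : \int[gamma]_x (Num.max x 0)%:E = half_moment 1.
Proof.
rewrite ge0_integral_normal_prob.
- rewrite /half_moment [RHS]integral_mkcond; apply: eq_integral => x _.
  rewrite patchE mem_setE in_itv /= andbT -EFinM expr1.
  by case: leP => // _; rewrite mul0r.
- by apply/measurable_EFinP; exact: measurable_maxr.
- by move=> x; rewrite lee_fin le_max lexx orbT.
Qed.

Lemma normal_abs_moment : \int[gamma]_x (`|x|)%:E = 2%:E * half_moment 1.
Proof.
rewrite ge0_integral_normal_prob.
- have -> : half_moment 1 = \int[mu]_(x in [set x : R | (0 <= x)%R]) (`|x| * p x)%:E.
    rewrite -set_itvcy; apply: eq_integral => x; rewrite mem_setE in_itv/= andbT => x0.
    by rewrite expr1 ger0_norm.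
  rewrite -ge0_symfun_integralT//.
  + by move=> x; rewrite mulr_ge0 ?normal_pdf_ge0.
  + move=> x; apply: cvgM; first exact: norm_continuous.
    by apply: continuous_normal_pdf; rewrite gt_eqF.
  + by move=> x; rewrite /= gauss_pdf_sym normrN.
- by apply/measurable_EFinP; exact: normr_measurable.
- by move=> x; rewrite lee_fin.
Qed.

(** Subtract the positive part from the absolute moment. The value of [half_moment 1] is never
    computed: its finiteness suffices for the mean to cancel. *)
Lemma normal_neg_moment : \int[gamma]_x (Num.max (- x) 0)%:E = half_moment 1.
Proof.
have mpos : measurable_fun [set: R] (fun x : R => (Num.max x 0)%:E).
  by apply/measurable_EFinP; exact: measurable_maxr.
have mneg : measurable_fun [set: R] (fun x : R => (Num.max (- x) 0)%:E).
  by apply/measurable_EFinP; apply: measurable_maxr => //; exact: oppr_measurable.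
have := normal_abs_moment.
under eq_integral => x _.
  have -> : (`|x| = Num.max x 0 + Num.max (- x) 0)%R.
    case/orP: (le_total 0%R x) => x0.
      by rewrite ger0_norm// max_l// max_r ?addr0 ?oppr_le0.
    by rewrite ler0_norm// max_r// max_l ?add0r ?oppr_ge0.
  rewrite EFinD; over.
rewrite ge0_integralD//; last 2 first.
- by move=> x _; rewrite lee_fin le_max lexx orbT.
- by move=> x _; rewrite lee_fin le_max lexx orbT.
rewrite normal_pos_moment; have := half_moment_fin 1; case: (half_moment 1) => // a _.
case: (\int[gamma]_x (Num.max (- x) 0)%:E) => //= b.
by rewrite -EFinM => -[?]; congr EFin; lra.
Qed.

Lemma normal_abs_fin : \int[gamma]_x (`|x|)%:E < +oo.
Proof.
rewrite normal_abs_moment; have := half_moment_fin 1; case: (half_moment 1) => // a _.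
by rewrite -EFinM ltry.
Qed.

Lemma normal_mean : \int[gamma]_x x%:E = 0.
Proof.
rewrite integralE.
have -> : \int[gamma]_x ((fun x : R => x%:E)^\+ x) = \int[gamma]_x (Num.max x 0)%:E.
  by apply: eq_integral => x _; rewrite funeposE EFin_max.
have -> : \int[gamma]_x ((fun x : R => x%:E)^\- x) = \int[gamma]_x (Num.max (- x) 0)%:E.
  by apply: eq_integral => x _; rewrite funenegE EFin_max EFinN.
rewrite normal_pos_moment normal_neg_moment; have := half_moment_fin 1.
by case: (half_moment 1) => // a _; rewrite -EFinB subrr.
Qed.

End GaussianMoments.

(** * Independence *)

Section Independence.
Context {dsp : measure_display} {Omega : measurableType dsp} {R : realType}.
Context d' (T' : measurableType d').
Variables (P : probability Omega R) (gamma : probability T' R).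
Local Open Scope ereal_scope.

(** Independence of U and Z together with the law gamma of Z, which is the case A = setT. *)
Definition indep_law d (T : measurableType d) (U : Omega -> T) (Z : Omega -> T') :=
  forall A B, measurable A -> measurable B ->
    P (U @^-1` A `&` Z @^-1` B) = P (U @^-1` A) * gamma B.

Lemma law_pair d (T : measurableType d) (U : {RV P >-> T}) (Z : {RV P >-> T'}) :
  indep_law U Z -> forall X, measurable X ->
  (distribution P U \x gamma) X = P [set w | X (U w, Z w)].
Proof.
move=> iUZ X mX.
have mUZ : measurable_fun setT (fun w => (U w, Z w)).
  by apply: measurable_fun_pair; exact: measurable_funP.
pose mix := isMeasurableFun.Build _ _ _ _ _ mUZ.
pose V : {mfun Omega >-> (T * T')%type} := HB.pack (fun w => (U w, Z w)) mix.
have -> : P [set w | X (U w, Z w)] = distribution P V X by [].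
by apply: product_measure_unique.
Qed.

Section Product.
Variables (U : {RV P >-> R}) (Z : {RV P >-> T'}) (g : T' -> R).
Hypothesis iUZ : indep_law U Z.
Hypothesis mg : measurable_fun setT g.
Hypothesis intU : P.-integrable setT (EFin \o U).
Hypothesis intg : gamma.-integrable setT (EFin \o g).

Let F (z : R * T') : \bar R := (z.1 * g z.2)%:E.

Let mF : measurable_fun setT F.
Proof.
apply/measurable_EFinP; apply: measurable_funM => //.
exact: measurableT_comp.
Qed.

Let V w : R * T' := (U w, Z w).

Let mV : measurable_fun setT V.
Proof. by apply: measurable_fun_pair; exact: measurable_funP. Qed.

Let absg : \int[gamma]_y `|(g y)%:E| < +oo.
Proof. by have /integrableP[_] := intg. Qed.

Let intF : (distribution P U \x gamma).-integrable setT F.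
Proof.
apply/integrable12ltyP => //.
have -> : \int[distribution P U]_x \int[gamma]_y `|F (x, y)| =
    \int[distribution P U]_x ((\int[gamma]_y `|(g y)%:E|) * `|x%:E|).
  apply: eq_integral => x _; rewrite muleC -ge0_integralZl//.
  - by apply: eq_integral => y _; rewrite /F /= normrM EFinM.
  - by apply/measurableT_comp => //; exact/measurable_EFinP.
rewrite ge0_integralZl//; last 2 first.
- by apply/measurableT_comp => //; exact/measurable_EFinP.
- exact: integral_ge0.
apply: lte_mul_pinfty; first exact: integral_ge0.
  by rewrite ge0_fin_numE ?integral_ge0.
rewrite ge0_integral_distribution//; last first.
  by apply/measurableT_comp => //; exact/measurable_EFinP.
by have /integrableP[_] := intU.
Qed.

Let VRV : {RV P >-> (R * T')%type} := HB.pack V (isMeasurableFun.Build _ _ _ _ _ mV).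

Let int_law (h : R * T' -> \bar R) :
  \int[distribution P U \x gamma]_z h z = \int[distribution P VRV]_z h z.
Proof. by apply: eq_measure_integral => X mX _; exact: law_pair. Qed.

Lemma indep_integrable : P.-integrable setT (fun w => (U w * g (Z w))%:E).
Proof.
apply/integrableP; split.
  apply/measurable_EFinP; apply: measurable_funM => //.
  exact: measurableT_comp.
rewrite -(ge0_integral_distribution VRV (f := fun z => `|F z|)) //.
  by rewrite -int_law; have /integrableP[_] := intF.
exact: measurableT_comp.
Qed.

Lemma indep_integral :
  \int[P]_w (U w * g (Z w))%:E = \int[P]_w (U w)%:E * \int[gamma]_x (g x)%:E.
Proof.
rewrite -(integral_distribution (X := VRV) mF indep_integrable) -int_law.
rewrite -integral12_prod_meas1//.
have -> : \int[distribution P U]_x (fubini_F gamma F) x =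
    \int[distribution P U]_x ((\int[gamma]_y (g y)%:E) * x%:E).
  apply: eq_integral => x _; rewrite /fubini_F muleC -integralZl//.
have fing : \int[gamma]_y (g y)%:E \is a fin_num by exact: integrable_fin_num.
rewrite -(fineK fing) integralZl//; last first.
  by apply: integrable_pushforward.
by rewrite muleC integral_distribution.
Qed.

End Product.
End Independence.

Section IndependentProduct.
Context {dsp : measure_display} {Omega : measurableType dsp} {R : realType}.
Context d' (T' : measurableType d').
Variables (P : probability Omega R) (gamma gamma' : probability T' R).
Local Open Scope ereal_scope.

(** On the event Z' in B' the law of (U, Z) agrees on rectangles with a scaled product measure, and
    uniqueness of product measures extends this to preimages under M. With M the product, this
    serves the off-diagonal covariances of increments. *)
Lemma indep_mul (U : {RV P >-> R}) (Z Z' : {RV P >-> T'}) (M : R * T' -> R) :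
  measurable_fun setT M ->
  (forall A B B', measurable A -> measurable B -> measurable B' ->
    P (U @^-1` A `&` Z @^-1` B `&` Z' @^-1` B') = P (U @^-1` A) * gamma B * gamma' B') ->
  indep_law P gamma' (fun w => M (U w, Z w)) Z'.
Proof.
move=> mM iUZ A B' mA mB'.
have mUZ : measurable_fun setT (fun w => (U w, Z w)).
  by apply: measurable_fun_pair; exact: measurable_funP.
pose V : {mfun Omega >-> (R * T')%type} :=
  HB.pack (fun w => (U w, Z w)) (isMeasurableFun.Build _ _ _ _ _ mUZ).
have iUZ0 : indep_law P gamma U Z.
  move=> A0 B0 mA0 mB0; have := iUZ A0 B0 setT mA0 mB0 measurableT.
  by rewrite preimage_setT setIT probability_setT mule1.
have mC : measurable (Z' @^-1` B').
  by rewrite -[X in measurable X]setTI; exact: measurable_funP.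
have fin : gamma' B' \is a fin_num by exact: fin_num_measure.
have k0 : (0 <= fine (gamma' B'))%R by exact: fine_ge0.
pose k := NngNum k0.
have kE : k%:num%:E = gamma' B' by rewrite /= fineK.
pose X := M @^-1` A.
have mX : measurable X by rewrite -[X]setTI; exact: mM.
have E1 := product_measure_unique (m1 := mscale k (distribution P U)) (m2 := gamma)
  (m' := pushforward (mrestr P mC) V).
have E2 := product_measure_unique (m1 := mscale k (distribution P U)) (m2 := gamma)
  (m' := mscale k (distribution P V)).
have -> : P ((fun w => M (U w, Z w)) @^-1` A `&` Z' @^-1` B') =
    pushforward (mrestr P mC) V X by [].
rewrite -(E1 mUZ)//; last first.
  move=> A0 B0 mA0 mB0; transitivity (P (U @^-1` A0) * gamma B0 * gamma' B'); first exact: iUZ.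
  by rewrite muleC muleA -kE.
rewrite E2//; first by rewrite [RHS]muleC -kE.
move=> A0 B0 mA0 mB0.
transitivity (k%:num%:E * (P (U @^-1` A0) * gamma B0)); last by rewrite muleA.
by congr (_ * _); exact: iUZ0.
Qed.

End IndependentProduct.

(** * Wiener increments *)

(** Measurability is known coordinate by coordinate, so the open preimage of a half-line is written
    as a countable union of boxes with rational centres. *)
Lemma measurable_continuous_rV {R : realType} d (phi : 'rV[R]_d -> R)
    dsp (T : measurableType dsp) (X : T -> 'rV[R]_d) :
  continuous phi -> (forall i, measurable_fun setT (fun w => X w 0 i)) ->
  measurable_fun setT (fun w => phi (X w)).
Proof.
move=> cphi mX; apply: (measurability _ (RGenOInfty.measurableE R)) => _ [_ [a ->] <-].
rewrite setTI.
pose box (q : 'rV[rat]_d * nat) : set 'rV[R]_d :=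
  [set y | forall i, `|y 0 i - ratr (q.1 0 i)| < q.2.+1%:R^-1].
pose U (q : 'rV[rat]_d * nat) : set T :=
  [set w | box q `<=` [set y | a < phi y] /\ box q (X w)].
have -> : (fun w => phi (X w)) @^-1` `]a, +oo[ = \bigcup_q U q.
  apply/seteqP; split => [w /=|w [q _]]; last first.
    by case=> sub /sub; rewrite /= in_itv/= andbT.
  rewrite in_itv/= andbT => aw.
  have /nbhs_ballP[e /= e0 He] : nbhs (X w) [set y | a < phi y].
    have h : nbhs (phi (X w)) [set y : R | a < y].
      by apply: open_nbhs_nbhs; split => //; exact: open_gt.
    exact: (cphi (X w) _ h).
  pose N := Num.truncn (2 / e).
  have N0 : (0 : R) < N.+1%:R^-1 by rewrite invr_gt0.
  have Ne : N.+1%:R^-1 + N.+1%:R^-1 < e.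
    have h : 2 / e < N.+1%:R by exact: truncnS_gt.
    by rewrite -mulr2n -[X in X < _]mulr_natl ltr_pdivrMr// mulrC -ltr_pdivrMr.
  have /choice[q Hq] : forall i, exists q : rat, `|X w 0 i - ratr q| < N.+1%:R^-1.
    move=> i; have [|q] := @rat_in_itvoo R (X w 0 i - N.+1%:R^-1) (X w 0 i + N.+1%:R^-1).
      by rewrite ltrBlDr -addrA ltrDl addr_gt0.
    rewrite in_itv/= => /andP[q1 q2]; exists q.
    by rewrite ltr_norml; move: q1 q2; set c := N.+1%:R^-1; lra.
  exists (\row_i q i, N) => //; split => [y Hy|i /=]; last by rewrite mxE.
  apply: He; split => // i j; rewrite (ord1 i).
  apply: le_lt_trans Ne; rewrite -(subrKA (ratr (q j))).
  apply: le_trans (ler_normD _ _) _; apply: lerD; first exact/ltW.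
  by have := ltW (Hy j); rewrite /= mxE distrC.
apply: countable_bigcupT_measurable => [//|q].
have [sub|nsub] := pselect (box q `<=` [set y | a < phi y]); last first.
  by rewrite (_ : U q = set0) //; apply/seteqP; split => // w [].
have -> : U q = X @^-1` box q by apply/seteqP; split => [w []|].
have -> : X @^-1` box q = \bigcap_(i in [set: 'I_d]) (fun w => X w 0 i) @^-1` 
    (ball (ratr (q.1 0 i) : R) q.2.+1%:R^-1).
  by apply/seteqP; split => w Hw i; [move=> _; have := Hw i|have := Hw i I];
    rewrite /= /ball /= distrC.
apply: fin_bigcap_measurable => // i _; rewrite -[X in measurable X]setTI.
by apply: mX => //; exact: measurable_ball.
Qed.

Section Expectation.
Context {dsp : measure_display} {Omega : measurableType dsp} {R : realType}.
Variable P : probability Omega R.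
Implicit Types U V : Omega -> R.

Definition summable U : Prop := P.-integrable setT (EFin \o U).

Definition Ex U : R := \int[P]_w U w.

Lemma summableD U V : summable U -> summable V -> summable (fun w => U w + V w).
Proof. by move=> iU iV; exact: (@integrableD _ _ _ _ _ measurableT _ _ iU iV). Qed.

Lemma summableZ c U : summable U -> summable (fun w => c * U w).
Proof. by move=> iU; exact: (@integrableZl _ _ _ _ _ measurableT c _ iU). Qed.

Lemma summableB U V : summable U -> summable V -> summable (fun w => U w - V w).
Proof.
move=> iU iV; have := summableD iU (summableZ (-1) iV).
by congr summable; apply/funext => w; rewrite mulN1r.
Qed.

Lemma summable_measurable U : summable U -> measurable_fun setT U.
Proof. by move=> /measurable_int/measurable_EFinP. Qed.

Lemma bounded_summable U C : measurable_fun setT U -> (forall w, `|U w| <= C) ->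
  summable U.
Proof.
move=> mU UC; apply: measurable_bounded_integrable => //.
  by rewrite -ge0_fin_numE//; exact: fin_num_measure.
by exists C; split; rewrite ?num_real// => x Cx w _; exact: le_trans (UC w) (ltW Cx).
Qed.

Lemma summable_sum (I : Type) (r : seq I) (U : I -> Omega -> R) :
  (forall i, summable (U i)) -> summable (fun w => \sum_(i <- r) U i w).
Proof.
move=> iU; elim: r => [|i r IH].
  apply: (@bounded_summable _ 0) => [|w].
    by under eq_fun do rewrite big_nil; exact: measurable_cst.
  by rewrite big_nil normr0.
have := summableD (iU i) IH.
by congr summable; apply/funext => w; rewrite big_cons.
Qed.

Lemma ExD U V : summable U -> summable V -> Ex (fun w => U w + V w) = Ex U + Ex V.
Proof. by move=> iU iV; exact: RintegralD. Qed.

Lemma ExZ c U : summable U -> Ex (fun w => c * U w) = c * Ex U.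
Proof. by move=> iU; exact: RintegralZl. Qed.

Lemma ExB U V : summable U -> summable V -> Ex (fun w => U w - V w) = Ex U - Ex V.
Proof. by move=> iU iV; exact: RintegralB. Qed.

Lemma Ex_cst c : Ex (fun=> c) = c.
Proof. by rewrite /Ex Rintegral_cst//= probability_setT mulr1. Qed.

Lemma Ex_sum (I : Type) (r : seq I) (U : I -> Omega -> R) :
  (forall i, summable (U i)) ->
  Ex (fun w => \sum_(i <- r) U i w) = \sum_(i <- r) Ex (U i).
Proof.
move=> iU; elim: r => [|i r IH].
  by rewrite big_nil -[RHS](Ex_cst 0); congr Ex; apply/funext => w; rewrite big_nil.
rewrite big_cons -IH -ExD//; last exact: summable_sum.
by congr Ex; apply/funext => w; rewrite big_cons.
Qed.

Lemma Ex_le U V : summable U -> summable V -> (forall w, U w <= V w) -> Ex U <= Ex V.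
Proof. by move=> iU iV UV; apply: le_Rintegral => // w _; exact: UV. Qed.

Lemma Ex_norm_le U V : summable U -> summable V -> (forall w, `|U w| <= V w) ->
  `|Ex U| <= Ex V.
Proof.
move=> iU iV UV; rewrite ler_norml; apply/andP; split.
  rewrite lerNl -mulN1r -ExZ//; apply: Ex_le => //; first exact: summableZ.
  by move=> w; rewrite mulN1r (le_trans _ (UV w))// -normrN ler_norm.
by apply: Ex_le => // w; rewrite (le_trans _ (UV w))// ler_norm.
Qed.

Lemma Ex_bound U C : summable U -> (forall w, `|U w| <= C) -> `|Ex U| <= C.
Proof.
move=> iU UC; rewrite -[leRHS]Ex_cst; apply: Ex_norm_le => //.
by apply: (@bounded_summable _ `|C|) => [|w]; [exact: measurable_cst|].
Qed.

End Expectation.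

Section Noise.
Context {dsp : measure_display} {Omega : measurableType dsp} {R : realType}.
Variables (P : probability Omega R) (F : R -> set (set Omega)) (m : nat).
Variable W : 'I_m -> R -> Omega -> R.
Hypotheses (HF : is_filtration F) (HW : is_wiener P F W).

Definition adapted t (U : Omega -> R) : Prop :=
  forall B, measurable B -> F t (U @^-1` B).

(** Turns adaptedness into measurability for the sigma-algebra F t, so that closure under sums,
    products and continuous maps is that of measurable functions. *)
Lemma adaptedP t U : 0 <= t ->
  adapted t U <-> measurable_fun setT (U : g_sigma_algebraType (F t) -> R).
Proof.
move=> t0; have [sF _] := HF.1 t t0; split => [aU _ B mB|mU B mB].
  by rewrite setTI; apply: sub_sigma_algebra; exact: aU.
by have := mU measurableT B mB; rewrite setTI /measurable /= sigma_algebra_id.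
Qed.

Lemma adapted_measurable t U : 0 <= t -> adapted t U -> measurable_fun setT U.
Proof.
by move=> t0 aU _ B mB; rewrite setTI; apply: (HF.1 t t0).2; exact: aU.
Qed.

Lemma adapted_le s t U : 0 <= s -> s <= t -> adapted s U -> adapted t U.
Proof. by move=> s0 st aU B mB; apply: (HF.2 s t s0 st); exact: aU. Qed.

Lemma adapted_continuous d (phi : 'rV[R]_d -> R) t (X : Omega -> 'rV[R]_d) :
  0 <= t -> continuous phi -> (forall i, adapted t (fun w => X w 0 i)) ->
  adapted t (fun w => phi (X w)).
Proof.
move=> t0 cphi aX; apply/adaptedP => //.
apply: (@measurable_continuous_rV _ _ _ _ (g_sigma_algebraType (F t))) => // i.
exact/adaptedP.
Qed.

Definition increment l s h w := W l (s + h) w - W l s w.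

Lemma adapted_increment l s h : 0 <= s -> 0 <= h -> adapted (s + h) (increment l s h).
Proof.
move=> s0 h0; have [aW _ _ _] := HW; have sh0 := addr_ge0 s0 h0.
apply/adaptedP => //; apply: measurable_funB; apply/adaptedP => // B mB.
  exact: aW.
by apply: (HF.2 s (s + h) s0); [rewrite lerDl|exact: aW].
Qed.

Section OneStep.
Variables s h : R.
Hypotheses (s0 : 0 <= s) (h0 : 0 < h).

Let sd : R := Num.sqrt h.
Let gamma : probability (measurableTypeR R) R := normal_prob 0 sd.
Let Z l := increment l s h.

Let sd0 : 0 < sd. Proof. by rewrite sqrtr_gt0. Qed.

Lemma increment_measurable l : measurable_fun setT (Z l).
Proof.
exact: adapted_measurable (addr_ge0 s0 (ltW h0)) (adapted_increment l s0 (ltW h0)).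
Qed.

Let mZ l : measurable_fun setT (Z l : Omega -> measurableTypeR R).
Proof. exact: increment_measurable. Qed.

Let ZRV l : {RV P >-> measurableTypeR R} :=
  HB.pack (Z l : Omega -> measurableTypeR R) (isMeasurableFun.Build _ _ _ _ _ (mZ l)).

Let noise_box l k U A B B' : l != k -> adapted s U ->
  measurable A -> measurable B -> measurable B' ->
  (P (U @^-1` A `&` Z l @^-1` B `&` Z k @^-1` B') =
   P (U @^-1` A) * gamma B * gamma B')%E.
Proof.
move=> lk aU mA mB mB'; have [_ _ _ box] := HW.
pose Bs j := if j == l then B else if j == k then B' else setT.
have := box s (s + h) (U @^-1` A) Bs s0.
rewrite ltrDl (_ : s + h - s = h); last by rewrite addrC addKr.
move=> /(_ h0 (aU A mA)) H.
have -> : U @^-1` A `&` Z l @^-1` B `&` Z k @^-1` B' =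
    U @^-1` A `&` [set w | forall j, Bs j (W j (s + h) w - W j s w)].
  rewrite -setIA; congr (_ `&` _); apply/seteqP; split => w /=.
    move=> [h1 h2] j; rewrite /Bs; case: eqP => [->//|_]; by case: eqP => [->//|_].
  move=> h1; split; first by have := h1 l; rewrite /Bs eqxx.
  by have := h1 k; rewrite /Bs eq_sym (negbTE lk) eqxx.
rewrite H.
  rewrite (bigD1 l)//= (bigD1 k) /=; last by rewrite eq_sym.
  rewrite big1 ?mule1 /Bs; last first.
    by move=> j /andP[/negbTE-> /negbTE->]; exact: probability_setT.
  by rewrite eqxx [k == l]eq_sym (negbTE lk) eqxx muleA.
by move=> j; rewrite /Bs; case: ifP => // _; case: ifP.
Qed.

Let noise_indep l U : adapted s U -> indep_law P gamma U (Z l).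
Proof.
move=> aU A B mA mB; have [_ _ _ box] := HW.
pose Bs j := if j == l then B else setT.
have := box s (s + h) (U @^-1` A) Bs s0.
rewrite ltrDl (_ : s + h - s = h); last by rewrite addrC addKr.
move=> /(_ h0 (aU A mA)) H.
have -> : U @^-1` A `&` Z l @^-1` B =
    U @^-1` A `&` [set w | forall j, Bs j (W j (s + h) w - W j s w)].
  congr (_ `&` _); apply/seteqP; split => w /=.
    by move=> h1 j; rewrite /Bs; case: eqP => [->//|].
  by move=> h1; have := h1 l; rewrite /Bs eqxx.
rewrite H.
  rewrite (bigD1 l)//= big1 ?mule1 /Bs ?eqxx// => j /negbTE->.
  exact: probability_setT.
by move=> j; rewrite /Bs; case: ifP.
Qed.

Let gamma_id : gamma.-integrable setT (fun x : measurableTypeR R => x%:E).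
Proof.
by apply/integrableP; split; [exact/measurable_EFinP|exact: normal_abs_fin sd0].
Qed.

Let gamma_sqr : gamma.-integrable setT (fun x : measurableTypeR R => (x ^+ 2)%:E).
Proof.
apply/integrableP; split; first by apply/measurable_EFinP; exact: measurable_funX.
have E x : (`|(x ^+ 2)%:E| = (x ^+ 2)%:E :> \bar R)%E.
  by rewrite gee0_abs// lee_fin sqr_ge0.
under eq_integral => x _ do rewrite E.
by rewrite (normal_moment2 sd0) ltry.
Qed.

Let gamma_pow4 : gamma.-integrable setT (fun x : measurableTypeR R => (x ^+ 4)%:E).
Proof.
apply/integrableP; split; first by apply/measurable_EFinP; exact: measurable_funX.
have E x : (`|(x ^+ 4)%:E| = (x ^+ 4)%:E :> \bar R)%E.
  by rewrite gee0_abs// lee_fin exprn_even_ge0.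
under eq_integral => x _ do rewrite E.
by rewrite (normal_moment4 sd0) ltry.
Qed.

Let noise_indep_moment l U (g : R -> R) c : summable P U -> indep_law P gamma U (Z l) ->
  gamma.-integrable setT (fun x : measurableTypeR R => (g x)%:E) ->
  (\int[gamma]_x (g x)%:E = c%:E)%E ->
  summable P (fun w => U w * g (Z l w)) /\ Ex P (fun w => U w * g (Z l w)) = c * Ex P U.
Proof.
move=> iU iUZ ig cg; have mU := summable_measurable iU.
pose URV : {RV P >-> R} := HB.pack U (isMeasurableFun.Build _ _ _ _ _ mU).
have mg : measurable_fun setT (g : measurableTypeR R -> R).
  by apply/measurable_EFinP; exact: measurable_int ig.
split; first exact: (@indep_integrable _ _ _ _ _ P gamma URV (ZRV l) g iUZ mg iU ig).
rewrite /Ex /Rintegral (@indep_integral _ _ _ _ _ P gamma URV (ZRV l) g iUZ mg iU ig).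
rewrite cg fineM//; first by rewrite mulrC.
exact: integrable_fin_num.
Qed.

Lemma noise_mean l U : adapted s U -> summable P U ->
  summable P (fun w => U w * Z l w) /\ Ex P (fun w => U w * Z l w) = 0.
Proof.
move=> aU iU.
have [h1 h2] := noise_indep_moment (g := id) iU (noise_indep l aU) gamma_id (normal_mean sd0).
by split=> //; rewrite h2 mul0r.
Qed.

(** On the diagonal this is the second Gaussian moment; off it, U times the first increment is
    independent of the second increment, which has mean zero. *)
Lemma noise_cov l k U : adapted s U -> summable P U ->
  summable P (fun w => U w * (Z l w * Z k w)) /\
  Ex P (fun w => U w * (Z l w * Z k w)) = (l == k)%:R * h * Ex P U.
Proof.
move=> aU iU; have mU := summable_measurable iU.
pose URV : {RV P >-> R} := HB.pack U (isMeasurableFun.Build _ _ _ _ _ mU).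
have [->|lk] := eqVneq l k.
  have := noise_indep_moment (g := fun x => x ^+ 2) iU (noise_indep k aU) gamma_sqr (normal_moment2 sd0).
  by rewrite /sd sqr_sqrtr ?ltW// mul1r.
have mM : measurable_fun setT (fun z : (R * measurableTypeR R)%type => (z.1 * (z.2 : R))%R : R).
  by apply: measurable_funM; [exact: measurable_fst|exact: measurable_snd].
have [iUZ _] := noise_mean l aU iU.
have ind := @indep_mul _ _ _ _ _ P gamma gamma URV (ZRV l) (ZRV k) _ mM
  (fun A B B' => @noise_box l k U A B B' lk aU).
have [h1 h2] := noise_indep_moment (l := k) (g := id) iUZ ind gamma_id (normal_mean sd0).
have -> : (fun w => U w * (Z l w * Z k w)) = (fun w => U w * Z l w * Z k w).
  by apply/funext => w; rewrite mulrA.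
by split=> //; rewrite h2 !mul0r.
Qed.

Lemma noise_pow4 l : summable P (fun w => Z l w ^+ 4) /\
  Ex P (fun w => Z l w ^+ 4) = 3 * h ^+ 2.
Proof.
have i1 : summable P (cst 1).
  by apply: (@bounded_summable _ _ _ _ _ 1) => [|w]; [exact: measurable_cst|rewrite normr1].
have a1 : adapted s (cst 1) by apply/adaptedP => //; exact: measurable_cst.
have := noise_indep_moment (g := fun x => x ^+ 4) i1 (noise_indep l a1) gamma_pow4 (normal_moment4 sd0).
rewrite Ex_cst mulr1 /sd -[4%N]/((2 * 2)%N) exprM sqr_sqrtr ?ltW//.
by under eq_fun do rewrite mul1r.
Qed.

End OneStep.
End Noise.

(** * The frozen diffusion over a short time *)

Section FrozenFamilies.
Context {R : realType} {d m : nat}.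
Variables (f : 'rV[R]_d -> 'rV[R]_d) (sigma : 'rV[R]_d -> 'M[R]_(d, m)).
Hypothesis f_smooth : forall i, torus_smooth (fun x => f x 0 i).
Hypothesis sigma_smooth : forall i l, torus_smooth (fun x => sigma x i l).
Local Notation frozen := (frozen_generator f sigma).
Implicit Types (psi chi : 'rV[R]_d -> R) (x y z : 'rV[R]_d).

Lemma coefficient_bound : exists2 C, 0 <= C & forall x,
  [/\ norm1 (f x) <= C, forall l, \sum_i `|sigma x i l| <= C &
      \sum_i \sum_j `|diffusion sigma x i j| <= C].
Proof.
have bound (I : finType) (g : I -> 'rV[R]_d -> R) : (forall i, torus_smooth (g i)) ->
    exists2 C, 0 <= C & forall x, \sum_i `|g i x| <= C.
  move=> tg; have /choice[M HM] : forall i, exists M, bd 0 (g i) M.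
    by move=> i; exact: ts_bd (tg i).
  exists (\sum_i M i); first by apply: sumr_ge0 => i _; exact: bd_ge0 (HM i).
  by move=> x; apply: ler_sum => i _; exact: bd0 (HM i).
have [C1 C10 H1] := bound _ (fun i x => f x 0 i) f_smooth.
have [C2 C20 H2] := bound _ (fun (p : 'I_d * 'I_m) x => sigma x p.1 p.2)
  (fun p => sigma_smooth p.1 p.2).
have [C3 C30 H3] := bound _ (fun (p : 'I_d * 'I_d) x => diffusion sigma x p.1 p.2)
  (fun p => ts_diffusion sigma_smooth p.1 p.2).
exists (C1 + C2 + C3); first by rewrite !addr_ge0.
move=> x; split=> [|l|].
- by apply: le_trans (H1 x) _; rewrite -addrA lerDl addr_ge0.
- apply: (@le_trans _ _ C2); last by rewrite addrAC lerDr addr_ge0.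
  apply: le_trans (H2 x).
  rewrite -(pair_big xpredT xpredT (fun i l => `|sigma x i l|)) /=.
  by apply: ler_sum => i _; rewrite (bigD1 l)//= lerDl sumr_ge0.
- apply: (@le_trans _ _ C3); last by rewrite lerDr addr_ge0.
  by apply: le_trans (H3 x); rewrite -(pair_big xpredT xpredT (fun i j => `|diffusion sigma x i j|)).
Qed.

Lemma D_sum s (I : Type) (r : seq I) (g : I -> 'rV[R]_d -> R) :
  (forall i, torus_smooth (g i)) ->
  D s (fun x => \sum_(i <- r) g i x) = fun x => \sum_(i <- r) D s (g i) x.
Proof.
move=> tg; elim: r => [|i r IH].
  transitivity (D s (cst 0 : 'rV[R]_d -> R)).
    by congr (D s); apply/funext => x; rewrite big_nil.
  by apply/funext => x; rewrite big_nil D_cst; case: s.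
transitivity (D s (fun x => g i x + \sum_(i <- r) g i x)).
  by congr (D s); apply/funext => x; rewrite big_cons.
rewrite (DD s (ts_smooth (tg i)) (ts_smooth (ts_sum _ (fun i _ => tg i)))) IH.
by apply/funext => x; rewrite big_cons.
Qed.

Lemma D_frozen s x chi : torus_smooth chi ->
  D s (frozen x chi) = fun y => \sum_i f x 0 i * D (s ++ [:: i]) chi y +
    \sum_i \sum_j diffusion sigma x i j * D (s ++ [:: i; j]) chi y.
Proof.
move=> tc; have tp i : torus_smooth (partial i chi) := ts_partial i tc.
have tpp i j : torus_smooth (partial i (partial j chi)) := ts_partial i (tp j).
have t1 i : torus_smooth (fun y => f x 0 i * partial i chi y) := tsZ _ (tp i).
have t2 i j : torus_smooth (fun y => diffusion sigma x i j * partial i (partial j chi) y) :=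
  tsZ _ (tpp i j).
have t3 i : torus_smooth (fun y => \sum_j diffusion sigma x i j * partial i (partial j chi) y) :=
  ts_sum _ (fun j _ => t2 i j).
rewrite (DD s (ts_smooth (ts_sum _ (fun i _ => t1 i))) (ts_smooth (ts_sum _ (fun i _ => t3 i)))).
rewrite (D_sum _ _ t1) (D_sum _ _ t3); apply/funext => y; congr (_ + _).
  by apply: eq_bigr => i _; rewrite (DZ _ _ (ts_smooth (tp i))) D_cat.
apply: eq_bigr => i _; rewrite (D_sum _ _ (t2 i)); apply: eq_bigr => j _.
by rewrite (DZ _ _ (ts_smooth (tpp i j))) D_cat.
Qed.

(** Frozen coefficients are constants, so no derivative falls on them and one [C] serves all orders
    k and all freezing points x. *)
Lemma frozen_bd : exists2 C, 0 <= C & forall k x chi M, torus_smooth chi ->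
  bd k.+2 chi M -> bd k (frozen x chi) (C * M).
Proof.
have [C C0 HC] := coefficient_bound; exists (C + C); first by rewrite addr_ge0.
move=> k x chi M tc hc s y sk; rewrite (D_frozen _ _ tc) mulrDl.
have [h1 _ h3] := HC x; have M0 := bd_ge0 hc.
apply: le_trans (ler_normD _ _) _; apply: lerD.
  apply: le_trans (ler_norm_sum _ _ _) _.
  apply: (@le_trans _ _ (norm1 (f x) * M)); last by rewrite ler_wpM2r.
  rewrite mulr_suml; apply: ler_sum => i _; rewrite normrM ler_wpM2l//; apply: hc.
  by rewrite size_cat addn1 ltnS (leq_trans sk).
apply: le_trans (ler_norm_sum _ _ _) _.
apply: (@le_trans _ _ ((\sum_i \sum_j `|diffusion sigma x i j|) * M)); last by rewrite ler_wpM2r.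
rewrite mulr_suml; apply: ler_sum => i _.
apply: le_trans (ler_norm_sum _ _ _) _.
rewrite mulr_suml; apply: ler_sum => j _; rewrite normrM ler_wpM2l//; apply: hc.
by rewrite size_cat addn2 !ltnS.
Qed.

Lemma ts_iter_frozen x j chi : torus_smooth chi -> torus_smooth (iter j (frozen x) chi).
Proof. by move=> tc; apply: diffop_ts tc; exact: iter_frozen_diffop. Qed.

Lemma iter_frozen_bd : exists2 C, 0 <= C & forall j k x chi M, torus_smooth chi ->
  bd (k + 2 * j) chi M -> bd k (iter j (frozen x) chi) (C ^+ j * M).
Proof.
have [C C0 HC] := frozen_bd; exists C => // j.
elim: j => [|j IH] k x chi M tc hc; first by rewrite expr0 mul1r -[k]addn0.
rewrite iterS exprS -mulrA; apply: HC (ts_iter_frozen _ _ tc) _.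
by apply: IH => //; rewrite (_ : (k.+2 + 2 * j = k + 2 * j.+1)%N)//; lia.
Qed.

(* Psi x is evaluated at a second point, x being the point at which the
   coefficients are frozen. *)
Definition regular (Psi : 'rV[R]_d -> 'rV[R]_d -> R) : Prop :=
  [/\ forall x, torus_smooth (Psi x),
      forall k, exists M, forall x, bd k (Psi x) M &
      forall s dsp (T : measurableType dsp) (X Y : T -> 'rV[R]_d),
        (forall i, measurable_fun setT (fun w => X w 0 i)) ->
        (forall i, measurable_fun setT (fun w => Y w 0 i)) ->
        measurable_fun setT (fun w => D s (Psi (X w)) (Y w))].

Lemma regular_cst psi : torus_smooth psi -> regular (fun=> psi).
Proof.
move=> tp; split=> [//|k|s dsp T X Y mX mY].
  by have [M HM] := ts_bd k tp; exists M.
exact: measurable_continuous_rV (smooth_continuous (ts_smooth (ts_D s tp))) mY.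
Qed.

Lemma regular_frozen Psi : regular Psi -> regular (fun x => frozen x (Psi x)).
Proof.
move=> [tP bP mP]; split=> [x|k|s dsp T X Y mX mY].
- by apply: diffop_ts (tP x); exact: frozen_diffop.
- have [C C0 HC] := frozen_bd; have [M HM] := bP k.+2.
  by exists (C * M) => x; exact: HC (tP x) (HM x).
have mc (c : 'rV[R]_d -> R) : torus_smooth c -> measurable_fun setT (fun w => c (X w)).
  by move=> tc; exact: measurable_continuous_rV (smooth_continuous (ts_smooth tc)) mX.
have -> : (fun w => D s (frozen (X w) (Psi (X w))) (Y w)) =
    fun w => \sum_i f (X w) 0 i * D (s ++ [:: i]) (Psi (X w)) (Y w) +
    \sum_i \sum_j diffusion sigma (X w) i j * D (s ++ [:: i; j]) (Psi (X w)) (Y w).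
  by apply/funext => w; rewrite (D_frozen _ _ (tP (X w))).
apply: measurable_funD; apply: measurable_sum => i.
  by apply: measurable_funM; [exact: mc (f_smooth i)|exact: mP].
apply: measurable_sum => j.
by apply: measurable_funM; [exact: mc (ts_diffusion sigma_smooth i j)|exact: mP].
Qed.

Lemma regular_iter j psi : torus_smooth psi -> regular (fun x => iter j (frozen x) psi).
Proof.
move=> tp; elim: j => [|j IH]; first exact: regular_cst.
exact: regular_frozen IH.
Qed.

End FrozenFamilies.

Section Displacement.
Context {R : realType} {d m : nat}.
Implicit Types (chi : 'rV[R]_d -> R) (z u S : 'rV[R]_d).

Lemma dir_dir S chi z : torus_smooth chi ->
  dir S (dir S chi) z = \sum_i \sum_j S 0 i * S 0 j * partial i (partial j chi) z.
Proof.
move=> tc; rewrite /dir; apply: eq_bigr => i _.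
have tp j : torus_smooth (fun y => S 0 j * partial j chi y) := tsZ _ (ts_partial j tc).
have -> : partial i (fun y => \sum_j S 0 j * partial j chi y) z =
    \sum_j S 0 j * partial i (partial j chi) z.
  rewrite -[LHS]/(D [:: i] _ z) (D_sum _ _ tp); apply: eq_bigr => j _.
  by rewrite (DZ _ _ (ts_smooth (ts_partial j tc))).
by rewrite mulr_sumr; apply: eq_bigr => j _; rewrite mulrA.
Qed.

Lemma dir_scale h u chi z : dir (h *: u) chi z = h * dir u chi z.
Proof. by rewrite /dir mulr_sumr; apply: eq_bigr => i _; rewrite mxE mulrA. Qed.

Lemma norm1_scale h u : 0 <= h -> norm1 (h *: u) = h * norm1 u.
Proof.
move=> h0; rewrite /norm1 mulr_sumr; apply: eq_bigr => i _.
by rewrite mxE normrM (ger0_norm h0).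
Qed.

Lemma displacement_taylor1 h u chi z M : 0 <= h -> torus_smooth chi -> bd 1 chi M ->
  `|chi (z + h *: u) - chi z| <= h * (norm1 u * M).
Proof.
move=> h0 tc hc; have := space_taylor z (h *: u) tc hc.
by rewrite big_ord1 /= !fact0 !divr1 expr1 (norm1_scale _ h0) mulrA.
Qed.

Lemma displacement_taylor2 h u chi z M : 0 <= h -> torus_smooth chi -> bd 2 chi M ->
  `|chi (z + h *: u) - chi z - h * dir u chi z| <= h ^+ 2 * (norm1 u ^+ 2 * M / 2).
Proof.
move=> h0 tc hc; have := space_taylor z (h *: u) tc hc.
rewrite !big_ord_recr big_ord0 /= add0r fact0 factS fact0 muln1 !divr1 opprD addrA.
by rewrite dir_scale (norm1_scale _ h0) exprMn !mulrA.
Qed.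

Lemma displacement_taylor3 S chi z M : torus_smooth chi -> bd 3 chi M ->
  `|chi (z + S) - chi z - (dir S chi z + 2^-1 * dir S (dir S chi) z)| <= norm1 S ^+ 3 * M.
Proof.
move=> tc hc; apply: le_trans (_ : norm1 S ^+ 3 * M / 3`!%:R <= _); last first.
  have M0 := bd_ge0 hc.
  rewrite ler_pdivrMr ?ltr0n// ler_peMr ?mulr_ge0 ?exprn_ge0 ?norm1_ge0//.
  by rewrite ler1n.
have := space_taylor z S tc hc.
rewrite !big_ord_recr big_ord0 /= add0r fact0 (_ : 1`! = 1)%N// (_ : 2`! = 2)%N// !divr1.
by congr (`|_| <= _); lra.
Qed.

Variable sigma : 'rV[R]_d -> 'M[R]_(d, m).

Definition noise_vector (x : 'rV[R]_d) (c : 'I_m -> R) : 'rV[R]_d :=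
  \row_i \sum_l sigma x i l * c l.

Lemma dir_noise x c chi z : dir (noise_vector x c) chi z =
  \sum_l (\sum_i sigma x i l * partial i chi z) * c l.
Proof.
rewrite /dir; under eq_bigr => i _ do rewrite mxE mulr_suml.
rewrite exchange_big /=; apply: eq_bigr => l _; rewrite mulr_suml.
by apply: eq_bigr => i _; rewrite mulrAC.
Qed.

Lemma dir_dir_noise x c chi z : torus_smooth chi ->
  2^-1 * dir (noise_vector x c) (dir (noise_vector x c) chi) z =
  \sum_l \sum_k (2^-1 * \sum_i \sum_j sigma x i l * sigma x j k *
    partial i (partial j chi) z) * (c l * c k).
Proof.
move=> tc; rewrite (dir_dir _ _ tc).
have -> : \sum_i \sum_j noise_vector x c 0 i * noise_vector x c 0 j *
      partial i (partial j chi) z =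
    \sum_i \sum_j \sum_l \sum_k sigma x i l * sigma x j k * partial i (partial j chi) z *
      (c l * c k).
  apply: eq_bigr => i _; apply: eq_bigr => j _; rewrite !mxE big_distrlr mulr_suml.
  by apply: eq_bigr => l _; rewrite mulr_suml; apply: eq_bigr => k _ /=; ring.
under eq_bigr => i _ do rewrite exchange_big.
rewrite exchange_big mulr_sumr; apply: eq_bigr => l _.
under eq_bigr => i _ do rewrite exchange_big.
rewrite exchange_big mulr_sumr; apply: eq_bigr => k _ /=.
rewrite -mulrA; congr (_ * _); rewrite mulr_suml; apply: eq_bigr => i _.
by rewrite mulr_suml.
Qed.

(** The diagonal part of the second-order noise term is the second-order part of the generator. *)
Lemma noise_trace x chi z :
  \sum_l 2^-1 * \sum_i \sum_j sigma x i l * sigma x j l * partial i (partial j chi) z =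
  \sum_i \sum_j diffusion sigma x i j * partial i (partial j chi) z.
Proof.
rewrite -mulr_sumr exchange_big mulr_sumr; apply: eq_bigr => i _ /=.
rewrite exchange_big mulr_sumr; apply: eq_bigr => j _ /=.
by rewrite -mulr_suml mulrA.
Qed.

Lemma norm1_noise x c C : (forall l, \sum_i `|sigma x i l| <= C) ->
  norm1 (noise_vector x c) <= C * \sum_l `|c l|.
Proof.
move=> HC; rewrite /norm1 mulr_sumr.
apply: (@le_trans _ _ (\sum_i \sum_l `|sigma x i l| * `|c l|)).
  apply: ler_sum => i _; rewrite mxE; apply: le_trans (ler_norm_sum _ _ _) _.
  by apply: ler_sum => l _; rewrite normrM.
rewrite exchange_big; apply: ler_sum => l _ /=.
by rewrite -mulr_suml ler_wpM2r.
Qed.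

End Displacement.

Lemma sum_sqr_le {R : realType} (m : nat) (a : 'I_m -> R) :
  (\sum_l a l) ^+ 2 <= m%:R * \sum_l a l ^+ 2.
Proof.
have : 0 <= \sum_l \sum_k (a l - a k) ^+ 2.
  by apply: sumr_ge0 => l _; apply: sumr_ge0 => k _; exact: sqr_ge0.
have -> : \sum_l \sum_k (a l - a k) ^+ 2 =
    2 * (m%:R * \sum_l a l ^+ 2 - (\sum_l a l) ^+ 2).
  have -> : (\sum_l a l) ^+ 2 = \sum_l \sum_k a l * a k by rewrite expr2 big_distrlr.
  have -> : \sum_l \sum_k (a l - a k) ^+ 2 =
      \sum_l \sum_(k < m) a l ^+ 2 + \sum_(l < m) \sum_k a k ^+ 2 - 2 * \sum_l \sum_k a l * a k.
    rewrite -big_split mulr_sumr -sumrB; apply: eq_bigr => l _ /=.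
    rewrite -big_split mulr_sumr -sumrB; apply: eq_bigr => k _ /=; ring.
  have E : \sum_(l < m) \sum_k a k ^+ 2 = m%:R * \sum_l a l ^+ 2.
    by rewrite sumr_const card_ord mulr_natl.
  by rewrite exchange_big E; ring.
by rewrite pmulr_rge0// subr_ge0.
Qed.

(* AM-GM, up to the factor 1/2. *)
Lemma cube_le {R : realType} (a q : R) : 0 < a -> 0 <= q ->
  q ^+ 3 <= a * q ^+ 2 + a^-1 * q ^+ 4.
Proof.
move=> a0 q0; rewrite -subr_ge0.
have -> : a * q ^+ 2 + a^-1 * q ^+ 4 - q ^+ 3 =
    a^-1 * (q ^+ 2 * ((q - a / 2) ^+ 2 + 3 / 4 * a ^+ 2)) by field; rewrite gt_eqF.
apply: mulr_ge0; first by rewrite invr_ge0 ltW.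
apply: mulr_ge0; first exact: sqr_ge0.
apply: addr_ge0; first exact: sqr_ge0.
by apply: mulr_ge0; [lra|exact: sqr_ge0].
Qed.

Lemma step_combine {R : realType} (a b c l e g u B1 B2 B3 : R) :
  `|a - b - u * e| <= B1 -> `|b - c - u * l| <= B2 -> `|e - g| <= B3 -> 0 <= u ->
  `|a - c - u * (l + g)| <= B1 + B2 + u * B3.
Proof.
move=> h1 h2 h3 u0.
have -> : a - c - u * (l + g) = (a - b - u * e) + (b - c - u * l) + u * (e - g) by ring.
apply: le_trans (ler_normD _ _) _; apply: lerD.
  by apply: le_trans (ler_normD _ _) _; apply: lerD.
by rewrite normrM (ger0_norm u0) ler_wpM2l.
Qed.

Section FrozenEvolution.
Context {dsp : measure_display} {Omega : measurableType dsp} {R : realType} {d m : nat}.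
Variables (P : probability Omega R) (F : R -> set (set Omega)).
Variable W : 'I_m -> R -> Omega -> R.
Hypotheses (HF : is_filtration F) (HW : is_wiener P F W).
Local Notation adapted := (adapted F).
Local Notation Z := (increment W).
Local Notation E := (Ex P).

Lemma adapted_cst t c : 0 <= t -> adapted t (cst c).
Proof. by move=> t0; apply/(adaptedP HF) => //; exact: measurable_cst. Qed.

Lemma adaptedD t U V : 0 <= t -> adapted t U -> adapted t V ->
  adapted t (fun w => U w + V w).
Proof.
by move=> t0 aU aV; apply/(adaptedP HF) => //; apply: measurable_funD; exact/(adaptedP HF).
Qed.

Lemma adaptedM t U V : 0 <= t -> adapted t U -> adapted t V ->
  adapted t (fun w => U w * V w).
Proof.
by move=> t0 aU aV; apply/(adaptedP HF) => //; apply: measurable_funM; exact/(adaptedP HF).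
Qed.

Lemma adaptedZ t c U : 0 <= t -> adapted t U -> adapted t (fun w => c * U w).
Proof. by move=> t0; apply: adaptedM => //; exact: adapted_cst. Qed.

Lemma adapted_sum (I : Type) (r : seq I) t (U : I -> Omega -> R) : 0 <= t ->
  (forall i, adapted t (U i)) -> adapted t (fun w => \sum_(i <- r) U i w).
Proof.
move=> t0 aU; apply/(adaptedP HF) => //; apply: measurable_sum => i; exact/(adaptedP HF).
Qed.

Lemma noise_quadratic s h (U : 'I_m -> Omega -> R) (V : 'I_m -> 'I_m -> Omega -> R) :
  0 <= s -> 0 < h ->
  (forall l, adapted s (U l) /\ summable P (U l)) ->
  (forall l k, adapted s (V l k) /\ summable P (V l k)) ->
  let Q w := \sum_l U l w * Z l s h w + \sum_l \sum_k V l k w * (Z l s h w * Z k s h w) in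
  summable P Q /\ E Q = h * \sum_l E (V l l).
Proof.
move=> s0 h0 HU HV Q.
have HU1 l := noise_mean HF HW s0 h0 l (HU l).1 (HU l).2.
have HV1 l k := noise_cov HF HW s0 h0 l k (HV l k).1 (HV l k).2.
have i1 := summable_sum (index_enum 'I_m) (fun l => (HU1 l).1).
have i2 l := summable_sum (index_enum 'I_m) (fun k => (HV1 l k).1).
have i3 := summable_sum (index_enum 'I_m) i2.
split; first exact: summableD i1 i3.
rewrite /Q (ExD i1 i3) (Ex_sum _ (fun l => (HU1 l).1)) (Ex_sum _ i2) big1 ?add0r; last first.
  by move=> l _; rewrite (HU1 l).2.
rewrite mulr_sumr; apply: eq_bigr => l _; rewrite (Ex_sum _ (fun k => (HV1 l k).1)).
rewrite (bigD1 l)//= (HV1 l l).2 eqxx mul1r big1 ?addr0// => k kl.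
by rewrite (HV1 l k).2 eq_sym (negbTE kl) !mul0r.
Qed.

(** m^2 comes from the second moments and 3 m^4 from the fourth moments in the majorant of
    [noise_cubic]. *)
Definition noise_const : R := m%:R ^+ 2 + 3 * m%:R ^+ 4.

(** The cube is dominated by sqrt(h) q^2 + q^4 / sqrt(h), both terms being of order h^(3/2) in mean,
    so only even moments are needed. *)
Lemma noise_cubic s h : 0 <= s -> 0 < h -> exists B : Omega -> R,
  [/\ summable P B, forall w, (\sum_l `|Z l s h w|) ^+ 3 <= B w &
      E B = noise_const * (h * Num.sqrt h)].
Proof.
move=> s0 h0; have c1 : adapted s (cst 1) by exact: adapted_cst.
have b1 : summable P (cst 1).
  by apply: (@bounded_summable _ _ _ _ _ 1) => [|w]; [exact: measurable_cst|rewrite normr1].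
have sd0 : 0 < Num.sqrt h by rewrite sqrtr_gt0.
have H2 l : summable P (fun w => Z l s h w ^+ 2) /\ E (fun w => Z l s h w ^+ 2) = h.
  have := noise_cov HF HW s0 h0 l l c1 b1; rewrite Ex_cst eqxx mulr1 mul1r.
  by under eq_fun do rewrite mul1r -expr2.
have H4 l := noise_pow4 HF HW s0 h0 l.
pose B2 w := \sum_l Z l s h w ^+ 2; pose B4 w := \sum_l Z l s h w ^+ 4.
have i2 : summable P B2 by exact: summable_sum (fun l => (H2 l).1).
have i4 : summable P B4 by exact: summable_sum (fun l => (H4 l).1).
exists (fun w => Num.sqrt h * m%:R * B2 w + (Num.sqrt h)^-1 * m%:R ^+ 3 * B4 w); split.
- exact: summableD (summableZ _ i2) (summableZ _ i4).
- move=> w; set q := \sum_l _; have q0 : 0 <= q by exact: sumr_ge0.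
  have q2 : q ^+ 2 <= m%:R * B2 w.
    apply: le_trans (sum_sqr_le _) _; rewrite ler_wpM2l//; apply: ler_sum => l _.
    by rewrite real_normK ?num_real.
  have q4 : q ^+ 4 <= m%:R ^+ 3 * B4 w.
    rewrite -[4%N]/((2 * 2)%N) exprM; apply: (@le_trans _ _ ((m%:R * B2 w) ^+ 2)).
      by have := ler_pM (sqr_ge0 q) (sqr_ge0 q) q2 q2; rewrite -!expr2.
    rewrite exprMn [_ ^+ 3]exprSr -mulrA ler_wpM2l ?sqr_ge0//.
    apply: le_trans (sum_sqr_le _) _; rewrite ler_wpM2l//; apply: ler_sum => l _.
    by rewrite -exprM.
  apply: le_trans (cube_le sd0 q0) _; rewrite -[Num.sqrt h * _ * _]mulrA -[_^-1 * _ * _]mulrA.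
  by apply: lerD; rewrite ler_wpM2l// ?invr_ge0 ltW.
- rewrite (ExD (summableZ _ i2) (summableZ _ i4)) (ExZ _ i2) (ExZ _ i4).
  rewrite (Ex_sum _ (fun l => (H2 l).1)) (Ex_sum _ (fun l => (H4 l).1)).
  under eq_bigr => l _ do rewrite (H2 l).2.
  under [X in _ + _ * X]eq_bigr => l _ do rewrite (H4 l).2.
  rewrite !sumr_const card_ord -[h *+ m]mulr_natl -[_ * _ *+ m]mulr_natl /noise_const.
  have hE : h = Num.sqrt h ^+ 2 by rewrite sqr_sqrtr// ltW.
  by move: hE sd0; move: (Num.sqrt h) => a -> a0; field; rewrite gt_eqF.
Qed.

Variables (f : 'rV[R]_d -> 'rV[R]_d) (sigma : 'rV[R]_d -> 'M[R]_(d, m)).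
Hypothesis f_smooth : forall i, torus_smooth (fun x => f x 0 i).
Hypothesis sigma_smooth : forall i l, torus_smooth (fun x => sigma x i l).
Local Notation frozen := (frozen_generator f sigma).

Definition vadapted t (X : Omega -> 'rV[R]_d) : Prop :=
  forall i, adapted t (fun w => X w 0 i).

Lemma vadapted_le s t X : 0 <= s -> s <= t -> vadapted s X -> vadapted t X.
Proof. by move=> s0 st aX i; exact: (adapted_le HF s0 st (aX i)). Qed.

Lemma adapted_coef t X (c : 'rV[R]_d -> R) : 0 <= t -> vadapted t X -> torus_smooth c ->
  adapted t (fun w => c (X w)).
Proof.
move=> t0 aX tc; exact: (adapted_continuous HF t0 (smooth_continuous (ts_smooth tc)) aX).
Qed.

Lemma adapted_regular Psi s t X Y : regular Psi -> 0 <= t -> vadapted t X -> vadapted t Y ->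
  adapted t (fun w => D s (Psi (X w)) (Y w)).
Proof.
move=> [_ _ mP] t0 aX aY; apply/(adaptedP HF) => //.
by apply: (mP s _ (g_sigma_algebraType (F t))) => i; exact/(adaptedP HF).
Qed.

Lemma summable_adapted t U C : 0 <= t -> adapted t U -> (forall w, `|U w| <= C) ->
  summable P U.
Proof. by move=> t0 aU; apply: bounded_summable; exact: (adapted_measurable HF t0 aU). Qed.

Lemma summable_regular Psi s t X Y : regular Psi -> 0 <= t -> vadapted t X -> vadapted t Y ->
  summable P (fun w => D s (Psi (X w)) (Y w)).
Proof.
move=> rP t0 aX aY; have [_ /(_ (size s))[M HM] _] := rP.
apply: (summable_adapted t0 (adapted_regular s rP t0 aX aY)) => w.
exact: (HM (X w) s (Y w) (leqnn _)).
Qed.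

Definition frozen_move (x y : 'rV[R]_d) h (c : 'I_m -> R) : 'rV[R]_d :=
  y + h *: f x + noise_vector sigma x c.

Lemma vadapted_drift t h X Y : 0 <= t -> vadapted t X -> vadapted t Y ->
  vadapted t (fun w => Y w + h *: f (X w)).
Proof.
move=> t0 aX aY i.
have := adaptedD t0 (aY i) (adaptedZ h t0 (adapted_coef t0 aX (f_smooth i))).
by congr adapted; apply/funext => w; rewrite !mxE.
Qed.

Lemma vadapted_move s h X Y : 0 <= s -> 0 <= h -> vadapted s X -> vadapted s Y ->
  vadapted (s + h) (fun w => frozen_move (X w) (Y w) h (fun l => Z l s h w)).
Proof.
move=> s0 h0 aX aY i; have sh0 := addr_ge0 s0 h0.
have le_s : s <= s + h by rewrite lerDl.
have aX' := vadapted_le s0 le_s aX; have aY' := vadapted_le s0 le_s aY.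
have aS l := adaptedM sh0 (adapted_coef sh0 aX' (sigma_smooth i l))
  (adapted_increment HF HW l s0 h0).
have := adaptedD sh0 (vadapted_drift h sh0 aX' aY' i) (adapted_sum (index_enum 'I_m) sh0 aS).
by congr adapted; apply/funext => w; rewrite /frozen_move [RHS]mxE; congr (_ + _); rewrite mxE.
Qed.

(** The move is split into drift, from Y to Y1, and noise, from Y1 on. The three constants bound the
    third-order noise remainder, the second-order drift remainder, and the shift of the second-order
    part of the generator from Y1 back to Y. *)
Lemma frozen_increment Psi : regular Psi -> exists2 C, 0 <= C & forall s h X Y,
  0 <= s -> 0 < h -> h <= 1 -> vadapted s X -> vadapted s Y ->
  `|E (fun w => Psi (X w) (frozen_move (X w) (Y w) h (fun l => Z l s h w))) -
    E (fun w => Psi (X w) (Y w)) - h * E (fun w => frozen (X w) (Psi (X w)) (Y w))|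
  <= C * (h * Num.sqrt h).
Proof.
move=> rP; have [tP /(_ 3)[M HM] _] := rP.
have [K K0 HK] := coefficient_bound f_smooth sigma_smooth.
have M0 : 0 <= M := bd_ge0 (HM 0).
have tpart i x : torus_smooth (partial i (Psi x)) := ts_partial i (tP x).
have bdM k x : (k <= 3)%N -> bd k (Psi x) M by move=> k3; exact: bdW k3 (lexx _) (HM x).
have nc0 : 0 <= noise_const :> R.
  by rewrite /noise_const addr_ge0 ?sqr_ge0// mulr_ge0// exprn_even_ge0.
exists (K ^+ 3 * M * noise_const + K ^+ 2 * M / 2 + K * (K * M)).
  by rewrite !addr_ge0// !mulr_ge0// ?exprn_ge0.
move=> s h X Y s0 h0 h1 aX aY.
have hs := ltW h0; have sh0 := addr_ge0 s0 hs; have le_s : s <= s + h by rewrite lerDl.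
pose Y1 w := Y w + h *: f (X w).
pose S w := noise_vector sigma (X w) (fun l => Z l s h w).
have aY1 : vadapted s Y1 := vadapted_drift h s0 aX aY.
have aX' := vadapted_le s0 le_s aX.
have aY2 : vadapted (s + h) (fun w => Y1 w + S w) := vadapted_move s0 hs aX aY.
pose U l w := \sum_i sigma (X w) i l * D [:: i] (Psi (X w)) (Y1 w).
pose V l k w := 2^-1 * \sum_i \sum_j sigma (X w) i l * sigma (X w) j k *
  D [:: i; j] (Psi (X w)) (Y1 w).
have absig x i l : `|sigma x i l| <= K.
  have [_ /(_ l) h2 _] := HK x; apply: le_trans h2.
  by rewrite (bigD1 i)//= lerDl sumr_ge0.
have HU l : adapted s (U l) /\ summable P (U l).
  have aU : adapted s (U l).
    apply: adapted_sum => // i; apply: adaptedM => //.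
      exact: (adapted_coef s0 aX (sigma_smooth i l)).
    exact: (adapted_regular [:: i] rP s0 aX aY1).
  split=> //; apply: (summable_adapted (C := \sum_(i < d) K * M) s0 aU) => w.
  apply: le_trans (ler_norm_sum _ _ _) _; apply: ler_sum => i _; rewrite normrM.
  by apply: ler_pM => //; exact: HM.
have HV l k : adapted s (V l k) /\ summable P (V l k).
  have aV : adapted s (V l k).
    apply: adaptedZ => //; apply: adapted_sum => // i; apply: adapted_sum => // j.
    apply: adaptedM => //; last exact: (adapted_regular [:: i; j] rP s0 aX aY1).
    apply: adaptedM => //; first exact: (adapted_coef s0 aX (sigma_smooth i l)).
    exact: (adapted_coef s0 aX (sigma_smooth j k)).
  split=> //; apply: (summable_adapted (C := 2^-1 * \sum_(i < d) \sum_(j < d) K * K * M) s0 aV) => w.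
  rewrite normrM ger0_norm ?invr_ge0// ler_wpM2l ?invr_ge0//.
  apply: le_trans (ler_norm_sum _ _ _) _; apply: ler_sum => i _.
  apply: le_trans (ler_norm_sum _ _ _) _; apply: ler_sum => j _; rewrite !normrM.
  by apply: ler_pM => //; [apply: ler_pM|exact: HM].
have [iQ EQ] := noise_quadratic s0 h0 HU HV; set Q := (fun w => _) in iQ EQ.
pose G Y' w := \sum_i \sum_j diffusion sigma (X w) i j * D [:: i; j] (Psi (X w)) (Y' w).
pose A w := \sum_i f (X w) 0 i * D [:: i] (Psi (X w)) (Y w).
have iG Y' : vadapted s Y' -> summable P (G Y').
  move=> aY'; have aG : adapted s (G Y').
    apply: adapted_sum => // i; apply: adapted_sum => // j; apply: adaptedM => //.
      exact: (adapted_coef s0 aX (ts_diffusion sigma_smooth i j)).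
    exact: (adapted_regular [:: i; j] rP s0 aX aY').
  apply: (summable_adapted (C := K * M) s0 aG) => w; have [_ _ h3] := HK (X w).
  apply: (@le_trans _ _ ((\sum_i \sum_j `|diffusion sigma (X w) i j|) * M)); last by rewrite ler_wpM2r.
  rewrite mulr_suml; apply: le_trans (ler_norm_sum _ _ _) _; apply: ler_sum => i _.
  rewrite mulr_suml; apply: le_trans (ler_norm_sum _ _ _) _; apply: ler_sum => j _.
  by rewrite normrM ler_wpM2l//; exact: HM.
have iA : summable P A.
  have aA : adapted s A.
    apply: adapted_sum => // i; apply: adaptedM => //.
      exact: (adapted_coef s0 aX (f_smooth i)).
    exact: (adapted_regular [:: i] rP s0 aX aY).
  apply: (summable_adapted (C := K * M) s0 aA) => w; have [h1' _ _] := HK (X w).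
  apply: (@le_trans _ _ (norm1 (f (X w)) * M)); last by rewrite ler_wpM2r.
  rewrite mulr_suml; apply: le_trans (ler_norm_sum _ _ _) _; apply: ler_sum => i _.
  by rewrite normrM ler_wpM2l//; exact: HM.
have i0 : summable P (fun w => Psi (X w) (Y w)) := summable_regular [::] rP s0 aX aY.
have i1 : summable P (fun w => Psi (X w) (Y1 w)) := summable_regular [::] rP s0 aX aY1.
have i2 : summable P (fun w => Psi (X w) (Y1 w + S w)) :=
  summable_regular [::] rP sh0 aX' aY2.
have EV : \sum_l E (V l l) = E (G Y1).
  rewrite -(Ex_sum _ (fun l => (HV l l).2)); congr (E _); apply/funext => w.
  exact: noise_trace.
have [B [iB HB EB]] := noise_cubic s0 h0.
have T1 : `|E (fun w => Psi (X w) (Y1 w + S w)) - E (fun w => Psi (X w) (Y1 w)) - h * E (G Y1)|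
    <= K ^+ 3 * M * noise_const * (h * Num.sqrt h).
  rewrite -EV -EQ -(ExB i2 i1) -(ExB (summableB i2 i1) iQ) -[leRHS]mulrA -EB -(ExZ _ iB).
  apply: Ex_norm_le (summableB (summableB i2 i1) iQ) (summableZ _ iB) _ => w.
  have QE : Q w = dir (S w) (Psi (X w)) (Y1 w) +
      2^-1 * dir (S w) (dir (S w) (Psi (X w))) (Y1 w).
    by rewrite (dir_dir_noise _ _ _ _ (tP (X w))) dir_noise.
  rewrite QE; apply: le_trans (displacement_taylor3 _ _ (tP _) (HM _)) _.
  rewrite [leRHS]mulrAC ler_wpM2r//; have [_ h2 _] := HK (X w).
  apply: (@le_trans _ _ ((K * \sum_l `|Z l s h w|) ^+ 3)).
    by rewrite lerXn2r ?nnegrE ?norm1_ge0 ?mulr_ge0 ?sumr_ge0//; exact: norm1_noise.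
  by rewrite exprMn ler_wpM2l ?exprn_ge0.
have T2 : `|E (fun w => Psi (X w) (Y1 w)) - E (fun w => Psi (X w) (Y w)) - h * E A|
    <= h ^+ 2 * (K ^+ 2 * M / 2).
  rewrite -(ExZ _ iA) -(ExB i1 i0) -(ExB (summableB i1 i0) (summableZ _ iA)).
  apply: Ex_bound (summableB (summableB i1 i0) (summableZ _ iA)) _ => w.
  apply: le_trans (displacement_taylor2 (f (X w)) (Y w) hs (tP _) (bdM 2 _ isT)) _.
  rewrite ler_wpM2l ?sqr_ge0// ler_wpM2r ?invr_ge0// ler_wpM2r//.
  by rewrite lerXn2r ?nnegrE ?norm1_ge0//; have [] := HK (X w).
have T3 : `|E (G Y1) - E (G Y)| <= h * (K * (K * M)).
  rewrite -(ExB (iG _ aY1) (iG _ aY)); apply: Ex_bound (summableB (iG _ aY1) (iG _ aY)) _ => w.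
  have [hf _ h3] := HK (X w).
  rewrite /G -sumrB; apply: (@le_trans _ _ ((\sum_i \sum_j `|diffusion sigma (X w) i j|) * (h * (K * M)))).
    rewrite mulr_suml; apply: le_trans (ler_norm_sum _ _ _) _; apply: ler_sum => i _.
    rewrite -sumrB mulr_suml; apply: le_trans (ler_norm_sum _ _ _) _; apply: ler_sum => j _.
    rewrite -mulrBr normrM ler_wpM2l//.
    apply: le_trans (displacement_taylor1 (M := M) (f (X w)) (Y w) hs (ts_D [:: i; j] (tP _)) _) _.
      by apply: bd_D; exact: HM.
    by rewrite ler_wpM2l// ler_wpM2r.
  by rewrite [leRHS]mulrCA ler_wpM2r// !mulr_ge0.
have -> : E (fun w => frozen (X w) (Psi (X w)) (Y w)) = E A + E (G Y).
  by rewrite -(ExD iA (iG _ aY)).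
have h2 : h ^+ 2 <= h * Num.sqrt h.
  by have := @sqr_le_modulus R h; rewrite (gtr0_norm h0) => /(_ h1).
apply: le_trans (step_combine T1 T2 T3 hs) _.
rewrite !mulrDl; apply: lerD; first apply: lerD => //.
  by rewrite mulrC ler_wpM2l// !mulr_ge0 ?exprn_ge0.
by rewrite [leLHS]mulrA -expr2 [leLHS]mulrC ler_wpM2l// !mulr_ge0.
Qed.

End FrozenEvolution.

(** * Expansion of one Euler step *)

(* A two-sided derivative from a one-sided expansion: the expansion at x - h
   is used for the left difference quotient. *)
Lemma is_derive_right_modulus {R : realType} (g g' : R -> R) (C B x : R) : 0 < x ->
  (forall r h, 0 <= r -> 0 < h -> h <= 1 ->
    `|g (r + h) - g r - h * g' r| <= C * (h * Num.sqrt h)) ->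
  (forall r h, 0 <= r -> 0 < h -> h <= 1 -> `|g' (r + h) - g' r| <= B * h) ->
  is_derive x 1 g (g' x).
Proof.
move=> x0 Hg Hg'.
have C0 : 0 <= C.
  have := Hg 0 1 (lexx _) ltr01 (lexx _); rewrite sqrtr1 !mulr1.
  exact: le_trans.
have B0 : 0 <= B.
  by have := Hg' 0 1 (lexx _) ltr01 (lexx _); rewrite mulr1; exact: le_trans.
apply: (@is_derive_modulus _ _ _ _ _ _ (C + B) (Num.min 1 x)).
  by rewrite lt_min ltr01.
move=> h; rewrite le_min => /andP[h1 hx].
have -> : h *: (1 : R^o) = h by exact: mulr1.
have [h0|h0|->] := ltgtP h 0; last first.
- by rewrite addr0 subrr mul0r subr0 normr0 mul0r mulr0.
- rewrite (gtr0_norm h0) in h1 *.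
  apply: le_trans (Hg x h (ltW x0) h0 h1) _.
  by rewrite ler_wpM2r ?mulr_ge0 ?sqrtr_ge0 ?(ltW h0)// lerDl.
have k0 : 0 < - h by rewrite oppr_gt0.
move: h1 hx; rewrite (ltr0_norm h0); move: k0; set k := - h => k0 k1 kx.
have hk : h = - k by rewrite /k opprK.
have r0 : 0 <= x - k by rewrite subr_ge0.
have H1 := Hg (x - k) k r0 k0 k1; have H2 := Hg' (x - k) k r0 k0 k1.
rewrite !subrK in H1 H2; rewrite hk.
have -> : g (x - k) - g x - - k * g' x =
  - (g x - g (x - k) - k * g' (x - k)) + k * (g' x - g' (x - k)) by ring.
apply: le_trans (ler_normD _ _) _; rewrite normrN mulrDl; apply: lerD => //.
rewrite normrM (gtr0_norm k0).
apply: (@le_trans _ _ (k * (B * k))); first by rewrite ler_pM2l.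
have := @sqr_le_modulus R k; rewrite (gtr0_norm k0) => /(_ k1) h2.
by rewrite mulrCA -expr2 ler_wpM2l.
Qed.

(** A right increment of length at most 1 is controlled by K, and a longer one by the bound 2G,
    since 2G <= 2G h for h > 1; constancy on r <= 0 settles the other side of 0. *)
Lemma continuous_right_lipschitz {R : realType} (g : R -> R) (K G : R) :
  (forall r, `|g r| <= G) -> (forall r, r <= 0 -> g r = g 0) ->
  (forall r h, 0 <= r -> 0 < h -> h <= 1 -> `|g (r + h) - g r| <= K * h) ->
  continuous g.
Proof.
move=> HG g0 HK.
have K0 : 0 <= K.
  by have := HK 0 1 (lexx _) ltr01 (lexx _); rewrite mulr1; exact: le_trans.
have G0 : 0 <= G by exact: le_trans (HG 0).
have H r s : 0 <= r -> r <= s -> `|g s - g r| <= (K + G + G) * (s - r).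
  move=> r0; rewrite le_eqVlt => /predU1P[<-|rs]; first by rewrite !subrr normr0 mulr0.
  have h0 : 0 < s - r by rewrite subr_gt0.
  have [h1|h1] := leP (s - r) 1.
    have := HK r (s - r) r0 h0 h1; rewrite [r + _]addrC subrK => /le_trans; apply.
    by rewrite ler_pM2r// -addrA lerDl addr_ge0.
  apply: (@le_trans _ _ (G + G)).
    by apply: le_trans (ler_normB _ _) _; exact: lerD.
  apply: (@le_trans _ _ (K + G + G)); first by rewrite -addrA lerDr.
  by rewrite ler_peMr ?(ltW h1)//; exact: addr_ge0 (addr_ge0 K0 G0) G0.
have Hm r s : r <= s -> `|g s - g r| <= (K + G + G) * (s - r).
  move=> rs; have [r0|r0] := leP 0 r; first exact: H.
  have [s0|s0] := leP 0 s.
    rewrite (g0 r (ltW r0)); apply: le_trans (H 0 s (lexx _) s0) _.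
    by rewrite ler_wpM2l ?addr_ge0// lerB// ltW.
  rewrite (g0 r (ltW r0)) (g0 s (ltW s0)) subrr normr0 mulr_ge0 ?subr_ge0//.
  by rewrite !addr_ge0.
apply: (@lipschitz_continuous R R^o R^o g (K + G + G)) => s t.
have [st|/ltW ts] := leP s t.
  by rewrite distrC [X in _ * X]distrC (ger0_norm (_ : 0 <= t - s)) ?subr_ge0//; exact: Hm.
by rewrite [X in _ * X]ger0_norm ?subr_ge0//; exact: Hm.
Qed.

Section OneStepExpansion.
Context {dsp : measure_display} {Omega : measurableType dsp} {R : realType} {d m : nat}.
Variables (P : probability Omega R) (F : R -> set (set Omega)).
Variable W : 'I_m -> R -> Omega -> R.
Hypotheses (HF : is_filtration F) (HW : is_wiener P F W).
Variables (f : 'rV[R]_d -> 'rV[R]_d) (sigma : 'rV[R]_d -> 'M[R]_(d, m)).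
Hypothesis f_smooth : forall i, torus_smooth (fun x => f x 0 i).
Hypothesis sigma_smooth : forall i l, torus_smooth (fun x => sigma x i l).
Local Notation frozen := (frozen_generator f sigma).
Local Notation vadapted := (vadapted F).
Local Notation Z := (increment W).
Local Notation E := (Ex P).

(** Interpolates one Euler step in time, with coefficients frozen at X. *)
Definition flow (X : Omega -> 'rV[R]_d) s r w : 'rV[R]_d :=
  frozen_move f sigma (X w) (X w) r (fun l => Z l s r w).

Lemma flow0 X s : flow X s 0 = X.
Proof.
apply/funext => w; rewrite /flow /frozen_move scale0r addr0.
apply/rowP => i; rewrite !mxE big1 ?addr0// => l _.
by rewrite /increment addr0 subrr mulr0.
Qed.

(** As the freezing point remains X, displacements add up and the flow can be restarted at an
    intermediate time with the same frozen coefficients. *)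
Lemma flowD X s r h w :
  flow X s (r + h) w = frozen_move f sigma (X w) (flow X s r w) h (fun l => Z l (s + r) h w).
Proof.
apply/rowP => i; rewrite !mxE.
have -> : \sum_l sigma (X w) i l * Z l s (r + h) w =
    \sum_l sigma (X w) i l * Z l s r w + \sum_l sigma (X w) i l * Z l (s + r) h w.
  rewrite -big_split; apply: eq_bigr => l _ /=; rewrite -mulrDr; congr (_ * _).
  by rewrite /increment addrA; ring.
ring.
Qed.

Lemma vadapted_flow X s r : 0 <= s -> 0 <= r -> vadapted s X ->
  vadapted (s + r) (flow X s r).
Proof.
by move=> s0 r0 aX; exact: (vadapted_move HF HW f_smooth sigma_smooth s0 r0 aX aX).
Qed.

Lemma flow_modulus Psi X s : regular Psi -> 0 <= s -> vadapted s X ->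
  exists2 C, 0 <= C & forall r h, 0 <= r -> 0 < h -> h <= 1 ->
  `|E (fun w => Psi (X w) (flow X s (r + h) w)) - E (fun w => Psi (X w) (flow X s r w)) -
    h * E (fun w => frozen (X w) (Psi (X w)) (flow X s r w))| <= C * (h * Num.sqrt h).
Proof.
move=> rP s0 aX; have [C C0 HC] := frozen_increment HF HW f_smooth sigma_smooth rP.
exists C => // r h r0 h0 h1; have sr0 := addr_ge0 s0 r0.
have le_s : s <= s + r by rewrite lerDl.
have := HC (s + r) h X (flow X s r) sr0 h0 h1 (vadapted_le HF s0 le_s aX) (vadapted_flow s0 r0 aX).
by under [X in `|E X - _ - _|]eq_fun do rewrite -flowD.
Qed.

Lemma flow_summable Psi X s r : regular Psi -> 0 <= s -> 0 <= r -> vadapted s X ->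
  summable P (fun w => Psi (X w) (flow X s r w)).
Proof.
move=> rP s0 r0 aX; have sr0 := addr_ge0 s0 r0; have le_s : s <= s + r by rewrite lerDl.
exact (summable_regular P HF [::] rP sr0 (vadapted_le HF s0 le_s aX) (vadapted_flow s0 r0 aX)).
Qed.

Lemma flow_bounded Psi X s M : regular Psi -> 0 <= s -> vadapted s X ->
  (forall x, bd 0 (Psi x) M) ->
  forall r, 0 <= r -> `|E (fun w => Psi (X w) (flow X s r w))| <= M.
Proof.
move=> rP s0 aX HM r r0; apply: (Ex_bound (flow_summable rP s0 r0 aX)) => w.
exact: bd0 (HM (X w)).
Qed.

Lemma flow_lipschitz Psi X s : regular Psi -> 0 <= s -> vadapted s X ->
  exists2 K, 0 <= K & forall r h, 0 <= r -> 0 < h -> h <= 1 ->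
  `|E (fun w => Psi (X w) (flow X s (r + h) w)) - E (fun w => Psi (X w) (flow X s r w))|
    <= K * h.
Proof.
move=> rP s0 aX; have [C C0 HC] := flow_modulus rP s0 aX.
have rF := regular_frozen f_smooth sigma_smooth rP.
have [_ /(_ 0)[M HM] _] := rF; have M0 := bd_ge0 (HM 0).
exists (C + M); first exact: addr_ge0.
move=> r h r0 h0 h1; have := HC r h r0 h0 h1.
set a := E _; set b := E _; set c := E _ => Habc.
have Hc : `|c| <= M by exact: (flow_bounded rF s0 aX HM r0).
rewrite -[a - b](subrK (h * c)) mulrDl; apply: le_trans (ler_normD _ _) _; apply: lerD.
  apply: le_trans Habc _; rewrite ler_wpM2l// ger_pMr//.
  by rewrite -sqrtr1 ler_wsqrtr.
by rewrite normrM (gtr0_norm h0) mulrC ler_wpM2r// ltW.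
Qed.

Variable C : R.
Hypothesis C_bd : forall j k x chi M, torus_smooth chi ->
  bd (k + 2 * j) chi M -> bd k (iter j (frozen x) chi) (C ^+ j * M).

(** The constants of [flow_modulus] and [flow_lipschitz] serve only to justify differentiation; the
    final remainder uses nothing but the uniform bound [C_bd]. *)
Lemma one_step_bound K psi M s h X : torus_smooth psi -> bd (2 * K) psi M ->
  0 <= s -> 0 < h -> vadapted s X ->
  `|E (fun w => psi (flow X s h w)) - \sum_(k < K) h ^+ k * E (fun w => Aop f sigma k psi (X w))|
  <= C ^+ K * M * h ^+ K.
Proof.
move=> tp hp s0 h0 aX.
have rI k := regular_iter f_smooth sigma_smooth k tp.
pose g k r := E (fun w => iter k (frozen (X w)) psi (flow X s r w)).
(* Constant continuation to negative r makes the function continuous on the whole line;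
   differentiability is claimed for r > 0 only. *)
pose u k r := g k (Num.max 0 r).
have uE k r : 0 <= r -> u k r = g k r by move=> r0; rewrite /u max_r.
have u_mod k : exists2 c, 0 <= c & forall r h, 0 <= r -> 0 < h -> h <= 1 ->
    `|u k (r + h) - u k r - h * u k.+1 r| <= c * (h * Num.sqrt h).
  have [c c0 Hc] := flow_modulus (rI k) s0 aX; exists c; first exact: c0.
  move=> r k' r0 k0 k1; rewrite (uE k _ (addr_ge0 r0 (ltW k0))) (uE k r r0) (uE k.+1 r r0).
  exact: Hc r0 k0 k1.
have u_lip k : exists2 c, 0 <= c & forall r h, 0 <= r -> 0 < h -> h <= 1 ->
    `|u k (r + h) - u k r| <= c * h.
  have [c c0 Hc] := flow_lipschitz (rI k) s0 aX; exists c; first exact: c0.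
  move=> r k' r0 k0 k1; rewrite (uE k _ (addr_ge0 r0 (ltW k0))) (uE k r r0).
  exact: Hc r0 k0 k1.
have u_cont k : continuous (u k).
  have [c c0 Hc] := u_lip k; have [_ /(_ 0)[B HB] _] := rI k.
  apply: (continuous_right_lipschitz (G := B) _ _ Hc) => [r|r r0].
    by apply: (flow_bounded (rI k) s0 aX HB); rewrite le_max lexx.
  by rewrite /u max_l// maxxx.
have u_der k (x : R) : 0 < x -> is_derive x 1 (u k) (u k.+1 x).
  move=> x0; have [c _ Hc] := u_mod k; have [c' _ Hc'] := u_lip k.+1.
  exact: is_derive_right_modulus x0 Hc Hc'.
have HK x : bd 0 (iter K (frozen x) psi) (C ^+ K * M) by apply: C_bd.
have := @taylor_bound _ u K 0 h (C ^+ K * M) (ltW h0) _ _ _.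
rewrite (uE 0 h (ltW h0)) {1}/g /taylor_sum {2}/taylor_mono subr0.
have -> : \sum_(j < K) taylor_mono 0 j h * u j 0 =
    \sum_(k < K) h ^+ k * E (fun w => Aop f sigma k psi (X w)).
  apply: eq_bigr => k _; rewrite uE// /taylor_mono subr0 /g flow0 -mulrA; congr (_ * _).
  rewrite /Aop -ExZ//.
  by have := flow_summable (rI k) s0 (lexx 0) aX; rewrite flow0.
move=> H; apply: le_trans (H _ _ _) _.
- by move=> k _; apply: continuous_subspaceT; exact: u_cont.
- by move=> k x _; rewrite in_itv/= => /andP[x0 _]; exact: u_der.
- move=> x; rewrite in_itv/= => /andP[x0 _]; rewrite uE//.
  exact: (flow_bounded (rI K) s0 aX HK x0).
have CM0 : 0 <= C ^+ K * M := bd_ge0 (HK 0).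
rewrite ler_wpM2l// ler_pdivrMr ?ltr0n ?fact_gt0// ler_peMr ?exprn_ge0 ?(ltW h0)//.
by rewrite ler1n fact_gt0.
Qed.

Lemma euler_flow tau x n : 0 <= tau ->
  euler f sigma W tau x n.+1 = flow (euler f sigma W tau x n) (n%:R * tau) tau.
Proof.
move=> tau0; apply/funext => w; apply/rowP => i; rewrite !mxE; congr (_ + _).
apply: eq_bigr => l _; congr (_ * _); rewrite /increment.
by rewrite -[n.+1]addn1 natrD mulrDl mul1r.
Qed.

Lemma vadapted_euler tau x n : 0 < tau ->
  vadapted (n%:R * tau) (euler f sigma W tau x n).
Proof.
move=> tau0; elim: n => [|n IH].
  by move=> i; apply: (adapted_cst HF (x 0 i)); rewrite mul0r.
rewrite euler_flow ?ltW// -[n.+1]addn1 natrD mulrDl mul1r.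
exact: (vadapted_flow (mulr_ge0 (ler0n _ n) (ltW tau0)) (ltW tau0) IH).
Qed.

End OneStepExpansion.

(** * Local and global errors *)

(** Half of the exponential rate absorbs the polynomial, through t^i <= (i! / a^i) e^(a t). *)
Lemma poly_expR_bound {R : realType} (q : {poly R}) (a : R) : 0 < a ->
  exists2 K, 0 <= K & forall t, 0 <= t -> q.[t] * expR (- (a + a) * t) <= K * expR (- a * t).
Proof.
move=> a0; exists (\sum_(i < size q) `|q`_i| * (i`!%:R / a ^+ i)).
  apply: sumr_ge0 => i _; rewrite mulr_ge0// divr_ge0// exprn_ge0// ltW//.
move=> t t0.
have -> : expR (- (a + a) * t) = expR (- (a * t)) * expR (- a * t).
  by rewrite -expRD; congr expR; ring.
rewrite mulrA ler_wpM2r ?expR_ge0// horner_coef mulr_suml; apply: ler_sum => i _.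
have ai0 : 0 < a ^+ i by rewrite exprn_gt0.
apply: (@le_trans _ _ (`|q`_i| * (t ^+ i * expR (- (a * t))))).
  rewrite -mulrA; apply: le_trans (ler_norm _) _.
  rewrite normrM; apply: ler_wpM2l => //.
  by rewrite ger0_norm// mulr_ge0 ?exprn_ge0// expR_ge0.
apply: ler_wpM2l => //; rewrite expRN ler_pdivrMr ?expR_gt0// mulrAC ler_pdivlMr//.
rewrite -exprMn [t * a]mulrC; apply: pow_le_expR; exact: mulr_ge0 (ltW a0) t0.
Qed.

(** By induction the sum is at most (1/a + tau)(1 - e^(-a p tau)); the step reduces to 1 + a tau <=
    e^(a tau). The result behaves like the integral 1/a, uniformly in p. *)
Lemma geometric_expR_bound {R : realType} (a tau : R) p : 0 < a -> 0 < tau ->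
  \sum_(i < p) tau * expR (- a * (i%:R * tau)) <= a^-1 + tau.
Proof.
move=> a0 tau0; have c0 : 0 <= a^-1 + tau by rewrite addr_ge0 ?invr_ge0 ?(ltW a0) ?(ltW tau0).
apply: (@le_trans _ _ ((a^-1 + tau) * (1 - expR (- a * (p%:R * tau))))); last first.
  by rewrite ger_pMr ?(lt_le_trans tau0) ?lerDr ?invr_ge0 ?(ltW a0)// gerBl expR_ge0.
elim: p => [|p IH]; first by rewrite big_ord0 mul0r mulr0 expR0 subrr mulr0.
rewrite big_ord_recr /=; apply: le_trans (lerD IH (lexx _)) _.
have -> : expR (- a * (p.+1%:R * tau)) = expR (- a * (p%:R * tau)) * expR (- (a * tau)).
  by rewrite -expRD; congr expR; rewrite -[p.+1]addn1 natrD; ring.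
set r := expR (- a * _); set e := expR _.
have : tau <= (a^-1 + tau) * (1 - e).
  rewrite mulrBr mulr1 lerBrDr -lerBrDl addrK.
  have -> : a^-1 + tau = a^-1 * (1 + a * tau) by field; rewrite gt_eqF.
  rewrite -mulrA ger_pMr ?invr_gt0// /e expRN ler_pdivrMr ?expR_gt0// mul1r.
  exact: expR_ge1Dx.
move/(ler_wpM2r (expR_ge0 (- a * (p%:R * tau)))); rewrite -/r => H.
apply: le_trans (lerD (lexx _) H) _.
by rewrite [leLHS](_ : _ = (a^-1 + tau) * (1 - r * e))//; ring.
Qed.

Lemma sum_antidiagonal {V : zmodType} (G : nat -> nat -> V) N :
  \sum_(i < N.+1) \sum_(k < N.+1 - i) G i k = \sum_(n < N.+1) \sum_(k < n.+1) G (n - k)%N k.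
Proof.
elim: N => [|N IH]; first by rewrite !big_ord1.
rewrite [RHS]big_ord_recr /= -IH.
rewrite (eq_bigr (fun i : 'I_N.+2 => (if (i < N.+1)%N then \sum_(k < N.+1 - i) G i k else 0) +
    G i (N.+1 - i)%N)); last first.
  move=> i _; case: ifP => iN.
    by rewrite subSn ?(ltnW iN)// big_ord_recr.
  have -> : (i : nat) = N.+1 by apply/eqP; rewrite eqn_leq -ltnS ltn_ord leqNgt iN.
  by rewrite subSnn subnn add0r big_ord1.
rewrite big_split /=; congr (_ + _).
  rewrite big_ord_recr /= ltnn addr0; apply: eq_bigr => i _ /=.
  by rewrite ltn_ord.
rewrite (reindex_inj rev_ord_inj) /=; apply: eq_bigr => k _.
by rewrite subSS subKn// -ltnS.
Qed.

Section GlobalError.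
Context {R : realType} {d m : nat}.
Variables (f : 'rV[R]_d -> 'rV[R]_d) (sigma : 'rV[R]_d -> 'M[R]_(d, m)).
Hypothesis f_smooth : forall i, torus_smooth (fun x => f x 0 i).
Hypothesis sigma_smooth : forall i l, torus_smooth (fun x => sigma x i l).
Variables (rho : 'rV[R]_d -> R) (lambda : R).
Hypothesis H1 : invariant_density f sigma rho.
Hypothesis H3 : exponential_decay f sigma rho lambda.
Variable v : ('rV[R]_d -> R) -> nat -> R -> 'rV[R]_d -> R.
Hypothesis Hv : forall phi, torus_smooth phi -> is_expansion f sigma phi (v phi).
Variable mu : nat -> 'rV[R]_d -> R.
Hypothesis Hmu : is_measure_expansion f sigma rho mu.
Variable N : nat.
Local Notation Lc := (conv (Lop f sigma)).
Local Notation a := (lambda / 2).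
Implicit Types (phi : 'rV[R]_d -> R) (M tau t : R).

Let a0 : 0 < a. Proof. by rewrite divr_gt0// (lambda_gt0 H3). Qed.

Definition limit phi i : R := torus_int (fun y => phi y * mu i y).

Definition centered phi t i : 'rV[R]_d -> R := fun x => v phi i t x - limit phi i.

Lemma ts_centered phi t : torus_smooth phi -> 0 <= t -> ts_seq (centered phi t).
Proof.
move=> tp t0 i; exact: tsB (ts_expansion f_smooth sigma_smooth Hv i tp t0) (ts_cst _).
Qed.

(** Of the 4N + 2 derivatives, 4i are spent on the decay of v_i. The remaining 4(N - i) + 2 suffice
    for an expansion of order N + 1 - i, which takes 2(N + 1 - i). *)
Lemma centered_bound : exists2 K, 0 <= K & forall phi M t i, torus_smooth phi ->
  bd (4 * N + 2) phi M -> 0 <= t -> (i <= N)%N ->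
  bd (4 * (N - i) + 2) (centered phi t i) (K * expR (- a * t) * M).
Proof.
have decay i : exists K, 0 <= K /\ forall phi M t, torus_smooth phi ->
    bd (4 * N + 2) phi M -> 0 <= t -> (i <= N)%N ->
    bd (4 * (N - i) + 2) (centered phi t i) (K * expR (- a * t) * M).
  have [q nq Hq] := expansion_decay f_smooth sigma_smooth H1 H3 Hv Hmu i (4 * (N - i) + 2).
  have [K K0 HK] := poly_expR_bound q a0; exists K; split; first exact: K0.
  move=> phi M t tp hp t0 iN.
  have e : (4 * (N - i) + 2 + 4 * i = 4 * N + 2)%N by lia.
  have := Hq phi M t tp; rewrite e => /(_ hp t0); apply: bdW => //.
  rewrite ler_wpM2r ?(bd_ge0 hp)//; apply: le_trans (HK t t0); rewrite ler_wpM2l//.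
    exact: nneg_poly_ge0.
  by rewrite ler_expR -splitr.
have [K HK] := choice decay.
exists (\sum_(i < N.+1) K i); first by apply: sumr_ge0 => i _; exact: (HK i).1.
move=> phi M t i tp hp t0 iN; have := (HK i).2 phi M t tp hp t0 iN; apply: bdW => //.
rewrite ler_wpM2r ?(bd_ge0 hp)// ler_wpM2r ?expR_ge0//.
rewrite (bigD1 (Ordinal (iN : (i < N.+1)%N)))//= lerDl; apply: sumr_ge0 => k _.
exact: (HK k).1.
Qed.

(** Common truncation, at degree N in tau, of the evolution of the v_n over a time tau and of one
    Euler step. *)
Definition taylor_part phi tau t x : R :=
  \sum_(n < N.+1) tau ^+ n * \sum_(j < n.+1) j`!%:R^-1 * iter j Lc (centered phi t) n x.

Lemma iter_conv_centered phi t j n : torus_smooth phi -> 0 <= t ->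
  iter j.+1 Lc (fun k => v phi k t) n = iter j.+1 Lc (centered phi t) n.
Proof.
move=> tp t0; apply: (iter_conv_cst f_smooth sigma_smooth (limit phi)) => k.
exact: (ts_expansion f_smooth sigma_smooth Hv k tp t0).
Qed.

(** The term tau^i v_i is expanded in time to order N + 1 - i, so every remainder carries tau^(N+1).
    The remainders contain at least one factor L_k and therefore see only the centered functions,
    which decay. *)
Lemma time_expansion : exists2 C, 0 <= C & forall phi M tau t x, torus_smooth phi ->
  bd (4 * N + 2) phi M -> 0 < tau -> 0 <= t ->
  `|\sum_(i < N.+1) tau ^+ i * centered phi (t + tau) i x - taylor_part phi tau t x|
    <= C * tau ^+ N.+1 * (expR (- a * t) * M).
Proof.
have [K K0 HK] := centered_bound.
have remainder (j : nat) : exists C, 0 <= C /\ forall phi M t x, torus_smooth phi ->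
    bd (4 * N + 2) phi M -> 0 <= t -> (0 < j <= N.+1)%N ->
    `|iter j Lc (fun k => v phi k t) N.+1 x| <= C * (expR (- a * t) * M).
  have [C C0 HC] := iter_conv_bd f_smooth sigma_smooth j N.+1 0.
  exists (C * K); split; first exact: mulr_ge0.
  move=> phi M t x tp hp t0 /andP[]; case: j C C0 HC => // j C C0 HC _ jN.
  rewrite (iter_conv_centered _ _ tp t0).
  have -> : C * K * (expR (- a * t) * M) = C * (K * expR (- a * t) * M) by ring.
  apply: bd0; apply: HC (ts_centered tp t0) _ => i ij.
  by apply: bdW (HK phi M t i tp hp t0 _); [clear -ij; lia|exact: lexx|clear -ij; lia].
have [C HC] := choice remainder.
exists (\sum_(i < N.+1) C (N.+1 - i)%N).
  by apply: sumr_ge0 => i _; exact: (HC _).1.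
move=> phi M tau t x tp hp tau0 t0.
have M0 := bd_ge0 hp; have ttau0 : 0 <= t + tau by rewrite addr_ge0// ltW.
pose T (i j : nat) : R := tau ^+ (i + j) * (j`!%:R^-1 * iter j Lc (centered phi t) (i + j)%N x).
have -> : taylor_part phi tau t x = \sum_(i < N.+1) \sum_(k < N.+1 - i) T i k.
  rewrite sum_antidiagonal; apply: eq_bigr => n _; rewrite mulr_sumr; apply: eq_bigr => k _.
  have kn : (k <= n)%N by rewrite -ltnS.
  by rewrite /T (subnK kn).
rewrite -sumrB; apply: le_trans (ler_norm_sum _ _ _) _.
rewrite -[leRHS]mulrA mulr_suml; apply: ler_sum => i _.
have iN : (i <= N)%N by rewrite -ltnS.
have -> : \sum_(k < N.+1 - i) T i k = tau ^+ i *
    \sum_(k < N.+1 - i) tau ^+ k / k`!%:R * iter k Lc (centered phi t) (i + k)%N x.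
  by rewrite mulr_sumr; apply: eq_bigr => k _; rewrite /T exprD; ring.
rewrite -mulrBr normrM ger0_norm ?exprn_ge0 ?(ltW tau0)//.
have [j jE] : exists j, (N.+1 - i = j.+1)%N by exists (N - i)%N; lia.
have := @time_taylor _ _ (N.+1 - i) (fun j t => iter j Lc (fun k => v phi k t) (i + j)%N) t tau
  (C (N.+1 - i)%N * (expR (- a * t) * M)) x t0 (ltW tau0) _ _ _.
(* Centering changes only the terms without operator, where the same limit is subtracted at t + tau
   and at t. *)
have -> : iter 0 Lc (fun k => v phi k (t + tau)) (i + 0)%N x -
     \sum_(j < N.+1 - i) tau ^+ j / j`!%:R * iter j Lc (fun k => v phi k t) (i + j)%N x =
   centered phi (t + tau) i x -
     \sum_(k < N.+1 - i) tau ^+ k / k`!%:R * iter k Lc (centered phi t) (i + k)%N x.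
  rewrite jE !big_ord_recl /= addn0 expr0 fact0 divr1 !mul1r.
  set S1 := \sum_(k < j) _; set S2 := \sum_(k < j) _.
  have -> : S1 = S2.
    apply: eq_bigr => k _; congr (_ * _).
    exact: (congr1 (fun g => g x) (iter_conv_centered k (i + k.+1)%N tp t0)).
  by rewrite /centered; ring.
move=> H; apply: le_trans (ler_wpM2l _ (H _ _ _)) _; first by rewrite exprn_ge0// ltW.
- move=> k _; have := iter_conv_time_derivative f_smooth sigma_smooth Hv k (i + k)%N tp.
  by rewrite addnS.
- rewrite jE.
  have [_ e _] := iter_conv_time_derivative f_smooth sigma_smooth Hv j (i + j)%N tp.
  by rewrite addnS.
- move=> s ts _; have s0 := le_trans t0 ts.
  rewrite subnKC; last exact: ltnW.
  apply: le_trans ((HC _).2 phi M s x tp hp s0 _) _.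
    by rewrite subn_gt0 ltn_ord leq_subr.
  rewrite ler_wpM2l ?(HC _).1// ler_wpM2r// ler_expR !mulNr lerN2 ler_wpM2l//.
  exact: ltW.
have -> : tau ^+ N.+1 = tau ^+ i * tau ^+ (N.+1 - i) by rewrite -exprD subnKC// ltnW.
rewrite [leRHS](_ : _ = tau ^+ i * (C (N.+1 - i)%N * (expR (- a * t) * M) * tau ^+ (N.+1 - i)));
  last by ring.
rewrite ler_wpM2l ?exprn_ge0 ?(ltW tau0)// ler_wpM2l//.
  by rewrite mulr_ge0 ?(HC _).1// mulr_ge0// expR_ge0.
rewrite ler_pdivrMr ?ltr0n ?fact_gt0// ler_peMr ?exprn_ge0 ?(ltW tau0)//.
by rewrite ler1n fact_gt0.
Qed.

Section Process.
Context {dsp : measure_display} {Omega : measurableType dsp}.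
Variables (P : probability Omega R) (F : R -> set (set Omega)).
Variable W : 'I_m -> R -> Omega -> R.
Hypotheses (HF : is_filtration F) (HW : is_wiener P F W).
Local Notation E := (Ex P).

Lemma summable_ts psi s (X : Omega -> 'rV[R]_d) : torus_smooth psi -> 0 <= s ->
  vadapted F s X -> summable P (fun w => psi (X w)).
Proof.
move=> tp s0 aX; have [M HM] := ts_bd 0 tp.
apply: (summable_adapted P HF s0 (adapted_coef HF s0 aX tp)) => w.
exact: bd0 HM.
Qed.

Definition corrected phi tau t x : R := \sum_(i < N.+1) tau ^+ i * centered phi t i x.

Lemma ts_corrected phi tau t : torus_smooth phi -> 0 <= t ->
  torus_smooth (corrected phi tau t).
Proof. by move=> tp t0; apply: ts_sum => i _; exact: (tsZ _ (ts_centered tp t0 i)). Qed.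

Lemma taylor_part_Aop phi tau t s X : torus_smooth phi -> 0 <= t -> 0 <= s ->
  vadapted F s X ->
  summable P (fun w => taylor_part phi tau t (X w)) /\
  E (fun w => taylor_part phi tau t (X w)) = \sum_(i < N.+1) tau ^+ i *
    \sum_(k < N.+1 - i) tau ^+ k * E (fun w => Aop f sigma k (centered phi t i) (X w)).
Proof.
move=> tp t0 s0 aX; have tc := ts_centered tp t0.
have tA k i : torus_smooth (Aop f sigma k (centered phi t i)).
  exact: diffop_ts (Aop_diffop f_smooth sigma_smooth k) (tc i).
have iA k i := summable_ts (tA k i) s0 aX.
have E1 x : taylor_part phi tau t x =
    \sum_(n < N.+1) tau ^+ n * \sum_(k < n.+1) Aop f sigma k (centered phi t (n - k)%N) x.
  apply: eq_bigr => n _; congr (_ * _).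
  exact: (esym (congr1 (fun g => g x) (Aop_exp f_smooth sigma_smooth n tc))).
have i1 n := summable_sum (index_enum 'I_n.+1) (fun k : 'I_n.+1 => iA k (n - k)%N).
have i2 n := summableZ (tau ^+ n) (i1 n).
have i3 := summable_sum (index_enum 'I_N.+1) (fun n : 'I_N.+1 => i2 n).
have -> : (fun w => taylor_part phi tau t (X w)) = (fun w => \sum_(n < N.+1) tau ^+ n *
    \sum_(k < n.+1) Aop f sigma k (centered phi t (n - k)%N) (X w)).
  by apply/funext => w; exact: E1.
split; first exact: i3.
pose G (i k : nat) : R := tau ^+ (i + k) * E (fun w => Aop f sigma k (centered phi t i) (X w)).
rewrite (Ex_sum _ (fun n : 'I_N.+1 => i2 n)).
transitivity (\sum_(n < N.+1) \sum_(k < n.+1) G (n - k)%N k).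
  apply: eq_bigr => n _; rewrite (ExZ _ (i1 n)).
  rewrite (Ex_sum _ (fun k : 'I_n.+1 => iA k (n - k)%N)) mulr_sumr; apply: eq_bigr => k _.
  have kn : (k <= n)%N by rewrite -ltnS.
  by rewrite /G (subnK kn).
rewrite -sum_antidiagonal; apply: eq_bigr => i _; rewrite mulr_sumr; apply: eq_bigr => k _.
by rewrite /G exprD mulrA.
Qed.

End Process.

(** Both expectations are compared with that of [taylor_part]: the Euler side by an expansion of
    order N + 1 - i for each i, the other side pointwise. The constant is chosen before the
    probability space. *)
Lemma local_error : exists2 C, 0 <= C &
  forall (dsp : measure_display) (Omega : measurableType dsp) (P : probability Omega R)
    (F : R -> set (set Omega)) (W : 'I_m -> R -> Omega -> R),
  is_filtration F -> is_wiener P F W ->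
  forall phi M tau t s X, torus_smooth phi -> bd (4 * N + 2) phi M -> 0 < tau -> 0 <= t ->
  0 <= s -> vadapted F s X ->
  `|Ex P (fun w => corrected phi tau t (flow W f sigma X s tau w)) -
    Ex P (fun w => corrected phi tau (t + tau) (X w))|
  <= C * tau ^+ N.+1 * (expR (- a * t) * M).
Proof.
have [K K0 HK] := centered_bound; have [Ct Ct0 HCt] := time_expansion.
have [Cf Cf0 HCf] := iter_frozen_bd f_smooth sigma_smooth.
pose Cs := \sum_(i < N.+1) Cf ^+ (N.+1 - i) * K.
have Cs0 : 0 <= Cs by apply: sumr_ge0 => i _; rewrite mulr_ge0 ?exprn_ge0.
exists (Cs + Ct); first exact: addr_ge0.
move=> dsp Omega P F W HF HW phi M tau t s X tp hp tau0 t0 s0 aX.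
have tau0' := ltW tau0; have tt0 := addr_ge0 t0 tau0'; have st0 := addr_ge0 s0 tau0'.
have aY := vadapted_flow HF HW f_smooth sigma_smooth s0 tau0' aX.
have tc := ts_centered tp t0.
have [iT ET] := taylor_part_Aop P HF tau tp t0 s0 aX.
set Y := flow W f sigma X s tau in aY *.
have iY i := summable_ts P HF (tc i) st0 aY.
have i1 := summable_ts P HF (ts_corrected tau tp tt0) s0 aX.
have Hs : `|Ex P (fun w => corrected phi tau t (Y w)) -
    Ex P (fun w => taylor_part phi tau t (X w))| <= Cs * tau ^+ N.+1 * (expR (- a * t) * M).
  rewrite ET /corrected (Ex_sum _ (fun i : 'I_N.+1 => summableZ (tau ^+ i) (iY i))) -sumrB.
  apply: le_trans (ler_norm_sum _ _ _) _.
  rewrite -[leRHS]mulrA mulr_suml; apply: ler_sum => i _.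
  have iN : (i <= N)%N by rewrite -ltnS.
  rewrite (ExZ _ (iY i)) -mulrBr normrM ger0_norm ?exprn_ge0//.
  have b : bd (2 * (N.+1 - i)) (centered phi t i) (K * expR (- a * t) * M).
    by apply: bdW (HK phi M t i tp hp t0 iN); [clear -iN; lia|exact: lexx].
  have := one_step_bound HF HW f_smooth sigma_smooth HCf (tc i) b s0 tau0 aX.
  move/(ler_wpM2l (exprn_ge0 i tau0')) => /le_trans; apply.
  have -> : tau ^+ N.+1 = tau ^+ i * tau ^+ (N.+1 - i) by rewrite -exprD subnKC// ltnW.
  by rewrite [leRHS](_ : _ = tau ^+ i * (Cf ^+ (N.+1 - i) * (K * expR (- a * t) * M) *
    tau ^+ (N.+1 - i)))//; ring.
have Ht : `|Ex P (fun w => corrected phi tau (t + tau) (X w)) -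
    Ex P (fun w => taylor_part phi tau t (X w))| <= Ct * tau ^+ N.+1 * (expR (- a * t) * M).
  rewrite -(ExB i1 iT); apply: (Ex_bound (summableB i1 iT)) => w.
  exact: HCt.
rewrite mulrDl mulrDl.
rewrite -[X in `|X|](subrKA (Ex P (fun w => taylor_part phi tau t (X w)))).
by apply: le_trans (ler_normD _ _) _; apply: lerD => //; rewrite distrC.
Qed.

(** Telescoping along the path: time is traded between the process and the expansion, one step at a
    time. The local error at the j-th step decays with the time p - j - 1 steps that the expansion
    still has to run, so the sum is geometric. *)
Lemma global_error : exists2 C, 0 <= C &
  forall (dsp : measure_display) (Omega : measurableType dsp) (P : probability Omega R)
    (F : R -> set (set Omega)) (W : 'I_m -> R -> Omega -> R),
  is_filtration F -> is_wiener P F W ->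
  forall phi M tau p x, torus_smooth phi -> bd (4 * N + 2) phi M -> 0 < tau ->
  `|Ex P (fun w => phi (euler f sigma W tau x p w)) -
    \sum_(n < N.+1) tau ^+ n * v phi n (p%:R * tau) x|
  <= C * (a^-1 + tau) * tau ^+ N * M.
Proof.
have [C C0 HC] := local_error; exists C; first exact: C0.
move=> dsp Omega P F W HF HW phi M tau p x tp hp tau0.
have tau0' := ltW tau0; have M0 := bd_ge0 hp.
have nt0 n : 0 <= n%:R * tau := mulr_ge0 (ler0n _ n) tau0'.
have aX n := vadapted_euler HF HW f_smooth sigma_smooth x n tau0.
(* For j = p this is the mean of phi(X_p), for j = 0 it is v^(N)(t_p, x), both up to the same
   constant. *)
pose J j := Ex P (fun w => corrected phi tau ((p - j)%:R * tau) (euler f sigma W tau x j w)).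
have step j : (j < p)%N ->
    `|J j.+1 - J j| <= C * tau ^+ N.+1 * (expR (- a * ((p - j.+1)%:R * tau)) * M).
  move=> jp; rewrite /J (euler_flow _ _ _ _ _ tau0').
  have := HC _ _ P F W HF HW phi M tau ((p - j.+1)%:R * tau) (j%:R * tau)
    (euler f sigma W tau x j) tp hp tau0 (nt0 _) (nt0 _) (aX j).
  suff -> : (p - j.+1)%:R * tau + tau = (p - j)%:R * tau by [].
  have -> : (p - j = p - j.+1 + 1)%N by clear -jp; lia.
  by rewrite natrD mulrDl mul1r.
have tele j : (j <= p)%N -> `|J j - J 0%N| <=
    \sum_(i < j) C * tau ^+ N.+1 * (expR (- a * ((p - i.+1)%:R * tau)) * M).
  elim: j => [|j IH] jp; first by rewrite subrr normr0 big_ord0.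
  rewrite big_ord_recr /= addrC -[X in `|X|](subrKA (J j)).
  apply: le_trans (ler_normD _ _) _; apply: lerD; first exact: step.
  exact: IH (ltnW jp).
(* The centering constant depends neither on t nor on X, so it cancels between the two ends of the
   telescoping sum. *)
have shift (X : Omega -> 'rV[R]_d) s t : 0 <= t -> 0 <= s -> vadapted F s X ->
    Ex P (fun w => corrected phi tau t (X w)) =
    Ex P (fun w => \sum_(n < N.+1) tau ^+ n * v phi n t (X w)) -
    \sum_(n < N.+1) tau ^+ n * limit phi n.
  move=> t0 s0 aXs.
  have iv n := summableZ (tau ^+ n)
    (summable_ts P HF (ts_expansion f_smooth sigma_smooth Hv n tp t0) s0 aXs).
  have ic : summable P (fun=> \sum_(n < N.+1) tau ^+ n * limit phi n).
    by apply: (@bounded_summable _ _ _ _ _ `|\sum_(n < N.+1) tau ^+ n * limit phi n|) => //.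
  rewrite -[in RHS](Ex_cst P (\sum_(n < N.+1) tau ^+ n * limit phi n)).
  rewrite -(ExB (summable_sum (index_enum 'I_N.+1) (fun n : 'I_N.+1 => iv n)) ic).
  congr (Ex P _); apply/funext => w; rewrite /corrected -sumrB; apply: eq_bigr => n _.
  by rewrite -mulrBr.
have Jp : J p = Ex P (fun w => phi (euler f sigma W tau x p w)) -
    \sum_(n < N.+1) tau ^+ n * limit phi n.
  rewrite /J subnn mul0r (shift _ (p%:R * tau) 0 (lexx _) (nt0 p) (aX p)).
  congr (_ - _); congr (Ex P _); apply/funext => w.
  have v0 n := (expansion_source f_smooth sigma_smooth Hv n tp).2.2.
  rewrite big_ord_recl /= expr0 mul1r (v0 0%N) big1 ?addr0// => n _.
  by rewrite (v0 n.+1) mulr0.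
have J0 : J 0%N = \sum_(n < N.+1) tau ^+ n * v phi n (p%:R * tau) x -
    \sum_(n < N.+1) tau ^+ n * limit phi n.
  rewrite /J subn0 (shift _ (0%:R * tau) (p%:R * tau) (nt0 p) (nt0 0%N) (aX 0%N)).
  by rewrite /= Ex_cst.
have := tele p (leqnn p); rewrite Jp J0 opprB addrA subrK => /le_trans; apply.
rewrite (reindex_inj rev_ord_inj) /=.
have -> : \sum_(i < p) C * tau ^+ N.+1 * (expR (- a * ((p - (p - i.+1).+1)%:R * tau)) * M) =
    C * tau ^+ N * M * \sum_(i < p) tau * expR (- a * (i%:R * tau)).
  rewrite mulr_sumr; apply: eq_bigr => i _.
  have -> : (p - (p - i.+1).+1 = i)%N by have := ltn_ord i; clear; lia.
  by rewrite exprS; ring.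
have -> : C * (a^-1 + tau) * tau ^+ N * M = C * tau ^+ N * M * (a^-1 + tau) by ring.
rewrite ler_wpM2l ?mulr_ge0 ?exprn_ge0//; exact: geometric_expR_bound.
Qed.

End GlobalError.

Lemma euler_meanE {R : realType} (d m : nat) (f : 'rV[R]_d -> 'rV[R]_d)
    (sigma : 'rV[R]_d -> 'M[R]_(d, m)) (dsp : measure_display) (Omega : measurableType dsp)
    (P : probability Omega R) (W : 'I_m -> R -> Omega -> R) tau phi p x :
  euler_mean f sigma P W tau phi p x = Ex P (fun w => phi (euler f sigma W tau x p w)).
Proof. by rewrite /euler_mean unlock. Qed.

Theorem theorem5p3 (R : realType) (d m : nat)
  (f : 'rV[R]_d -> 'rV[R]_d) (sigma : 'rV[R]_d -> 'M[R]_(d, m))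
  (f_smooth : forall i, torus_smooth (fun x => f x 0 i))
  (sigma_smooth : forall i l, torus_smooth (fun x => sigma x i l))
  (rho : 'rV[R]_d -> R) (lambda : R)
  (H1 : invariant_density f sigma rho)
  (H2 : adjoint_solvable f sigma rho)
  (H3 : exponential_decay f sigma rho lambda)
  (v : ('rV[R]_d -> R) -> nat -> R -> 'rV[R]_d -> R)
  (Hv : forall phi, torus_smooth phi -> is_expansion f sigma phi (v phi))
  (mu : nat -> 'rV[R]_d -> R)
  (Hmu : is_measure_expansion f sigma rho mu)
  (tau0 : R) (tau0_gt0 : 0 < tau0) (N : nat) :
  exists (C : R) (PN : {poly R}),
  forall (dsp : measure_display) (Omega : measurableType dsp)
    (P : probability Omega R) (F : R -> set (set Omega))
    (W : 'I_m -> R -> Omega -> R),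
  is_filtration F -> is_wiener P F W ->
  forall tau : R, 0 < tau -> tau <= tau0 ->
  forall phi : 'rV[R]_d -> R, torus_smooth phi ->
  (forall p : nat, let t := p%:R * tau in
    (supnorm (fun x => (euler_mean f sigma P W tau phi p x -
                        partial_sum tau N (fun n => v phi n t) x)%R)
      <= (C * tau ^+ N)%:E * Cnorm (8 * N + 2) phi)%E) /\
  (forall p : nat, let t := p%:R * tau in
    (supnorm (fun x => (euler_mean f sigma P W tau phi p x -
                        torus_int (fun y => phi y * partial_sum tau N mu y))%R)
      <= (PN.[t] * expR (- lambda * t) + C * tau ^+ N)%:E *
         Cnorm (8 * N + 2) phi)%E).
Proof.
have [C C0 HC] := global_error f_smooth sigma_smooth H1 H3 Hv Hmu N.
have /choice[q Hq] : forall n, exists q : {poly R}, nneg_poly q /\ forall phi M t,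
    torus_smooth phi -> bd (4 * n) phi M -> 0 <= t ->
    bd 0 (fun x => v phi n t x - torus_int (fun y => phi y * mu n y))
      (q.[t] * expR (- lambda * t) * M).
  move=> n; have [q nq Hq] := expansion_decay f_smooth sigma_smooth H1 H3 Hv Hmu n 0.
  by exists q.
(* The factor 1/a + tau of the geometric sum is made uniform by tau <= tau0; likewise tau0^n
   replaces tau^n in the polynomial below. *)
pose C' := C * ((lambda / 2)^-1 + tau0).
exists C', (\sum_(n < N.+1) tau0 ^+ n *: q n).
move=> dsp Omega P F W HF HW tau tau_gt0 tau_le phi tphi.
have [M HM ->] := Cnorm_bd (8 * N + 2) tphi.
have M0 := bd_ge0 HM.
have weak p x : let t := p%:R * tau in
    `|euler_mean f sigma P W tau phi p x - partial_sum tau N (fun n => v phi n t) x|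
    <= C' * tau ^+ N * M.
  have b : bd (4 * N + 2) phi M by apply: bdW HM; [clear; lia|exact: lexx].
  move=> t; rewrite euler_meanE.
  apply: le_trans (HC _ _ P F W HF HW phi M tau p x tphi b tau_gt0) _.
  rewrite ler_wpM2r// ler_wpM2r ?exprn_ge0 ?(ltW tau_gt0)//.
  by apply: ler_wpM2l => //; rewrite lerD2l.
split => p; cbv zeta; rewrite -EFinM; apply: supnorm_le => x; first exact: weak.
set t := p%:R * tau.
have t0 : 0 <= t by rewrite mulr_ge0// ltW.
have -> : torus_int (fun y => phi y * partial_sum tau N mu y) =
    \sum_(n < N.+1) tau ^+ n * torus_int (fun y => phi y * mu n y).
  have tn n : torus_smooth (fun y => phi y * mu n y) := tsM tphi (ts_mu H1 Hmu n).
  have -> : (fun y => phi y * partial_sum tau N mu y) =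
      fun y => \sum_(n < N.+1) tau ^+ n * (phi y * mu n y).
    apply/funext => y; rewrite /partial_sum mulr_sumr; apply: eq_bigr => n _.
    by rewrite mulrCA.
  rewrite (torus_int_sum _ (fun (n : 'I_N.+1) _ => tsZ (tau ^+ n) (tn n))); apply: eq_bigr => n _.
  exact: torus_intZ (tn n).
(* Passing through v^(N)(t_p, x): its distance to the integral against mu^(N) is controlled term by
   term by the decay of the v_n. *)
rewrite -[X in `|X|](subrKA (partial_sum tau N (fun n => v phi n t) x)).
apply: le_trans (ler_normD _ _) _; rewrite addrC mulrDl; apply: lerD; last exact: weak.
rewrite /partial_sum -sumrB; apply: le_trans (ler_norm_sum _ _ _) _.
rewrite horner_sum !mulr_suml; apply: ler_sum => n _.
have b : bd (4 * n) phi M.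
  by apply: bdW HM; [have := ltn_ord n; clear; lia|exact: lexx].
rewrite -mulrBr normrM ger0_norm ?exprn_ge0 ?(ltW tau_gt0)// hornerZ -!mulrA [X in _ <= _ * X]mulrA.
have [nq /(_ phi M t tphi b t0)/bd0 H] := Hq n.
apply: ler_pM (H x) => //; first by rewrite exprn_ge0// ltW.
by rewrite lerXn2r ?nnegrE ?(ltW tau_gt0) ?(ltW tau0_gt0).
Qed.
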